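(* Let $\mathcal{E}$ be a finite-dimensional complex Hilbert space, and let $R = VW^*$, where $V$ and $W$ are two bi-inner rational functions in $H^\infty(\mathcal{E},\mathcal{E})$. Let $\{A_v \text{ on } \mathcal{X}_v, B_v, C_v, D_v\}$ and $\{A_w \text{ on } \mathcal{X}_w, B_w, C_w, D_w\}$ be stable unitary realizations of $V$ and $W$, respectively. Let $\Omega:\mathcal{X}_w\to\mathcal{X}_v$ be the unique solution of the Stein equation $$\Omega = A_v\Omega A_w^* + B_vB_w^*.$$ Let $C_\circ:\mathcal{X}_w\to\mathcal{E}$ be defined by $$C_\circ = D_vB_w^* + C_v\Omega A_w^*.$$ Let $Q:\mathcal{X}_w\to\mathcal{X}_w$ be the unique solution of the Stein equation $$Q = A_wQA_w^* + C_\circ^*C_\circ.$$ Let $-\kappa_1,\ldots,-\kappa_p$ with $\kappa_1\ge\kappa_2\ge\cdots\ge\kappa_p$ (all $\kappa_j\geq 1$) be the negative Wiener-Hopf indices of $R$. Then the following holds. 1. The operator $Q$ is a positive contraction (i.e. $0\le Q\le I$). 2. The multiplicity of $1$ as an eigenvalue of $Q$ equals $\mathfrak{n}(T_R)$, i.e. $\mathfrak{n}(T_R)=\mathfrak{n}(I-Q)$. Moreover, for $k=0,1,2,\ldots,p$, $$\mathfrak{n}(T_{z^kR}) = \dim\ker\left(I - A_w^kQA_w^{*k}\right).$$ 3. For $k=1,2,\ldots$ put $$\mu_k = \mathfrak{n}\left(I-A_w^{k-1}Q(A_w^* )^{k-1}\right) - \mathfrak{n}\left(I-A_w^kQA_w^{*k}\right).$$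 Then the number of negative Wiener-Hopf indices of $R$ is $p=\mu_1$, and they are given by $$\kappa_j = \#\{k : \mu_k\ge j\},\qquad j=1,\ldots,p=\mu_1.$$
   Context: $\mathcal{E}$ is a finite-dimensional complex Hilbert space. $H^\infty(\mathcal{E},\mathcal{E})$ is the space of bounded analytic functions on the open unit disc with values in the linear operators on $\mathcal{E}$. $\Theta\in H^\infty(\mathcal{E},\mathcal{E})$ is bi-inner if $\Theta(e^{i\omega})$ is unitary for almost every $\omega$. A realization $\{A \text{ on } \mathcal{X},B,C,D\}$ of $\Theta$ consists of a finite-dimensional Hilbert space $\mathcal{X}$ and operators $A:\mathcal{X}\to\mathcal{X}$, $B:\mathcal{E}\to\mathcal{X}$, $C:\mathcal{X}\to\mathcal{E}$, $D:\mathcal{E}\to\mathcal{E}$ with $\Theta(z)=D+zC(I-zA)^{-1}B$ near $z=0$. It is stable if all eigenvalues of $A$ lie in the open unit disc, and unitary if $\begin{bmatrix}A&B\\C&D\end{bmatrix}$ is a unitary operator on $\mathcal{X}\oplus\mathcal{E}$. $W^*(z)=\bigl(W(1/\overline{z})\bigr)^*$, so that $R(e^{i\omega})=V(e^{i\omega})W(e^{i\omega})^*$. For $F(e^{i\omega})=\sum_{n=-\infty}^\infty e^{in\omega}F_n$, $T_F$ denotes the Toeplitz operator $[F_{i-j}]_{i,j\ge0}$ on $\ell^2_+(\mathcal{E})$. $z^kR$ denotes the function $z\mapsto z^kR(z)$. $\mathfrak{n}(T)=\dim\ker T$, and $\#E$ is the number of elements of the set $E$. Wiener-Hopf indices: with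 $m=\dim\mathcal{E}$, a (right) Wiener-Hopf factorization of $R$ with respect to the unit circle is $R(z)=W_-(z)\,\mathrm{diag}(z^{\lambda_j})_{j=1}^m\,W_+(z)$, where $W_-$ and its inverse are analytic outside the open unit disc including infinity, $W_+$ and its inverse are analytic on the closed unit disc, and $\lambda_j\in\mathbb{Z}$. The integers $\lambda_1,\dots,\lambda_m$ are uniquely determined by $R$ up to order (with repetitions) and are called the Wiener-Hopf indices of $R$; the negative ones are listed (with repetition) as $-\kappa_1,\dots,-\kappa_p$. *)

(* Defs.v *)
From HB Require Import structures.
From mathcomp Require Import all_boot all_order all_algebra.
From mathcomp Require Import complex.
From mathcomp Require Import all_classical all_reals all_analysis.

Set Implicit Arguments.
Unset Strict Implicit.
Unset Printing Implicit Defensive.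

Import Order.TTheory GRing.Theory Num.Theory.
Import numFieldNormedType.Exports.

Local Open Scope classical_set_scope.
Local Open Scope ring_scope.
Local Open Scope sesquilinear_scope.

(* The complex numbers, packed as a [numClosedFieldType] so that the generic
   topology of [numFieldType]s is found.  The order on [Cx R] is partial:
   [0 <= z] means that [z] is real and nonnegative; norms [`|z|] are real
   elements of [Cx R]. *)
Definition Cx (R : realType) : numClosedFieldType := R[i].

(* The Hilbert spaces [E], [X_v], [X_w] are [C^m], [C^n1], [C^n2] (column
   vectors, standard inner product); operators are matrices acting on the left
   and [A ^t*] is the adjoint. *)

Definition analytic_at (R : realType) (f : Cx R -> Cx R) (z0 : Cx R) : Prop :=
  exists2 r : Cx R, 0 < r & exists a : nat -> Cx R,
    forall h : Cx R, `|h| < r ->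
      series (fun n => a n * h ^+ n) @ \oo --> f (z0 + h).

Definition analytic_at_infty (R : realType) (f : Cx R -> Cx R) : Prop :=
  exists2 r : Cx R, 0 < r & exists a : nat -> Cx R,
    forall z : Cx R, r < `|z| ->
      series (fun n => a n * z ^- n) @ \oo --> f z.

Definition mx_analytic_at (R : realType) (m : nat)
    (F : Cx R -> 'M[Cx R]_m) (z0 : Cx R) : Prop :=
  forall i j, analytic_at (fun z => F z i j) z0.

Definition mx_analytic_at_infty (R : realType) (m : nat)
    (F : Cx R -> 'M[Cx R]_m) : Prop :=
  forall i j, analytic_at_infty (fun z => F z i j).

(* A rational function is represented by a total function whose values are
   irrelevant at its poles only: since [p / q] is in lowest terms, removable
   singularities are filled in. *)
Definition rational_fun (R : realType) (f : Cx R -> Cx R) : Prop :=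
  exists p q : {poly Cx R}, [/\ q != 0, coprimep p q &
    forall z, q.[z] != 0 -> f z = p.[z] / q.[z]].

Definition mx_rational (R : realType) (m : nat) (F : Cx R -> 'M[Cx R]_m) : Prop :=
  forall i j, rational_fun (fun z => F z i j).

Definition Hinfty (R : realType) (m : nat) (F : Cx R -> 'M[Cx R]_m) : Prop :=
  (forall z, `|z| < 1 -> mx_analytic_at F z) /\
  (exists M : Cx R, forall z, `|z| < 1 -> forall i j, `|F z i j| <= M).

Definition expi (R : realType) (w : R) : Cx R := Complex (cos w) (sin w).

(* A rational function in H^infty has no pole on the unit circle, so its
   boundary values are its values there. *)
Definition bi_inner (R : realType) (m : nat) (F : Cx R -> 'M[Cx R]_m) : Prop :=
  {ae @lebesgue_measure R, forall w : R, F (expi w) \is unitarymx}.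

Definition realization (R : realType) (m n : nat) (F : Cx R -> 'M[Cx R]_m)
    (A : 'M[Cx R]_n) (B : 'M[Cx R]_(n, m)) (C : 'M[Cx R]_(m, n))
    (D : 'M[Cx R]_m) : Prop :=
  \forall z \near (0 : Cx R),
    F z = D + z *: (C *m invmx (1%:M - z *: A) *m B).

Definition stable (R : realType) (n : nat) (A : 'M[Cx R]_n) : Prop :=
  forall a, eigenvalue A a -> `|a| < 1.

Definition stable_unitary_realization (R : realType) (m n : nat)
    (F : Cx R -> 'M[Cx R]_m) (A : 'M[Cx R]_n) (B : 'M[Cx R]_(n, m))
    (C : 'M[Cx R]_(m, n)) (D : 'M[Cx R]_m) : Prop :=
  [/\ realization F A B C D, stable A & block_mx A B C D \is unitarymx].

(* [W^*(z) = W(1 / conj z)^*], used for [z != 0] only *)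
Definition star_fun (R : realType) (m : nat) (W : Cx R -> 'M[Cx R]_m) :
    Cx R -> 'M[Cx R]_m :=
  fun z => (W ((z^*)^-1)) ^t*.

Definition psdmx (R : realType) (n : nat) (A : 'M[Cx R]_n) : Prop :=
  forall x : 'cV[Cx R]_n, 0 <= (x ^t* *m A *m x) 0 0.

(* the dimension of [{x | A *m x = 0}]: these [x] form the column space of
   [cokermx A] *)
Definition nullity (R : realType) (n : nat) (A : 'M[Cx R]_n) : nat :=
  \rank (cokermx A).

Definition circle_mean (R : realType) (f : R -> Cx R) : Cx R :=
  Complex
    ((2 * pi)^-1 * \int[@lebesgue_measure R]_(w in `[0, 2 * pi]) complex.Re (f w))
    ((2 * pi)^-1 * \int[@lebesgue_measure R]_(w in `[0, 2 * pi]) complex.Im (f w)).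

Definition fourier (R : realType) (m : nat) (F : Cx R -> 'M[Cx R]_m) (n : int) :
    'M[Cx R]_m :=
  \matrix_(i, j) circle_mean (fun w => (expi w ^ (- n))%R * F (expi w) i j).

Definition ell2 (R : realType) (m : nat) (h : nat -> 'cV[Cx R]_m) : Prop :=
  cvgn (series (fun n => \sum_(i < m) `|h n i 0| ^+ 2)).

(* For [h] in [ell2] and [F] bounded on the circle, all the series below
   converge (Cauchy-Schwarz), so the total operator [limn] is harmless. *)
Definition toeplitz (R : realType) (m : nat) (F : Cx R -> 'M[Cx R]_m)
    (h : nat -> 'cV[Cx R]_m) : nat -> 'cV[Cx R]_m :=
  fun i => \col_l limn (series (fun j : nat =>
    (fourier F (i%:Z - j%:Z) *m h j) l 0)).

Definition toeplitz_ker (R : realType) (m : nat) (F : Cx R -> 'M[Cx R]_m) :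
    set (nat -> 'cV[Cx R]_m) :=
  [set h | ell2 h /\ forall i, toeplitz F h i = 0].

(* [S] is a subspace of dimension [d]: it is the span of [d] linearly
   independent elements. *)
Definition has_dim (R : realType) (m : nat) (S : set (nat -> 'cV[Cx R]_m))
    (d : nat) : Prop :=
  exists b : 'I_d -> nat -> 'cV[Cx R]_m,
    (forall c : 'I_d -> Cx R,
       (forall n, \sum_i c i *: b i n = 0) -> forall i, c i = 0) /\
    S = [set h | exists c : 'I_d -> Cx R, forall n, h n = \sum_i c i *: b i n].

Definition nullity_toeplitz (R : realType) (m : nat) (F : Cx R -> 'M[Cx R]_m)
    (d : nat) : Prop :=
  has_dim (toeplitz_ker F) d.

Definition wiener_hopf_indices (R : realType) (m : nat)
    (F : Cx R -> 'M[Cx R]_m) (lambda : 'I_m -> int) : Prop :=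
  exists Wm Wp : Cx R -> 'M[Cx R]_m,
  [/\ (forall z, 1 <= `|z| -> [/\ Wm z \in unitmx, mx_analytic_at Wm z &
                                  mx_analytic_at (fun u => invmx (Wm u)) z]),
      mx_analytic_at_infty Wm /\ mx_analytic_at_infty (fun u => invmx (Wm u)),
      (forall z, `|z| <= 1 -> [/\ Wp z \in unitmx, mx_analytic_at Wp z &
                                  mx_analytic_at (fun u => invmx (Wp u)) z]) &
      forall z, `|z| = 1 ->
        F z = Wm z *m diag_mx (\row_j (z ^ lambda j)%R) *m Wp z].

(* [kappa] lists, in nonincreasing order and with repetition, the opposites of
   the negative elements of the family [lambda]. *)
Definition negative_indices (m : nat) (lambda : 'I_m -> int) (kappa : seq nat) :
    Prop :=
  sorted geq kappa /\
  perm_eq [seq - k%:Z | k <- kappa] [seq l <- codom lambda | l < 0].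

(* Main.v *)
(* Write [R_k = z^k R], [A, B, C, D] for the realization of [W], and [Omega] for the
   solution of the first Stein equation.

   Multiplying the two unitary realizations expresses [R] on the circle as a causal plus an
   anticausal transfer function, so that [T_R h] is the output of the stable system of [V]
   driven by a state which itself runs backwards through the adjoint system of [W].
   Unitarity makes both systems invertible: the output vanishes only if all states of the
   first one do, and then [h_n = C A^n x] with [Omega x = 0].  The Stein equation for [Q] is
   solved by [1 - Omega^* Omega], which turns the condition on [x] (for [R_k]: [x] is in the
   range of [A^k] on vectors unobservable for [k] steps) into
   [(1 - A^k Q (A^* )^k) x = 0]; the pair [C, A] is observable, so the dimensions agree.

   On the other side, [R = W_- diag(z^lambda_j) W_+] gives
   [dim ker T_(R_k) = sum_j max(0, - lambda_j - k)], because [R_k h] has no nonnegative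
   Fourier coefficient iff [z^(lambda_j + k) (W_+ h)_j] has none for all [j].  This uses
   that the factors are rational, by Liouville, hence have geometrically decaying one-sided
   Fourier coefficients.  The differences [mu_k] then form the conjugate partition of the
   [kappa_j]. *)
Require Import Defs.
From HB Require Import structures.
From mathcomp Require Import all_boot all_order all_algebra.
From mathcomp Require Import complex.
From mathcomp Require Import all_classical all_reals all_analysis.
From mathcomp Require Import measurable_realfun.
From mathcomp Require Import ring lra zify.

Set Implicit Arguments.
Unset Strict Implicit.
Unset Printing Implicit Defensive.

Import Order.TTheory GRing.Theory Num.Theory.
Import numFieldNormedType.Exports.

Local Open Scope classical_set_scope.
Local Open Scope card_scope.
Local Open Scope ring_scope.
Local Open Scope sesquilinear_scope.


(** * Complex modulus and geometric convergence *)

Section Modulus.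
Variable K : realType.
Implicit Types x y z : Cx K.

(** A quantity that does not depend on [N] is shown to vanish by bounding it by [c * q ^+ N] for
    every [N]; this is why expansions are carried with an explicit geometric remainder. Two
    obstacles shape the proof. An element of a Toeplitz kernel is a priori just a square summable
    sequence. The state space computation therefore precedes the index count: it shows the element
    to be [C A^n x], and the count then deals only with functions [C (1 - z A)^{-1} x], which are
    analytic across the circle. Secondly, the Wiener-Hopf factors are given by a local power series
    at each point of their closed domains. On the circle W_+ = diag(z^{-lambda_j}) W_-^{-1} R;
    clearing denominators turns each entry of W_+ into a function analytic in the disc that equals
    z^N times a function analytic outside, hence into a polynomial. Liouville's theorem is drawn
    from the maximum principle for local power series, applied to two functions glued along the
    circle. *)

Definition cabs z : K := complex.Re `|z|.

Lemma normE z : `|z| = (cabs z)%:C%C.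
Proof. by rewrite /cabs /Cx normc_def. Qed.

Lemma cabs_sqrt z :
  cabs z = Num.sqrt (complex.Re z ^+ 2 + complex.Im z ^+ 2).
Proof. by rewrite /cabs /Cx normc_def. Qed.

Lemma cabs_ge0 z : 0 <= cabs z.
Proof. by rewrite cabs_sqrt sqrtr_ge0. Qed.

Lemma cabsE_inj (a b : K) : ((a%:C)%C = (b%:C)%C :> Cx K) -> a = b.
Proof. by case. Qed.

Lemma cabsD x y : cabs (x + y) <= cabs x + cabs y.
Proof. by have := ler_normD x y; rewrite !normE -rmorphD lecR. Qed.

Lemma cabsM x y : cabs (x * y) = cabs x * cabs y.
Proof. by apply: cabsE_inj; rewrite rmorphM -!normE normrM. Qed.

Lemma cabsN x : cabs (- x) = cabs x.
Proof. by rewrite /cabs normrN. Qed.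

Lemma cabsB x y : cabs (x - y) <= cabs x + cabs y.
Proof. by rewrite -(cabsN y) cabsD. Qed.

Lemma cabs_distC x y : cabs (x - y) = cabs (y - x).
Proof. by rewrite /cabs distrC. Qed.

Lemma cabs0 : cabs 0 = 0.
Proof. by rewrite /cabs normr0. Qed.

Lemma cabs1 : cabs 1 = 1.
Proof. by rewrite /cabs normr1. Qed.

Lemma cabs_eq0 x : (cabs x == 0) = (x == 0).
Proof.
rewrite -[RHS]normr_eq0 normE; apply/eqP/eqP => [-> //|/cabsE_inj //].
Qed.

Lemma cabs_gt0 x : (0 < cabs x) = (x != 0).
Proof. by rewrite lt0r cabs_eq0 cabs_ge0 andbT. Qed.

Lemma cabs_le0 x : cabs x <= 0 -> x = 0.
Proof. by move=> h; apply/eqP; rewrite -cabs_eq0 eq_le h cabs_ge0. Qed.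

Lemma cabsX x n : cabs (x ^+ n) = cabs x ^+ n.
Proof. by elim: n => [|n IH]; rewrite ?expr0 ?cabs1 // !exprS cabsM IH. Qed.

Lemma cabsV x : cabs x^-1 = (cabs x)^-1.
Proof. by apply: cabsE_inj; rewrite fmorphV -!normE normfV. Qed.

Lemma cabs_conj z : cabs z^* = cabs z.
Proof. by rewrite /cabs norm_conjC. Qed.

Lemma cabs_real (a : K) : cabs (a%:C)%C = `|a|.
Proof. by rewrite cabs_sqrt /= expr0n addr0 sqrtr_sqr. Qed.

Lemma cabs_sum (I : Type) (r : seq I) (P : pred I) (f : I -> Cx K) :
  cabs (\sum_(i <- r | P i) f i) <= \sum_(i <- r | P i) cabs (f i).
Proof.
elim/big_rec2: _ => [|i a b _ h]; first by rewrite cabs0.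
by apply: le_trans (cabsD _ _) _; rewrite lerD2l.
Qed.

Lemma norm_Re_le z : `|complex.Re z| <= cabs z.
Proof.
rewrite cabs_sqrt -sqrtr_sqr ler_sqrt ?addr_ge0 ?sqr_ge0 //.
by rewrite lerDl sqr_ge0.
Qed.

Lemma norm_Im_le z : `|complex.Im z| <= cabs z.
Proof.
rewrite cabs_sqrt -sqrtr_sqr ler_sqrt ?addr_ge0 ?sqr_ge0 //.
by rewrite lerDr sqr_ge0.
Qed.

Lemma cabs_ReIm z : cabs z <= `|complex.Re z| + `|complex.Im z|.
Proof.
have {1}-> : z = (complex.Re z)%:C%C + (Complex 0 1) * (complex.Im z)%:C%C.
  exact: complexE.
apply: le_trans (cabsD _ _) _; rewrite cabsM !cabs_real.
have -> : cabs (Complex 0 1) = 1.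
  by rewrite cabs_sqrt /= expr0n /= expr1n add0r sqrtr1.
by rewrite mul1r.
Qed.

Lemma norm_leR z (a : K) : (`|z| <= (a%:C)%C) = (cabs z <= a).
Proof. by rewrite normE lecR. Qed.

Lemma norm_ltR z (a : K) : (`|z| < (a%:C)%C) = (cabs z < a).
Proof. by rewrite normE ltcR. Qed.

Lemma norm_gtR z (a : K) : ((a%:C)%C < `|z|) = (a < cabs z).
Proof. by rewrite normE ltcR. Qed.

Lemma norm_le1 z : (`|z| <= 1) = (cabs z <= 1).
Proof. by rewrite -norm_leR. Qed.

Lemma norm_ge1 z : (1 <= `|z|) = (1 <= cabs z).
Proof. by rewrite normE -lecR. Qed.

Lemma norm_lt1 z : (`|z| < 1) = (cabs z < 1).
Proof. by rewrite -norm_ltR. Qed.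

Lemma norm_eq1 z : (`|z| = 1) <-> (cabs z = 1).
Proof. by rewrite normE; split => [/cabsE_inj//|->]. Qed.

Lemma gt0_Cx z : 0 < z -> exists2 a : K, 0 < a & z = (a%:C)%C.
Proof.
case: z => a b; rewrite ltcE /= => /andP[/eqP -> a0]; by exists a.
Qed.

End Modulus.

(** * Geometric bounds and limits *)

Section Limits.
Variable K : realType.

Lemma exprn_small (q e : K) : 0 <= q < 1 -> 0 < e -> exists N, q ^+ N < e.
Proof.
move=> /andP[q0 q1] e0.
have /cvgrPdist_lt/(_ _ e0) : (fun n => q ^+ n) @ \oo --> (0 : K).
  by apply: cvg_expr; rewrite ger0_norm.
move=> [N _ /(_ N (leqnn N))] /=.
by rewrite sub0r normrN ger0_norm ?exprn_ge0 //; exists N.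
Qed.

(** Identities between limits are proved through this: the difference is free of [N] and is bounded
    by [c * q ^+ N] for every [N]. *)
Lemma le0_geometric (x c q : K) :
  0 <= q < 1 -> (forall N, x <= c * q ^+ N) -> x <= 0.
Proof.
move=> q01 h; rewrite leNgt; apply/negP => x0.
have c0 : 0 < c by have := h 0%N; rewrite expr0 mulr1; apply: lt_le_trans.
have [N hN] := exprn_small q01 (divr_gt0 x0 c0).
have := h N; rewrite leNgt => /negP; apply.
by rewrite mulrC -ltr_pdivlMr.
Qed.

Lemma cabs0_geometric (x : Cx K) (c q : K) :
  0 <= q < 1 -> (forall N, cabs x <= c * q ^+ N) -> x = 0.
Proof. by move=> q01 h; apply: cabs_le0; apply: le0_geometric q01 h. Qed.

Lemma cvg_CxP (u : nat -> Cx K) (l : Cx K) :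
  u @ \oo --> l <->
  (forall e : K, 0 < e -> exists N, forall n, (N <= n)%N -> cabs (l - u n) < e).
Proof.
split.
  move=> /cvgrPdist_lt h e e0.
  have /h : 0 < (e%:C%C : Cx K) by rewrite ltcR.
  by move=> [N _ hN]; exists N => n /hN /=; rewrite norm_ltR.
move=> h; apply/cvgrPdist_lt => e /gt0_Cx[a a0 ->].
have [N hN] := h a a0.
by exists N => // n /= /hN; rewrite norm_ltR.
Qed.

Lemma real_cauchy_lim (u : nat -> K) (c q : K) : 0 <= q < 1 ->
  (forall n, `|u n| <= c * q ^+ n) ->
  cvgn (series u).
Proof.
move=> /andP[q0 q1] h; apply: normed_cvg.
apply: (@series_le_cvg _ _ (fun n => c * q ^+ n)) => //=.
- by move=> n; apply: le_trans (h n).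
- by apply: is_cvg_geometric_series; rewrite ger0_norm.
Qed.

Lemma geometric_partial_le (c q : K) n m : 0 <= q < 1 -> 0 <= c ->
  \sum_(n <= i < m) c * q ^+ i <= c / (1 - q) * q ^+ n.
Proof.
move=> /andP[q0 q1] c0.
have [mn|nm] := leqP m n.
  rewrite big_geq // !mulr_ge0 ?exprn_ge0 ?invr_ge0 //; lra.
have e k : (1 - q) * \sum_(n <= i < n + k) c * q ^+ i = c * q ^+ n - c * q ^+ (n + k).
  elim: k => [|k IH]; first by rewrite addn0 big_geq // mulr0 subrr.
  by rewrite addnS big_nat_recr ?leq_addr //= mulrDr IH exprS; ring.
have := e (m - n)%N; rewrite subnKC ?(ltnW nm) // => e'.
have q1' : 0 < 1 - q by lra.
rewrite -(ler_pM2l q1') e' (_ : (1 - q) * _ = c * q ^+ n); last first.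
  by field; rewrite lt0r_neq0.
by rewrite lerBlDr lerDl mulr_ge0 ?exprn_ge0.
Qed.

(** Real and imaginary parts converge by comparison, and the factor 2 adds their remainders. The
    rate is kept because limits are used later in this form. *)
Lemma geometric_lim (u : nat -> Cx K) (c q : K) : 0 <= q < 1 ->
  (forall n, cabs (u n) <= c * q ^+ n) ->
  exists l, forall N, cabs (l - \sum_(0 <= n < N) u n) <= c / (1 - q) * 2 * q ^+ N.
Proof.
move=> q01 h.
have c0 : 0 <= c by have := h 0%N; rewrite expr0 mulr1; apply: le_trans (cabs_ge0 _).
have part (v : nat -> K) : (forall n, `|v n| <= c * q ^+ n) ->
    forall N, `|limn (series v) - \sum_(0 <= n < N) v n| <= c / (1 - q) * q ^+ N.
  move=> hv N.
  have cv := real_cauchy_lim q01 hv.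
  have cv2 : (fun n => `|series v n - series v N|) @ \oo -->
      `|limn (series v) - series v N|.
    by apply: cvg_norm; apply: cvgB => //; apply: cvg_cst.
  rewrite -[X in `|X|]/(limn (series v) - series v N).
  apply: (@cvgr_to_le _ _ _ _ (fun n => `|series v n - series v N|)) cv2 _.
  exists N => // n /= Nn.
  rewrite sub_series Nn; apply: le_trans (ler_norm_sum _ _ _) _.
  apply: le_trans (geometric_partial_le N n q01 c0).
  by apply: ler_sum => i _; exact: hv.
have hr := part (fun n => complex.Re (u n)) (fun n => le_trans (norm_Re_le _) (h n)).
have hi := part (fun n => complex.Im (u n)) (fun n => le_trans (norm_Im_le _) (h n)).
exists (Complex (limn (series (fun n => complex.Re (u n))))
                (limn (series (fun n => complex.Im (u n))))) => N; apply: le_trans (cabs_ReIm _) _.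
have -> : c / (1 - q) * 2 * q ^+ N = c / (1 - q) * q ^+ N + c / (1 - q) * q ^+ N by ring.
apply: lerD.
  rewrite [X in `|X|](_ : _ = limn (series (fun n => complex.Re (u n))) - \sum_(0 <= n < N) complex.Re (u n)); first exact: hr.
  by rewrite (raddfB (@complex.Re K : Rcomplex K -> K)) (raddf_sum (@complex.Re K : Rcomplex K -> K)).
rewrite [X in `|X|](_ : _ = limn (series (fun n => complex.Im (u n))) - \sum_(0 <= n < N) complex.Im (u n)); first exact: hi.
by rewrite (raddfB (@complex.Im K : Rcomplex K -> K)) (raddf_sum (@complex.Im K : Rcomplex K -> K)).
Qed.

End Limits.

(** * Matrix norm and decay of the powers of a stable matrix *)

Section MatrixNorm.
Variable K : realType.

(** This norm is submultiplicative, invariant under the adjoint, and dominates every entry. *)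
Definition mnorm m n (A : 'M[Cx K]_(m, n)) : K := \sum_i \sum_j cabs (A i j).

Lemma mnorm_ge0 m n (A : 'M[Cx K]_(m, n)) : 0 <= mnorm A.
Proof. by apply: sumr_ge0 => i _; apply: sumr_ge0 => j _; apply: cabs_ge0. Qed.

Lemma cabs_le_mnorm m n (A : 'M[Cx K]_(m, n)) i j : cabs (A i j) <= mnorm A.
Proof.
rewrite /mnorm (bigD1 i) //= (bigD1 j) //= -addrA lerDl addr_ge0 //.
  by apply: sumr_ge0 => k _; apply: cabs_ge0.
by apply: sumr_ge0 => k _; apply: sumr_ge0 => l _; apply: cabs_ge0.
Qed.

Lemma mnorm_le0 m n (A : 'M[Cx K]_(m, n)) : mnorm A <= 0 -> A = 0.
Proof.
move=> h; apply/matrixP => i j; rewrite mxE; apply: cabs_le0.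
exact: le_trans (cabs_le_mnorm A i j) h.
Qed.

Lemma mnorm0 m n : mnorm (0 : 'M[Cx K]_(m, n)) = 0.
Proof. by rewrite /mnorm big1 // => i _; rewrite big1 // => j _; rewrite mxE cabs0. Qed.

Lemma mnormD m n (A B : 'M[Cx K]_(m, n)) : mnorm (A + B) <= mnorm A + mnorm B.
Proof.
rewrite /mnorm -big_split; apply: ler_sum => i _ /=.
by rewrite -big_split; apply: ler_sum => j _ /=; rewrite mxE cabsD.
Qed.

Lemma mnormZ m n (a : Cx K) (A : 'M[Cx K]_(m, n)) : mnorm (a *: A) = cabs a * mnorm A.
Proof.
rewrite /mnorm mulr_sumr; apply: eq_bigr => i _.
by rewrite mulr_sumr; apply: eq_bigr => j _; rewrite mxE cabsM.
Qed.

Lemma mnormM m n p (A : 'M[Cx K]_(m, n)) (B : 'M[Cx K]_(n, p)) :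
  mnorm (A *m B) <= mnorm A * mnorm B.
Proof.
rewrite {1 2}/mnorm mulr_suml; apply: ler_sum => i _.
apply: (@le_trans _ _ (\sum_k \sum_j cabs (A i j) * cabs (B j k))).
  apply: ler_sum => k _; rewrite mxE; apply: le_trans (cabs_sum _ _ _) _.
  by apply: ler_sum => j _; rewrite cabsM.
rewrite exchange_big mulr_suml; apply: ler_sum => j _ /=.
rewrite -mulr_sumr ler_wpM2l ?cabs_ge0 // /mnorm [leRHS](bigD1 j) //= lerDl.
by apply: sumr_ge0 => k _; apply: sumr_ge0 => l _; apply: cabs_ge0.
Qed.

Lemma mnorm_adj m n (A : 'M[Cx K]_(m, n)) : mnorm (A ^t*) = mnorm A.
Proof.
rewrite /mnorm exchange_big; apply: eq_bigr => i _; apply: eq_bigr => j _.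
by rewrite !mxE cabs_conj.
Qed.

Lemma mnorm0_geometric m n (A : 'M[Cx K]_(m, n)) (c q : K) : 0 <= q < 1 ->
  (forall N, mnorm A <= c * q ^+ N) -> A = 0.
Proof. by move=> q01 h; apply: mnorm_le0; apply: le0_geometric q01 h. Qed.

(** With [d = u 0 + c / (q - a)] one has [a d + c <= q d], so the bound [d q^k] passes from [k] to
    [k + 1]. *)
Lemma geometric_recursion (u w : nat -> K) (a c q : K) : 0 <= a < q -> 0 <= c ->
  0 <= u 0%N ->
  (forall k, u k.+1 <= a * u k + w k) -> (forall k, w k <= c * q ^+ k) ->
  exists2 d, 0 <= d & forall k, u k <= d * q ^+ k.
Proof.
move=> /andP[a0 aq] c0 u0 hu hw.
have qa : 0 < q - a by lra.
exists (u 0%N + c / (q - a)); first by rewrite addr_ge0 // divr_ge0 // ltW.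
elim => [|k IH]; first by rewrite expr0 mulr1 lerDl divr_ge0 // ltW.
apply: le_trans (hu k) _; apply: le_trans (lerD (ler_wpM2l a0 IH) (hw k)) _.
have -> : a * ((u 0%N + c / (q - a)) * q ^+ k) + c * q ^+ k =
   (a * (u 0%N + c / (q - a)) + c) * q ^+ k by ring.
have -> : (u 0%N + c / (q - a)) * q ^+ k.+1 = q * (u 0%N + c / (q - a)) * q ^+ k.
  by rewrite exprS; ring.
rewrite ler_pM2r ?exprn_gt0 //; last lra.
rewrite -subr_ge0.
have -> : (q * (u 0%N + c / (q - a)) - (a * (u 0%N + c / (q - a)) + c)) = (q - a) * u 0%N.
  by field; rewrite lt0r_neq0.
by rewrite mulr_ge0 // ltW.
Qed.

(** One factor is peeled off at a time: with [Y = A X - a X] one has [A^{k+1} X = a A^k X + A^k Y],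
    where [A^k Y] decays by induction. *)
Lemma geometric_annihilated n p (A : 'M[Cx K]_n) (s : seq (Cx K)) (q : K) :
  {in s, forall a, cabs a < q} -> 0 <= q -> forall X : 'M[Cx K]_(n, p),
  foldl (fun Y a => A *m Y - a *: Y) X s = 0 ->
  exists2 c, 0 <= c & forall k, mnorm (A ^+ k *m X) <= c * q ^+ k.
Proof.
move=> + q0; elim: s => [|a s IH] hs X /=.
  move=> ->; exists 0 => // k.
  by rewrite mulmx0 mnorm0 mul0r.
move=> /IH [|c c0 hc]; first by move=> b bs; apply: hs; rewrite inE bs orbT.
apply: (@geometric_recursion _ (fun k => mnorm (A ^+ k *m (A *m X - a *: X))) (cabs a) c) => //.
- by rewrite cabs_ge0 /= hs // mem_head.
- by rewrite mnorm_ge0.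
- move=> k; rewrite -mnormZ; apply: le_trans (mnormD _ _).
  by rewrite mulmxBr -scalemxAr addrC subrK exprSr mulmxA.
Qed.

Lemma foldl_horner_mx n p (A : 'M[Cx K]_n.+1) (s : seq (Cx K)) (X : 'M[Cx K]_(n.+1, p)) :
  foldl (fun Y a => A *m Y - a *: Y) X s =
  horner_mx A (\prod_(a <- s) ('X - a%:P)) *m X.
Proof.
elim: s X => [|a s IH] X /=; first by rewrite big_nil rmorph1 mul1mx.
rewrite IH big_cons mulrC rmorphM /= -mulmxE -mulmxA; congr (_ *m _).
by rewrite rmorphB /= horner_mx_X horner_mx_C mulmxBl mul_scalar_mx.
Qed.

(** By Cayley-Hamilton the linear factors of the characteristic polynomial annihilate the identity
    matrix; [q] is any bound below 1 that exceeds the moduli of the finitely many eigenvalues. *)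
Lemma stable_geometric n (A : 'M[Cx K]_n) : stable A ->
  exists c q, [/\ 0 <= c, 0 < q < 1 & forall k, mnorm (A ^+ k) <= c * q ^+ k].
Proof.
case: n A => [|n] A sA.
  exists 0, (1 / 2); split=> //; first by apply/andP; split; lra.
  by move=> k; rewrite mul0r /mnorm big_ord0.
have [s hs] : exists s : seq (Cx K), char_poly A = \prod_(a <- s) ('X - a%:P).
  have [s hs] := closed_field_poly_normal (char_poly A).
  by exists s; rewrite hs (monicP (char_poly_monic A)) scale1r.
have s1 : {in s, forall a, cabs a < 1}.
  move=> a a_s; rewrite -norm_lt1; apply: sA.
  by rewrite eigenvalue_root_char hs root_prod_XsubC.
have [q q01 sq] : exists2 q : K, 0 < q < 1 & {in s, forall a, cabs a < q}.
  elim: s s1 {hs} => [|a s IH] s1; first by exists (1 / 2) => //; apply/andP; split; lra.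
  have [q /andP[q0 q1] hq] := IH (fun b bs => s1 b (mem_behead (s := a :: s) bs)).
  have a1 := s1 a (mem_head _ _).
  exists (Num.max q ((1 + cabs a) / 2)).
    by rewrite lt_max q0 gt_max q1 /=; lra.
  move=> b; rewrite inE => /predU1P[->|/hq bq]; rewrite lt_max ?bq //.
  by apply/orP; right; lra.
case/andP: q01 => q0 q1.
have [] := @geometric_annihilated _ _ A s q sq (ltW q0) (1%:M : 'M[Cx K]_n.+1).
  by rewrite foldl_horner_mx -hs Cayley_Hamilton mul0mx.
move=> c c0 hc; exists c, q; split=> //; first by rewrite q0.
by move=> k; have := hc k; rewrite mulmx1.
Qed.

End MatrixNorm.

Section Adjoint.
Variable C : numClosedFieldType.

Lemma hadjM m n p (A : 'M[C]_(m, n)) (B : 'M[C]_(n, p)) : (A *m B) ^t* = B ^t* *m A ^t*.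
Proof. by rewrite trmx_mul map_mxM. Qed.

Lemma hadjD m n (A B : 'M[C]_(m, n)) : (A + B) ^t* = A ^t* + B ^t*.
Proof. by rewrite linearD /= map_mxD. Qed.

Lemma hadjB m n (A B : 'M[C]_(m, n)) : (A - B) ^t* = A ^t* - B ^t*.
Proof. by rewrite linearB /= map_mxB. Qed.

Lemma hadj1 n : (1%:M : 'M[C]_n) ^t* = 1%:M.
Proof. by rewrite trmx1 map_mx1. Qed.

Lemma hadjX n (A : 'M[C]_n) k : (A ^+ k) ^t* = (A ^t*) ^+ k.
Proof.
elim: k => [|k IH]; first by rewrite !expr0 hadj1.
by rewrite exprS exprSr -IH -!mulmxE hadjM.
Qed.

Lemma adj_mul_ge0 m n (A : 'M[C]_(m, n)) (x : 'cV[C]_n) :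
  0 <= (x ^t* *m (A ^t* *m A) *m x) 0 0.
Proof.
rewrite mulmxA -mulmxA -hadjM mxE; apply: sumr_ge0 => i _.
by rewrite !mxE mulrC mul_conjC_ge0.
Qed.

Lemma adj_mul_eq0 n (x : 'cV[C]_n) : (x ^t* *m x) 0 0 = 0 -> x = 0.
Proof.
rewrite mxE => /eqP; rewrite psumr_eq0 => [/allP h|i _]; last first.
  by rewrite !mxE mulrC mul_conjC_ge0.
apply/matrixP => i j; rewrite [j]ord1 [RHS]mxE.
have /= := h i (mem_index_enum _); rewrite !mxE mulrC mul_conjC_eq0.
by move/eqP.
Qed.

Lemma unitary_block m n (A : 'M[C]_n) (B : 'M[C]_(n, m)) (X : 'M[C]_(m, n)) (D : 'M[C]_m) :
  block_mx A B X D \is unitarymx ->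
  [/\ A *m A ^t* + B *m B ^t* = 1%:M, A *m X ^t* + B *m D ^t* = 0,
      X *m A ^t* + D *m B ^t* = 0 & X *m X ^t* + D *m D ^t* = 1%:M] /\
  [/\ A ^t* *m A + X ^t* *m X = 1%:M, A ^t* *m B + X ^t* *m D = 0,
      B ^t* *m A + D ^t* *m X = 0 & B ^t* *m B + D ^t* *m D = 1%:M].
Proof.
move=> h; move: (h) => /unitarymxP; move: h; rewrite -trmxC_unitary => /unitarymxP.
rewrite trmxCK tr_block_mx map_block_mx !mulmx_block.
rewrite !(scalar_mx_block _ _ 1).
by move=> /eq_block_mx[-> -> -> ->] /eq_block_mx[-> -> -> ->].
Qed.

End Adjoint.

(** * Stein equations *)

Section Stein.
Variable K : realType.

Lemma nonincreasing_le0 (C : numDomainType) (f : nat -> C) :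
  (forall N, 0 <= f N - f N.+1) -> forall N, f N <= f 0%N.
Proof.
by move=> h; elim=> // N IH; apply: le_trans IH; rewrite -subr_ge0.
Qed.

Lemma mulmx_expS n p (A : 'M[Cx K]_n) (X : 'M[Cx K]_(n, p)) k :
  A ^+ k.+1 *m X = A *m (A ^+ k *m X).
Proof. by rewrite exprS -mulmxE mulmxA. Qed.

Lemma le_ReIm (x y : Cx K) : x <= y ->
  complex.Re x <= complex.Re y /\ complex.Im x = complex.Im y.
Proof. by rewrite lecE => /andP[/eqP -> ->]. Qed.

Lemma stein_iter n p (A : 'M[Cx K]_n) (B : 'M[Cx K]_p) (X : 'M[Cx K]_(n, p)) k :
  X = A *m X *m B -> X = A ^+ k *m X *m B ^+ k.
Proof.
move=> h; elim: k => [|k IH]; first by rewrite !expr0 mul1mx mulmx1.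
by rewrite {1}IH {1}h exprSr exprS -!mulmxE !mulmxA.
Qed.

(** Iteration gives [X = A^k X B^{*k}], and the right side decays geometrically. *)
Lemma stein_unique n p (A : 'M[Cx K]_n) (B : 'M[Cx K]_p) (X : 'M[Cx K]_(n, p)) :
  stable A -> stable B -> X = A *m X *m B ^t* -> X = 0.
Proof.
move=> /stable_geometric[c [q [c0 /andP[q0 q1] hA]]].
move=> /stable_geometric[d [r [d0 /andP[r0 r1] hB]]] hX.
apply: (@mnorm0_geometric _ _ _ _ (c * mnorm X * d) q) => [|N].
  by rewrite ltW.
rewrite {1}(stein_iter N hX) -hadjX.
apply: le_trans (mnormM _ _) _; rewrite mnorm_adj.
apply: le_trans (ler_wpM2r (mnorm_ge0 _) (mnormM _ _)) _.
have -> : c * mnorm X * d * q ^+ N = c * q ^+ N * mnorm X * d by ring.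
rewrite ler_pM ?mulr_ge0 ?mnorm_ge0 ?exprn_ge0 ?(ltW q0) //.
  by rewrite ler_wpM2r ?mnorm_ge0.
apply: le_trans (hB N) _; rewrite ler_piMr // exprn_ile1 // ?ltW //.
Qed.

(** The numbers [e N = x^* A^N Q A^{*N} x] decrease, since [e N - e N.+1] is the square norm of
    [X A^{*N} x], and they tend to 0; hence [e 0] is nonnegative. *)
Lemma psdmx_stein n p (A Q : 'M[Cx K]_n) (X : 'M[Cx K]_(p, n)) : stable A ->
  Q = A *m Q *m A ^t* + X ^t* *m X -> psdmx Q.
Proof.
move=> /stable_geometric[c [q [c0 /andP[q0 q1] hA]]] hQ x.
pose e N := ((x ^t* *m (A ^+ N *m Q *m (A ^t*) ^+ N) *m x) 0 0).
have eS N : 0 <= e N - e N.+1.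
  rewrite /e {1}hQ exprSr exprS -!mulmxE mulmxDr mulmxDl mulmxDr mulmxDl.
  rewrite [X in X - _]mxE !mulmxA addrAC subrr add0r.
  have := adj_mul_ge0 (X *m (A ^t*) ^+ N) x.
  by rewrite hadjM hadjX trmxCK !mulmxA.
have eN N : e N <= e 0%N.
  exact: nonincreasing_le0 eS N.
have -> : (x ^t* *m Q *m x) 0 0 = e 0%N by rewrite /e !expr0 mul1mx mulmx1.
have small N : cabs (e N) <= mnorm x * (c * mnorm Q * c) * mnorm x * q ^+ N.
  apply: le_trans (cabs_le_mnorm _ _ _) _.
  apply: le_trans (mnormM _ _) _; rewrite mulrAC ler_wpM2r ?mnorm_ge0 //.
  apply: le_trans (mnormM _ _) _; rewrite mnorm_adj -[leRHS]mulrA ler_wpM2l ?mnorm_ge0 //.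
  apply: le_trans (mnormM _ _) _; rewrite -hadjX mnorm_adj.
  apply: (@le_trans _ _ (c * q ^+ N * mnorm Q * c)); last by rewrite le_eqVlt; apply/orP; left; apply/eqP; ring.
  apply: ler_pM; rewrite ?mnorm_ge0 //.
    by apply: le_trans (mnormM _ _) _; rewrite ler_wpM2r ?mnorm_ge0.
  by apply: le_trans (hA N) _; rewrite ler_piMr // exprn_ile1 // ltW.
have eN' N : complex.Re (e N) <= complex.Re (e 0%N) /\ complex.Im (e N) = complex.Im (e 0%N).
  exact: le_ReIm (eN N).
(* Comparable complex numbers have equal imaginary parts, so the imaginary part of [e N] is constant
   in [N] and vanishes in the limit; the real part decreases to 0. *)
rewrite lecE /=; apply/andP; split.
  apply/eqP; apply/eqP; rewrite -normr_le0.
  apply: (@le0_geometric _ _ (mnorm x * (c * mnorm Q * c) * mnorm x) q) => [|N]; first by rewrite ltW.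
  by rewrite -(eN' N).2; apply: le_trans (norm_Im_le _) (small N).
rewrite -oppr_le0.
apply: (@le0_geometric _ _ (mnorm x * (c * mnorm Q * c) * mnorm x) q) => [|N]; first by rewrite ltW.
apply: le_trans (small N); apply: le_trans (norm_Re_le _).
by rewrite -normrN; apply: le_trans (ler_norm _); rewrite lerN2; case: (eN' N).
Qed.

(** The sum telescopes because [B B^* = 1 - A A^*]. *)
Lemma contraction_defect m n (A : 'M[Cx K]_n) (B : 'M[Cx K]_(n, m)) k :
  A *m A ^t* + B *m B ^t* = 1%:M ->
  1%:M - A ^+ k *m (A ^t*) ^+ k =
  \sum_(j < k) A ^+ j *m (B *m B ^t*) *m (A ^t*) ^+ j.
Proof.
move=> h; elim: k => [|k IH]; first by rewrite big_ord0 !expr0 mulmx1 subrr.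
rewrite big_ord_recr /= -IH -(addKr (A *m A ^t*) (B *m B ^t*)) h.
rewrite mulmxDr mulmxDl mulmx1 exprSr exprS -!mulmxE mulmxN mulNmx !mulmxA.
by rewrite [- _ + _]addrC addrA subrK.
Qed.

Variables (m nv nw : nat).
Variables (Av : 'M[Cx K]_nv) (Bv : 'M[Cx K]_(nv, m)) (Cv : 'M[Cx K]_(m, nv)) (Dv : 'M[Cx K]_m).
Variables (A : 'M[Cx K]_nw) (B : 'M[Cx K]_(nw, m)) (C : 'M[Cx K]_(m, nw)) (D : 'M[Cx K]_m).
Hypothesis Av_stable : stable Av.
Hypothesis A_stable : stable A.
Hypothesis Uv : block_mx Av Bv Cv Dv \is unitarymx.
Hypothesis U : block_mx A B C D \is unitarymx.
Variables (Omega : 'M[Cx K]_(nv, nw)) (C0 : 'M[Cx K]_(m, nw)) (Q : 'M[Cx K]_nw).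
Hypothesis Omega_eq : Omega = Av *m Omega *m A ^t* + Bv *m B ^t*.
Hypothesis C0_def : C0 = Dv *m B ^t* + Cv *m Omega *m A ^t*.
Hypothesis Q_eq : Q = A *m Q *m A ^t* + C0 ^t* *m C0.

(* The unitary block of [V] maps the column [Omega A^*; B^*] to [Omega; C0], so both
   have the same Gram matrix; hence [1 - Omega^* Omega] solves the equation of [Q]. *)
Lemma stein_solution : Q = 1%:M - Omega ^t* *m Omega.
Proof.
have [[u1 _ _ _] _] := unitary_block U.
have gram : Omega ^t* *m Omega + C0 ^t* *m C0 =
            A *m (Omega ^t* *m Omega) *m A ^t* + B *m B ^t*.
  have colE p q r (P : 'M[Cx K]_(p, r)) (P' : 'M[Cx K]_(q, r)) :
      (col_mx P P') ^t* *m col_mx P P' = P ^t* *m P + P' ^t* *m P'.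
    by rewrite tr_col_mx map_row_mx mul_row_col.
  have img : block_mx Av Bv Cv Dv *m col_mx (Omega *m A ^t*) (B ^t*) = col_mx Omega C0.
    by rewrite mul_block_col !mulmxA -Omega_eq [X in col_mx _ X]addrC -C0_def.
  rewrite -colE -img hadjM -mulmxA [X in _ *m X]mulmxA.
  have -> : (block_mx Av Bv Cv Dv) ^t* *m block_mx Av Bv Cv Dv = 1%:M.
    by move: Uv; rewrite -trmxC_unitary => /unitarymxP; rewrite trmxCK.
  by rewrite mul1mx colE hadjM !trmxCK !mulmxA.
apply/eqP; rewrite -subr_eq0; apply/eqP; apply: (stein_unique A_stable A_stable).
rewrite {1}Q_eq !mulmxBr !mulmxBl mulmx1 -u1.
have -> : A *m (Omega ^t* *m Omega) *m A ^t* = Omega ^t* *m Omega + C0 ^t* *m C0 - B *m B ^t*.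
  by rewrite gram addrK.
move: (A *m Q *m _) (C0 ^t* *m C0) (A *m A ^t*) (B *m B ^t*) (Omega ^t* *m Omega).
move=> M1 M2 M3 M4 M5; apply/matrixP => i j; rewrite !mxE; ring.
Qed.

Lemma psdmx_contraction : psdmx (1%:M - Q).
Proof.
rewrite stein_solution opprB addrC subrK => x; exact: adj_mul_ge0.
Qed.

(** [1 - A^k Q A^{*k}] splits into [1 - A^k A^{*k}], a sum of squares by [contraction_defect], and
    the square [A^k Omega^* Omega A^{*k}]. A vector in the kernel of a sum of squares is killed by
    each of them. *)
Lemma defect_kernel k (x : 'cV[Cx K]_nw) :
  (1%:M - A ^+ k *m Q *m (A ^t*) ^+ k) *m x = 0 <->
  (forall j, (j < k)%N -> B ^t* *m ((A ^t*) ^+ j *m x) = 0) /\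
  Omega *m ((A ^t*) ^+ k *m x) = 0.
Proof.
have [[u1 _ _ _] _] := unitary_block U.
have -> : 1%:M - A ^+ k *m Q *m (A ^t*) ^+ k =
  \sum_(j < k) (B ^t* *m (A ^t*) ^+ j) ^t* *m (B ^t* *m (A ^t*) ^+ j) +
  (Omega *m (A ^t*) ^+ k) ^t* *m (Omega *m (A ^t*) ^+ k).
  rewrite stein_solution mulmxBr mulmxBl mulmx1 opprB addrCA addrC.
  rewrite (contraction_defect _ u1); congr (_ + _).
    by apply: eq_bigr => j _; rewrite hadjM hadjX !trmxCK !mulmxA.
  by rewrite hadjM hadjX !trmxCK !mulmxA.
split=> [h|[h1 h2]]; last first.
  rewrite mulmxDl mulmx_suml big1 => [|j _].
    by rewrite add0r -!mulmxA h2 !mulmx0.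
  by rewrite -!mulmxA h1 ?mulmx0.
have : (x ^t* *m (\sum_(j < k) (B ^t* *m (A ^t*) ^+ j) ^t* *m (B ^t* *m (A ^t*) ^+ j) +
  (Omega *m (A ^t*) ^+ k) ^t* *m (Omega *m (A ^t*) ^+ k)) *m x) 0 0 = 0.
  by rewrite -mulmxA h mulmx0 mxE.
rewrite mulmxDr mulmxDl mulmx_sumr mulmx_suml mxE summxE => /eqP.
have ge0 p (X : 'M[Cx K]_(p, nw)) : 0 <= (x ^t* *m (X ^t* *m X) *m x) 0 0.
  exact: adj_mul_ge0.
have eq0 p (X : 'M[Cx K]_(p, nw)) : (x ^t* *m (X ^t* *m X) *m x) 0 0 = 0 -> X *m x = 0.
  by move=> e; apply: adj_mul_eq0; rewrite hadjM !mulmxA in e *.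
rewrite paddr_eq0 ?sumr_ge0 // => /andP[].
rewrite psumr_eq0 // => /allP h1 /eqP h2; split.
  move=> j jk; rewrite mulmxA; apply: eq0; apply/eqP.
  exact: (h1 (Ordinal jk) (mem_index_enum _)).
by rewrite mulmxA; exact: eq0.
Qed.

(** By unitarity [A^*] maps the kernel of [B^*] into the kernel of [C], and [A] maps it back as the
    inverse. So [x] is recovered from [xi = A^{*k} x]. This is the form in which the Toeplitz
    computation delivers the kernel. *)
Lemma defect_kernel_image k (x : 'cV[Cx K]_nw) :
  (1%:M - A ^+ k *m Q *m (A ^t*) ^+ k) *m x = 0 <->
  exists xi : 'cV[Cx K]_nw, [/\ x = A ^+ k *m xi, Omega *m xi = 0 &
    forall j, (j < k)%N -> C *m (A ^+ j *m xi) = 0].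
Proof.
have [[u1 u2 u3 u4] [w1 w2 w3 w4]] := unitary_block U.
have AA' (y : 'cV_nw) : B ^t* *m y = 0 -> A *m (A ^t* *m y) = y.
  by move=> y0; rewrite -[RHS]mul1mx -u1 mulmxDl -!mulmxA y0 mulmx0 addr0.
have A'A (y : 'cV_nw) : C *m y = 0 -> A ^t* *m (A *m y) = y.
  by move=> y0; rewrite -[RHS]mul1mx -w1 mulmxDl -!mulmxA y0 mulmx0 addr0.
have CA' (y : 'cV_nw) : B ^t* *m y = 0 -> C *m (A ^t* *m y) = 0.
  by move=> y0; rewrite -[RHS](mul0mx _ y) -u3 mulmxDl -!mulmxA y0 mulmx0 addr0.
have B'A (y : 'cV_nw) : C *m y = 0 -> B ^t* *m (A *m y) = 0.
  by move=> y0; rewrite -[RHS](mul0mx _ y) -w3 mulmxDl -!mulmxA y0 mulmx0 addr0.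
split=> [/defect_kernel[h1 h2]|[xi [-> h2 h1]]].
  have step i : (i <= k)%N -> A ^+ i *m ((A ^t*) ^+ k *m x) = (A ^t*) ^+ (k - i) *m x.
    elim: i => [|i IH] ik; first by rewrite expr0 mul1mx subn0.
    rewrite mulmx_expS IH ?(ltnW ik) // -(subnSK ik) mulmx_expS AA' // h1 //; lia.
  exists ((A ^t*) ^+ k *m x); split=> //; first by rewrite step // subnn expr0 mul1mx.
  by move=> j jk; rewrite step ?(ltnW jk) // -(subnSK jk) mulmx_expS CA' // h1 //; lia.
have step j : (j <= k)%N -> (A ^t*) ^+ j *m (A ^+ k *m xi) = A ^+ (k - j) *m xi.
  elim: j => [|j IH] jk; first by rewrite expr0 mul1mx subn0.
  by rewrite mulmx_expS IH ?(ltnW jk) // -(subnSK jk) mulmx_expS A'A // h1 //; lia.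
apply/defect_kernel; split=> [j jk|]; last by rewrite step // subnn expr0 mul1mx.
by rewrite step ?(ltnW jk) // -(subnSK jk) mulmx_expS B'A // h1 //; lia.
Qed.

End Stein.

(** * Eigenvalue multiplicities of Hermitian matrices *)

Section Multiplicity.
Variable C : numClosedFieldType.

Lemma hermitian_spectral_decomposition n (Q : 'M[C]_n) : Q ^t* = Q ->
  exists P d, P \in unitmx /\ Q = invmx P *m diag_mx d *m P.
Proof.
move=> hQ.
have /orthomx_spectralP h : Q \is normalmx by apply/normalmxP; rewrite hQ.
by exists (spectralmx Q), (spectral_diag Q); split=> //; exact: spectral_unit.
Qed.

Lemma rank_diag_mx n (d : 'rV[C]_n) : \rank (diag_mx d) = (\sum_i (d ord0 i != 0%R)%R)%N.
Proof.
elim: n d => [|n IH] d; first by rewrite big_ord0; apply/eqP; rewrite -leqn0 rank_leq_row.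
rewrite -(@hsubmxK _ 1 1 n d); move: (lsubmx _) (rsubmx _) => l r.
have -> : \rank (diag_mx (row_mx l r)) = (\rank (diag_mx l) + \rank (diag_mx r))%N.
  by rewrite -rank_diag_block_mx -diag_mx_row.
rewrite IH (@big_split_ord _ _ _ 1 n) big_ord1 /=.
congr (_ + _)%N; last by apply: eq_bigr => i _; rewrite -[in LHS](row_mxEr l r).
have -> : row_mx l r ord0 (lshift n 0) = l ord0 0 by exact: row_mxEl.
rewrite rank_rV; congr (nat_of_bool (~~ _)).
apply/eqP/eqP => [/matrixP/(_ 0 0)|h]; first by rewrite !mxE /= mulr1n.
by apply/matrixP => k j; rewrite [k]ord1 [j]ord1 !mxE /= mulr1n.
Qed.

Lemma mup_prod_XsubC (I : Type) (r : seq I) (f : I -> C) a :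
  mup a (\prod_(i <- r) ('X - (f i)%:P)) = (\sum_(i <- r) (a == f i))%N.
Proof.
elim: r => [|i r IH]; first by rewrite !big_nil mupNroot // /root hornerE oner_eq0.
rewrite !big_cons mupM ?polyXsubC_eq0 ?monic_neq0 ?monic_prod_XsubC //.
rewrite IH; congr (_ + _)%N; rewrite -['X - _]expr1 mup_XsubCX eq_sym.
by case: eqP.
Qed.

(** After diagonalization both sides count the diagonal entries equal to [a]. *)
Lemma mup_char_poly_hermitian n (Q : 'M[C]_n) (a : C) : Q ^t* = Q ->
  mup a (char_poly Q) = (n - \rank (a%:M - Q)%R)%N.
Proof.
case/hermitian_spectral_decomposition => P [d [Pu ->]].
have -> : char_poly (invmx P *m diag_mx d *m P) = \prod_i ('X - (d 0 i)%:P).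
  transitivity (char_poly (diag_mx d)); last first.
    rewrite char_poly_trig ?diag_mx_is_trig //.
    by apply: eq_bigr => i _; rewrite mxE eqxx mulr1n.
  rewrite /char_poly.
  have -> : char_poly_mx (invmx P *m diag_mx d *m P) =
    map_mx polyC (invmx P) *m char_poly_mx (diag_mx d) *m map_mx polyC P.
    rewrite /char_poly_mx mulmxBr mulmxBl !map_mxM; congr (_ - _).
    by rewrite -mulmxA mul_scalar_mx -scalemxAr -map_mxM mulVmx // map_mx1 scalemx1.
  by rewrite !det_mulmx mulrC mulrA -det_mulmx -map_mxM mulmxV // map_mx1 det1 mul1r.
have -> : a%:M - invmx P *m diag_mx d *m P = invmx P *m diag_mx (\row_i (a - d 0 i)) *m P.
  have -> : diag_mx (\row_i (a - d 0 i)) = a%:M - diag_mx d.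
    by apply/matrixP => i j; rewrite !mxE; case: eqP => //=; rewrite ?mulr1n ?mulr0n ?subr0.
  by rewrite mulmxBr mulmxBl mul_mx_scalar -scalemxAl mulVmx // scalemx1.
rewrite mxrankMfree ?row_free_unit // eqmxMfull ?row_full_unit ?unitmx_inv //.
rewrite rank_diag_mx mup_prod_XsubC.
rewrite -[X in (X - _)%N]card_ord -sum1_card -sumnB => [|i _]; last by rewrite leq_b1.
by apply: eq_bigr => i _; rewrite mxE subr_eq0; case: eqP.
Qed.
End Multiplicity.

(** * Power series *)

Section PowerExpansion.
Variable K : realType.
Implicit Types (a b : nat -> Cx K) (F G h z : Cx K) (M q : K) (f g : Cx K -> Cx K).

(* [F = sum_n a_n h^n] with an explicit geometric remainder; in [ana] the ratio is
   proportional to [|h|], so that sums and products need no uniform convergence. *)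
Definition pexp a F h M q : Prop :=
  forall N, cabs (F - \sum_(n < N) a n * h ^+ n) <= M * q ^+ N.

Definition cauchy_prod a b n := \sum_(i < n.+1) a i * b (n - i)%N.

Lemma pexp_val a F h M q : pexp a F h M q -> cabs F <= M.
Proof. by move/(_ 0%N); rewrite big_ord0 subr0 expr0 mulr1. Qed.

Lemma pexp_M_ge0 a F h M q : pexp a F h M q -> 0 <= M.
Proof. by move/pexp_val; apply: le_trans (cabs_ge0 _). Qed.

Lemma pexp_term a F h M q n : pexp a F h M q ->
  cabs (a n * h ^+ n) <= M * (1 + q) * q ^+ n.
Proof.
move=> hF.
have -> : a n * h ^+ n = (F - \sum_(i < n) a i * h ^+ i) - (F - \sum_(i < n.+1) a i * h ^+ i).
  by rewrite big_ord_recr /=; ring.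
apply: le_trans (cabsB _ _) _; apply: le_trans (lerD (hF n) (hF n.+1)) _.
by rewrite exprS le_eqVlt; apply/orP; left; apply/eqP; ring.
Qed.

Lemma pexp_le a F h M q M' q' : 0 <= q <= q' -> M <= M' ->
  pexp a F h M q -> pexp a F h M' q'.
Proof.
move=> /andP[q0 qq'] MM' hF N; apply: le_trans (hF N) _.
rewrite ler_pM ?(pexp_M_ge0 hF) ?exprn_ge0 //.
by rewrite lerXn2r // nnegrE (le_trans q0).
Qed.

Lemma pexpD a b F G h M M' q : pexp a F h M q -> pexp b G h M' q ->
  pexp (fun n => a n + b n) (F + G) h (M + M') q.
Proof.
move=> hF hG N; rewrite mulrDl; apply: le_trans (lerD (hF N) (hG N)).
rewrite (_ : F + G - _ = (F - \sum_(n < N) a n * h ^+ n) + (G - \sum_(n < N) b n * h ^+ n)).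
  exact: cabsD.
rewrite (eq_bigr (fun n : 'I_N => a n * h ^+ n + b n * h ^+ n)) => [|i _]; last exact: mulrDl.
by rewrite big_split /=; ring.
Qed.

Lemma pexpZ a F h M q (c : Cx K) : pexp a F h M q ->
  pexp (fun n => c * a n) (c * F) h (cabs c * M) q.
Proof.
move=> hF N; rewrite -mulrA; apply: le_trans (ler_wpM2l (cabs_ge0 c) (hF N)).
rewrite -cabsM mulrBr mulr_sumr.
by rewrite (eq_bigr (fun n : 'I_N => c * (a n * h ^+ n))) => [|i _]; last by rewrite mulrA.
Qed.

Lemma sum_cauchy_prod a b h N :
  \sum_(n < N) cauchy_prod a b n * h ^+ n =
  \sum_(i < N) a i * h ^+ i * \sum_(j < N - i) b j * h ^+ j.
Proof.
elim: N => [|N IH]; first by rewrite !big_ord0.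
rewrite big_ord_recr IH /= [RHS]big_ord_recr /= subSnn big_ord1 expr0 mulr1.
rewrite [X in _ = X + _](eq_bigr (fun i : 'I_N => a i * h ^+ i * (\sum_(j < N - i) b j * h ^+ j)
    + a i * b (N - i)%N * h ^+ N)) => [|i _]; last first.
  rewrite subSn ?(ltnW (ltn_ord i)) // big_ord_recr /= mulrDr; congr (_ + _).
  have -> : h ^+ N = h ^+ i * h ^+ (N - i) by rewrite -exprD subnKC // ltnW.
  ring.
rewrite big_split /= -addrA; congr (_ + _).
rewrite /cauchy_prod big_ord_recr /= subnn mulrDl mulr_suml; congr (_ + _); ring.
Qed.

(** The remainder of the product is the sum over [i < N] of the [i]-th term of [F] times a remainder
    of [G] of order [N - i], plus a remainder of [F] times [G]. Each of the [N] summands is of order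
    [q^N], whence the factor linear in [N]. *)
Lemma pexpM a b F G h M M' q N : 0 <= q -> pexp a F h M q -> pexp b G h M' q ->
  cabs (F * G - \sum_(n < N) cauchy_prod a b n * h ^+ n) <= M * M' * (1 + (1 + q) * N%:R) * q ^+ N.
Proof.
move=> q0 hF hG; rewrite sum_cauchy_prod.
rewrite (_ : F * G - _ = \sum_(i < N) a i * h ^+ i * (G - \sum_(j < N - i) b j * h ^+ j) +
  (F - \sum_(i < N) a i * h ^+ i) * G); last first.
  rewrite [X in _ = X + _](eq_bigr (fun i : 'I_N => a i * h ^+ i * G - a i * h ^+ i * (\sum_(j < N - i) b j * h ^+ j))) => [|i _].
    rewrite big_split /= sumrN -mulr_suml; ring.
  by rewrite mulrBr.
apply: le_trans (cabsD _ _) _.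
rewrite mulrDr mulr1 mulrDl addrC; apply: lerD.
  rewrite cabsM -mulrA [M' * _]mulrC mulrA ler_pM ?cabs_ge0 //.
  exact: pexp_val hG.
apply: le_trans (cabs_sum _ _ _) _.
apply: (@le_trans _ _ (\sum_(i < N) M * M' * (1 + q) * q ^+ N)).
  apply: ler_sum => i _; rewrite cabsM.
  apply: le_trans (ler_pM (cabs_ge0 _) (cabs_ge0 _) (pexp_term i hF) (hG (N - i)%N)) _.
  have -> : q ^+ N = q ^+ i * q ^+ (N - i) by rewrite -exprD subnKC // ltnW.
  by rewrite le_eqVlt; apply/orP; left; apply/eqP; ring.
rewrite sumr_const card_ord -mulr_natr.
by rewrite le_eqVlt; apply/orP; left; apply/eqP; ring.
Qed.

(** Bernoulli's inequality, used to absorb the linear factor of [pexpM] by enlarging the ratio from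
    [q] to [s * q]. *)
Lemma affine_le_expr (c s : K) N : 1 < s -> 0 <= c ->
  1 + c * N%:R <= (1 + c / (s - 1)) * s ^+ N.
Proof.
move=> s1 c0; have s1' : 0 < s - 1 by lra.
have bern : 1 + (s - 1) * N%:R <= s ^+ N.
  elim: N => [|N IH]; first by rewrite mulr0 addr0 expr0.
  rewrite exprS; apply: le_trans (ler_wpM2l _ IH); last lra.
  rewrite -natr1 -subr_ge0.
  have -> : s * (1 + (s - 1) * N%:R) - (1 + (s - 1) * (N%:R + 1)) = (s - 1) ^+ 2 * N%:R by ring.
  by rewrite mulr_ge0 ?sqr_ge0.
apply: le_trans (ler_wpM2l _ bern); last by rewrite addr_ge0 // divr_ge0 // ltW.
have -> : (1 + c / (s - 1)) * (1 + (s - 1) * N%:R) = 1 + c * N%:R + (c / (s - 1) + (s - 1) * N%:R).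
  by field; rewrite lt0r_neq0.
by rewrite lerDl addr_ge0 ?divr_ge0 ?mulr_ge0 ?(ltW s1').
Qed.

Lemma pexpM_rate a b F G h M M' q s : 0 <= q -> 1 < s ->
  pexp a F h M q -> pexp b G h M' q ->
  pexp (cauchy_prod a b) (F * G) h (M * M' * (1 + (1 + q) / (s - 1))) (s * q).
Proof.
move=> q0 s1 hF hG N; apply: le_trans (pexpM N q0 hF hG) _.
rewrite exprMn mulrA ler_wpM2r ?exprn_ge0 // -[leRHS]mulrA ler_wpM2l //.
  by rewrite mulr_ge0 ?(pexp_M_ge0 hF) ?(pexp_M_ge0 hG).
by apply: affine_le_expr => //; lra.
Qed.

Lemma pexp_cst (c h : Cx K) q : 0 <= q -> pexp (fun n => if n is 0%N then c else 0) c h (cabs c) q.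
Proof.
move=> q0 [|N]; first by rewrite big_ord0 subr0 expr0 mulr1.
rewrite big_ord_recl /= expr0 mulr1 big1 => [|i _]; last by rewrite mul0r.
by rewrite addr0 subrr cabs0 mulr_ge0 ?cabs_ge0 ?exprn_ge0.
Qed.

Lemma pexp_var (c h : Cx K) r q : 0 < q -> cabs h <= r ->
  pexp (fun n => if n is 0%N then c else if n is 1%N then 1 else 0) (c + h) h (cabs c + r + r / q) q.
Proof.
move=> q0 hr; have r0 := le_trans (cabs_ge0 h) hr.
case=> [|[|N]].
- rewrite big_ord0 subr0 expr0 mulr1; apply: le_trans (cabsD _ _) _.
  by rewrite -addrA lerD2l ler_wpDr // divr_ge0 // ltW.
- rewrite big_ord1 expr0 mulr1 addrAC subrr add0r expr1 mulrDl divfK ?lt0r_neq0 //.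
  by rewrite ler_wpDl // mulr_ge0 ?addr_ge0 ?cabs_ge0 // ltW.
rewrite 2!big_ord_recl /= expr0 mulr1 expr1 mul1r big1 => [|i _]; last by rewrite mul0r.
rewrite addr0 subrr cabs0 mulr_ge0 ?exprn_ge0 ?(ltW q0) //.
by rewrite !addr_ge0 ?cabs_ge0 ?divr_ge0 ?(ltW q0).
Qed.

Lemma pexp_geometric (c h : Cx K) : cabs (c * h) <= 1 / 2 ->
  pexp (fun n => c ^+ n) (1 - c * h)^-1 h 2 (cabs (c * h)).
Proof.
move=> ch N; set w := c * h in ch *.
have nz : 1 - w != 0.
  apply/eqP => /eqP; rewrite subr_eq0 => /eqP e.
  by have := ch; rewrite -e cabs1; lra.
have -> : (1 - w)^-1 - \sum_(n < N) c ^+ n * h ^+ n = (1 - w)^-1 * w ^+ N.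
  rewrite (eq_bigr (fun n : 'I_N => w ^+ n)) => [|i _]; last by rewrite exprMn.
  apply: (mulfI nz); rewrite mulrBr mulrA divff // mul1r.
  by rewrite -[1 - w]opprB mulNr -subrX1; ring.
rewrite cabsM cabsX ler_wpM2r ?exprn_ge0 ?cabs_ge0 // cabsV invf_ple ?posrE ?cabs_gt0 //.
have : cabs 1 <= cabs (1 - w) + cabs w.
  by rewrite -{1}(subrK w 1); exact: cabsD.
rewrite cabs1; lra.
Qed.

Definition ana f z0 : Prop := exists a M C r, [/\ 0 < r, 0 <= C &
  forall h, cabs h <= r -> pexp a (f (z0 + h)) h M (C * cabs h)].

Lemma anaP2 f g z0 : ana f z0 -> ana g z0 -> exists a b M C r, [/\ 0 < r, 0 < C &
  forall h, cabs h <= r -> pexp a (f (z0 + h)) h M (C * cabs h) /\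
    pexp b (g (z0 + h)) h M (C * cabs h)].
Proof.
move=> [a [M [C [r [r0 C0 hf]]]]] [b [M' [C' [r' [r'0 C'0 hg]]]]].
have M0 : 0 <= M by apply: (@pexp_M_ge0 a _ _ _ _ (hf 0 _)); rewrite cabs0 ltW.
have M'0 : 0 <= M' by apply: (@pexp_M_ge0 b _ _ _ _ (hg 0 _)); rewrite cabs0 ltW.
exists a, b, (M + M'), (C + C' + 1), (Num.min r r'); split.
- by rewrite lt_min r0.
- lra.
- move=> h; rewrite le_min => /andP[/hf Hf /hg Hg]; split.
    apply: pexp_le Hf; last lra.
    by rewrite mulr_ge0 ?cabs_ge0 //= ler_wpM2r ?cabs_ge0 //; lra.
  apply: pexp_le Hg; last lra.
  by rewrite mulr_ge0 ?cabs_ge0 //= ler_wpM2r ?cabs_ge0 //; lra.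
Qed.

Lemma ana_ext f g z0 : f =1 g -> ana f z0 -> ana g z0.
Proof. by move=> /funext ->. Qed.

Lemma anaD f g z0 : ana f z0 -> ana g z0 -> ana (fun z => f z + g z) z0.
Proof.
move=> hf hg; have [a [b [M [C [r [r0 C0 h]]]]]] := anaP2 hf hg.
exists (fun n => a n + b n), (M + M), C, r; split=> // [|x /h[]]; first exact: ltW.
exact: pexpD.
Qed.

Lemma anaM f g z0 : ana f z0 -> ana g z0 -> ana (fun z => f z * g z) z0.
Proof.
move=> hf hg; have [a [b [M [C [r [r0 C0 h]]]]]] := anaP2 hf hg.
have M0 : 0 <= M by apply: (@pexp_M_ge0 a _ _ _ _ (h 0 _).1); rewrite cabs0 ltW.
(* The ratio is enlarged by [s = 2], so [C] becomes [2 * C]; bounding the old ratio by [C * r] makes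
   the constant independent of the point. *)
exists (cauchy_prod a b), (M * M * (1 + (1 + C * r) / (2 - 1))), (2 * C), r; split=> //; first by rewrite mulr_ge0 // ltW.
move=> x xr; have [Hf Hg] := h x xr.
have C0' := ltW C0.
apply: pexp_le (@pexpM_rate _ _ _ _ _ _ _ _ 2 _ _ Hf Hg) => //.
- by rewrite mulrA lexx !mulr_ge0 ?cabs_ge0.
- by rewrite ler_wpM2l ?mulr_ge0 // lerD2l ler_wpM2r ?invr_ge0 ?lerD2l ?ler_wpM2l //; lra.
- by rewrite mulr_ge0 ?cabs_ge0.
- lra.
Qed.

Lemma ana_cst (c z0 : Cx K) : ana (fun=> c) z0.
Proof.
exists (fun n => if n is 0%N then c else 0), (cabs c), 1, 1; split=> // h _.
by apply: pexp_cst; rewrite mul1r cabs_ge0.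
Qed.

Lemma anaZ (c : Cx K) f z0 : ana f z0 -> ana (fun z => c * f z) z0.
Proof. by move=> hf; apply: anaM => //; apply: ana_cst. Qed.

Lemma ana_id z0 : ana id z0.
Proof.
exists (fun n => if n is 0%N then z0 else if n is 1%N then 1 else 0), (cabs z0 + 2), 1, 1; split=> // h h1.
(* For nonzero [h], [pexp_var] is taken with radius and ratio both equal to [cabs h], so that their
   quotient in the constant is 1; at [h = 0] that ratio is not positive. *)
have [->|h0] := eqVneq h 0.
  rewrite cabs0 mulr0 => -[|N].
    by rewrite big_ord0 subr0 expr0 mulr1 addr0 lerDl.
  rewrite big_ord_recl /= expr0 mulr1 big1 => [|i _]; last by rewrite exprS mul0r mulr0.
  by rewrite !addr0 subrr cabs0 exprS mul0r mulr0.
rewrite mul1r; apply: pexp_le (@pexp_var z0 h (cabs h) (cabs h) _ (lexx _)).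
- by rewrite cabs_ge0 lexx.
- by rewrite divff ?cabs_eq0 // -addrA lerD2l; lra.
- by rewrite cabs_gt0.
Qed.

Lemma ana_sum (I : Type) (s : seq I) (f : I -> Cx K -> Cx K) z0 :
  (forall i, ana (f i) z0) -> ana (fun z => \sum_(i <- s) f i z) z0.
Proof.
move=> hf; elim: s => [|i s IH].
  by apply: ana_ext (ana_cst 0 z0) => z; rewrite big_nil.
by apply: ana_ext (anaD (hf i) IH) => z; rewrite big_cons.
Qed.

Lemma ana_expr f z0 n : ana f z0 -> ana (fun z => f z ^+ n) z0.
Proof.
move=> hf; elim: n => [|n IH]; first exact: ana_cst.
by apply: ana_ext (anaM hf IH) => z; rewrite exprS.
Qed.

Lemma ana_poly (p : {poly Cx K}) z0 : ana (fun z => p.[z]) z0.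
Proof.
apply: (@ana_ext (fun z => \sum_(i < size p) p`_i * z ^+ i)) => [z|]; first by rewrite horner_coef.
by apply: ana_sum => i; apply: anaZ; apply: ana_expr; apply: ana_id.
Qed.

Lemma ana_inv (b z0 : Cx K) : z0 != b -> ana (fun z => (z - b)^-1) z0.
Proof.
move=> zb; have nz : z0 - b != 0 by rewrite subr_eq0.
have d0 : 0 < cabs (z0 - b) by rewrite cabs_gt0.
pose c := - (z0 - b)^-1.
exists (fun n => (z0 - b)^-1 * c ^+ n), (cabs (z0 - b)^-1 * 2), (cabs c), (cabs (z0 - b) / 2); split.
- by rewrite divr_gt0.
- exact: cabs_ge0.
move=> h hr; rewrite -cabsM.
rewrite (_ : (z0 + h - b)^-1 = (z0 - b)^-1 * (1 - c * h)^-1); last first.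
  by rewrite -invfM; congr (_^-1); rewrite /c mulNr opprK mulrDr mulr1 mulrA mulfV // mul1r addrAC.
apply: pexpZ; apply: pexp_geometric.
by rewrite cabsM cabsN cabsV mulrC ler_pdivrMr // mulrC mulrA mulr1.
Qed.

Lemma ana_continuous f z0 : ana f z0 -> forall e : K, 0 < e ->
  exists2 d, 0 < d & forall h, cabs h <= d -> cabs (f (z0 + h) - f z0) < e.
Proof.
move=> [a [M [C [r [r0 C0 hf]]]]] e e0.
have M0 : 0 <= M by apply: (@pexp_M_ge0 a _ _ _ _ (hf 0 _)); rewrite cabs0 ltW.
have a0 : f z0 = a 0%N.
  have := hf 0; rewrite cabs0 addr0 mulr0 => /(_ (ltW r0) 1%N).
  rewrite big_ord1 expr0 mulr1 expr1 mulr0 => /cabs_le0/eqP.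
  by rewrite subr_eq0 => /eqP.
have p0 : 0 < M * C + 1 by rewrite ltr_wpDl // mulr_ge0.
exists (Num.min r (e / (M * C + 1) / 2)).
  by rewrite lt_min r0 !divr_gt0.
move=> h; rewrite le_min => /andP[/hf/(_ 1%N) + he].
rewrite big_ord1 expr0 mulr1 expr1 a0 => /le_lt_trans; apply.
rewrite mulrA; apply: (@le_lt_trans _ _ ((M * C + 1) * cabs h)).
  by rewrite ler_wpM2r ?cabs_ge0 // lerDl.
rewrite mulrC -ltr_pdivlMr //; apply: le_lt_trans he _.
have := divr_gt0 e0 p0; lra.
Qed.

Lemma series_bounded (u : nat -> Cx K) (l : Cx K) : series u @ \oo --> l ->
  exists B, forall n, cabs (u n) <= B.
Proof.
move=> /cvg_CxP/(_ 1 ltr01)[N hN].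
exists (\sum_(i < N) cabs (u i) + 2) => n.
have sum0 : 0 <= \sum_(i < N) cabs (u i) by apply: sumr_ge0 => i _; apply: cabs_ge0.
have [nN|Nn] := ltnP n N.
  rewrite (bigD1 (Ordinal nN)) //= -addrA lerDl addr_ge0 //.
  by apply: sumr_ge0 => i _; apply: cabs_ge0.
have -> : u n = (l - series u n) - (l - series u n.+1).
  by rewrite /series /= big_nat_recr //=; ring.
apply: le_trans (cabsB _ _) _; have := hN n Nn; have := hN n.+1 (leqW Nn); lra.
Qed.

(** Convergence at [r / 2] bounds the terms there, hence [|a_n| <= B (2 / r)^n]. For [|h| <= r / 4]
    the ratio [2 |h| / r] is at most 1/2, and the geometric tail at most doubles its first term. *)
Lemma analytic_at_ana f z0 : analytic_at f z0 -> ana f z0.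
Proof.
move=> [r' /gt0_Cx[r r0 ->] [a ha]].
have [B hB] : exists B, forall n, cabs (a n * ((r / 2)%:C%C) ^+ n) <= B.
  by apply: series_bounded (ha _ _); rewrite norm_ltR cabs_real ger0_norm; lra.
have B0 : 0 <= B by apply: le_trans (hB 0%N); apply: cabs_ge0.
have an n : cabs (a n) <= B * (2 / r) ^+ n.
  have := hB n; rewrite cabsM cabsX cabs_real ger0_norm; last lra.
  by rewrite -ler_pdivlMr ?exprn_gt0 ?divr_gt0 // -exprVn invf_div.
exists a, (2 * B), (2 / r), (r / 4); split; [lra|by rewrite divr_ge0 // ltW|].
move=> h hr N; set q := 2 / r * cabs h.
have q0 : 0 <= q by rewrite mulr_ge0 ?cabs_ge0 // divr_ge0 // ltW.
have q1 : q <= 1 / 2.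
  have -> : 1 / 2 = 2 / r * (r / 4) by field; rewrite lt0r_neq0.
  by rewrite ler_wpM2l // divr_ge0 // ltW.
have /cvg_CxP hc : series (fun n => a n * h ^+ n) @ \oo --> f (z0 + h).
  by apply: ha; rewrite norm_ltR; lra.
have tail n : (N <= n)%N -> cabs (series (fun n => a n * h ^+ n) n - \sum_(i < N) a i * h ^+ i) <= 2 * B * q ^+ N.
  move=> Nn; rewrite /series /= (big_cat_nat (leq0n N) Nn) //= big_mkord addrAC subrr add0r.
  apply: le_trans (cabs_sum _ _ _) _.
  apply: le_trans (_ : \sum_(N <= i < n) B * q ^+ i <= _).
    by apply: ler_sum => i _; rewrite cabsM cabsX exprMn mulrA ler_wpM2r ?exprn_ge0 ?cabs_ge0.
  apply: le_trans (geometric_partial_le _ _ _ B0) _; first by apply/andP; split=> //; lra.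
  rewrite ler_wpM2r ?exprn_ge0 // mulrC ler_wpM2r // invf_ple ?posrE //; lra.
apply/ler_addgt0Pr => e e0; have [n0 hn0] := hc e e0.
rewrite -(subrKA (series (fun n => a n * h ^+ n) (maxn N n0))).
apply: le_trans (cabsD _ _) _; rewrite addrC lerD ?tail ?leq_maxl //.
by rewrite ltW // hn0 // leq_maxr.
Qed.

(** The function in the chart [h = 1 / z] of the sphere; [l] is its value at infinity. *)
Definition at_infty f (l h : Cx K) : Cx K := if h == 0 then l else f h^-1.

Lemma analytic_at_infty_ana f : analytic_at_infty f -> exists l, ana (at_infty f l) 0.
Proof.
move=> [r' /gt0_Cx[r r0 ->] [a ha]]; exists (a 0%N).
apply: analytic_at_ana; exists ((r^-1)%:C%C); first by rewrite ltcR invr_gt0.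
exists a => h; rewrite norm_ltR add0r /at_infty => hr.
have [->|h0] := eqVneq h 0.
  apply/cvg_CxP => e e0; exists 1%N => -[//|n] _.
  rewrite /series /= big_nat_recl //= expr0 mulr1 big1 => [|i _]; last by rewrite exprS mul0r mulr0.
  by rewrite addr0 subrr cabs0.
have := ha h^-1; rewrite norm_gtR cabsV => H.
have {}H := H _.
rewrite (_ : (fun n => a n * h ^+ n) = (fun n => a n * h^-1 ^- n)); last first.
  by apply: funext => n; rewrite exprVn invrK.
apply: H; rewrite -[r]invrK ltf_pV2 // posrE ?invr_gt0 // cabs_gt0 //.
Qed.

End PowerExpansion.

(** * Liouville's theorem on the Riemann sphere *)

Section Liouville.
Variable K : realType.
Implicit Types (a b : nat -> Cx K) (F G h z : Cx K) (M q : K) (f g u v : Cx K -> Cx K).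

Lemma ana_near f g z0 (r : K) : 0 < r ->
  (forall h, cabs h <= r -> f (z0 + h) = g (z0 + h)) -> ana f z0 -> ana g z0.
Proof.
move=> r0 fg [a [M [C [r' [r'0 C0 hf]]]]]; exists a, M, C, (Num.min r r'); split=> //.
  by rewrite lt_min r0.
by move=> h; rewrite le_min => /andP[/fg <- /hf].
Qed.

Lemma pexp0 a f z0 M (C : K) r : 0 < r ->
  (forall h, cabs h <= r -> pexp a (f (z0 + h)) h M (C * cabs h)) -> f z0 = a 0%N.
Proof.
move=> r0 /(_ 0); rewrite cabs0 addr0 mulr0 => /(_ (ltW r0) 1%N).
rewrite big_ord1 expr0 mulr1 expr1 mulr0 => /cabs_le0/eqP.
by rewrite subr_eq0 => /eqP.
Qed.

Lemma small_le0 (x D r : K) : 0 < r -> (forall s, 0 < s <= r -> x <= D * s) -> x <= 0.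
Proof.
move=> r0 h; rewrite leNgt; apply/negP => x0.
have D0 : 0 < D.
  have := h r; rewrite r0 lexx => /(_ isT) /(lt_le_trans x0).
  by rewrite pmulr_lgt0.
pose s := Num.min r (x / D / 2).
have xD : 0 < x / D by rewrite divr_gt0.
have s0 : 0 < s by rewrite lt_min r0; lra.
have := h s; rewrite s0 ge_min lexx /= => /(_ isT).
rewrite leNgt => /negP; apply; rewrite mulrC -ltr_pdivlMr //.
by apply: (@le_lt_trans _ _ (x / D / 2)); [rewrite ge_min lexx orbT|lra].
Qed.

(* If [a_(k+1)] is the first nonzero coefficient beyond [a_0], then [|f|] increases from
   [z0] in the direction [eta] with [a_(k+1) eta^(k+1) = a_0]. *)
Lemma local_max_locally_constant f z0 (r1 : K) : ana f z0 -> f z0 != 0 -> 0 < r1 ->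
  (forall h, cabs h <= r1 -> cabs (f (z0 + h)) <= cabs (f z0)) ->
  exists2 d : K, 0 < d & forall h, cabs h <= d -> f (z0 + h) = f z0.
Proof.
move=> [a [M [C [r [r0 C0 hf]]]]] f0 r10 fmax.
have fa := pexp0 r0 hf.
have M0 : 0 <= M by apply: (@pexp_M_ge0 _ a _ _ _ _ (hf 0 _)); rewrite cabs0 ltW.
have [[k ak]|nak] := pselect (exists k, a k.+1 != 0); last first.
  have a0 k : a k.+1 = 0.
    by apply/eqP/negPn/negP => h; apply: nak; exists k.
  have C1 : 0 < C + 1 by lra.
  exists (Num.min r (1 / 2 / (C + 1))); first by rewrite lt_min r0 !divr_gt0.
  move=> h; rewrite le_min => /andP[hr hC].
  have q1 : 0 <= C * cabs h < 1.
    rewrite mulr_ge0 ?cabs_ge0 //=; apply: (@le_lt_trans _ _ ((C + 1) * cabs h)).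
      by rewrite ler_wpM2r ?cabs_ge0 // lerDl.
    rewrite mulrC -ltr_pdivlMr //; apply: le_lt_trans hC _.
    by rewrite ltr_pM2r ?invr_gt0 //; lra.
  apply/eqP; rewrite -subr_eq0; apply/eqP.
  apply: (@cabs0_geometric _ _ M (C * cabs h)) => // N.
  have := hf h hr N.+1; rewrite big_ord_recl /= expr0 mulr1 big1 => [|i _]; last by rewrite a0 mul0r.
  rewrite addr0 fa => /le_trans; apply.
  by case/andP: q1 => q0 /ltW q1; rewrite ler_wpM2l // exprS ler_piMl ?exprn_ge0.
have exk : exists k, a k.+1 != 0 by exists k.
case: (ex_minnP exk) => {ak exk}k ak kmin.
have az i : (i < k)%N -> a i.+1 = 0.
  by move=> ik; apply/eqP/negPn/negP => /kmin; rewrite leqNgt ik.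
pose eta := (k.+1).-root (a 0%N / a k.+1).
have etaE : eta ^+ k.+1 = a 0%N / a k.+1 by rewrite rootCK.
have eta0 : eta != 0.
  apply/eqP => e; have := etaE; rewrite e expr0n /= => /esym/eqP.
  by rewrite mulf_eq0 invr_eq0 (negPf ak) orbF -fa (negPf f0).
have e0 : 0 < cabs eta by rewrite cabs_gt0.
(* At [h = s eta] the value of [f] is [(1 + s^{k+1}) f(z0)] up to order [s^{k+2}]. Maximality
   cancels [|f(z0)|], and division by [s^{k+1}] leaves a bound of [|f(z0)|] by a multiple of [s]. *)
suff : cabs (f z0) <= 0 by rewrite le_eqVlt ltNge cabs_ge0 orbF cabs_eq0 (negPf f0).
apply: (@small_le0 _ (M * (C * cabs eta) ^+ k.+2) (Num.min r r1 / cabs eta)).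
  by rewrite divr_gt0 // lt_min r0.
move=> s /andP[s0]; rewrite ler_pdivlMr // le_min => /andP[sr sr1].
pose h := s%:C%C * eta.
have ch : cabs h = s * cabs eta by rewrite /h cabsM cabs_real ger0_norm // ltW.
have hr : cabs h <= r by rewrite ch.
have hr1 : cabs h <= r1 by rewrite ch.
have := hf h hr k.+2.
rewrite big_ord_recr big_ord_recl /= expr0 mulr1 big1 => [|i _]; last by rewrite az // mul0r.
rewrite addr0 /h exprMn etaE.
have -> : a 0%N + a k.+1 * (s%:C%C ^+ k.+1 * (a 0%N / a k.+1)) = (1 + s%:C%C ^+ k.+1) * a 0%N.
  by field.
rewrite -fa cabsM cabs_real ger0_norm; last by rewrite ltW.
have -> : C * (s * cabs eta) = s * (C * cabs eta) by ring.
rewrite exprMn => H.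
have sk : 0 < s ^+ k.+1 by rewrite exprn_gt0.
rewrite -(ler_pM2r sk).
have -> : M * (C * cabs eta) ^+ k.+2 * s * s ^+ k.+1 = M * (s ^+ k.+2 * (C * cabs eta) ^+ k.+2).
  by rewrite [s ^+ k.+2]exprS; ring.
apply: le_trans H; set X := f (z0 + _).
have H2 : cabs ((1 + s%:C%C ^+ k.+1) * f z0) <= cabs (X - (1 + s%:C%C ^+ k.+1) * f z0) + cabs X.
  have := cabsB X (X - (1 + s%:C%C ^+ k.+1) * f z0).
  rewrite (_ : X - (X - _) = (1 + s%:C%C ^+ k.+1) * f z0); last by ring.
  by rewrite [X in _ <= X]addrC.
have H3 : cabs X <= cabs (f z0) by exact: fmax.
have H4 : cabs ((1 + s%:C%C ^+ k.+1) * f z0) = (1 + s ^+ k.+1) * cabs (f z0).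
  rewrite cabsM -rmorphXn -[1]/((1 : K)%:C%C) -rmorphD cabs_real ger0_norm //.
  by rewrite addr_ge0 // ltW.
rewrite -rmorphXn /= in H2 H4 *; rewrite /X; lra.
Qed.

Lemma cabs_dist (x y : Cx K) : `|cabs x - cabs y| <= cabs (x - y).
Proof.
have := cabsD (x - y) y; have := cabsD (y - x) x; rewrite !subrK (cabs_distC y).
by rewrite ler_norml => h1 h2; apply/andP; split; lra.
Qed.

(* At a maximum of [|f|] with largest real part, [f] is locally constant, so the maximum
   is also attained further to the right. *)
Lemma liouville_decay f : (forall z, ana f z) -> ana (at_infty f 0) 0 ->
  forall z, f z = 0.
Proof.
move=> af finf z1; apply/eqP/negPn/negP => f1.
have m1 : 0 < cabs (f z1) by rewrite cabs_gt0.
have [d d0 hd] := ana_continuous finf m1.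
pose r := d^-1 + cabs z1.
(* Since [f] vanishes at infinity, it is smaller than at [z1] outside a disc; a maximum over a
   square containing that disc is therefore global. *)
have far z : r < cabs z -> cabs (f z) < cabs (f z1).
  move=> rz; have zd : d^-1 < cabs z by apply: le_lt_trans rz; rewrite lerDl cabs_ge0.
  have z0 : z != 0 by rewrite -cabs_gt0; apply: lt_trans zd; rewrite invr_gt0.
  have := hd z^-1; rewrite cabsV /at_infty add0r eqxx subr0 invr_eq0 (negPf z0) invrK; apply.
  by rewrite -[d]invrK lef_pV2 ?posrE ?invr_gt0 ?cabs_gt0 // ltW.
pose c (t : K * K) : Cx K := Complex t.1 t.2.
pose g (t : K * K) : K := cabs (f (c t)).
pose B : set (K * K) := (`[- r, r] `*` `[- r, r])%classic.
have Bc : compact B by apply: compact_setX; exact: segment_compact.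
have inB (z : Cx K) : cabs z <= r -> B (complex.Re z, complex.Im z).
  move=> zr; split; rewrite /= in_itv /= -ler_norml.
    exact: le_trans (norm_Re_le z) zr.
  exact: le_trans (norm_Im_le z) zr.
have cE (z : Cx K) : c (complex.Re z, complex.Im z) = z by rewrite /c; case: z.
have gcont : continuous g.
  move=> t; apply/cvgrPdist_lt => e e0.
  have [d' d'0 hd'] := ana_continuous (af (c t)) e0.
  have d2 : 0 < d' / 2 by rewrite divr_gt0.
  near=> s.
  have : ball t (d' / 2) s by near: s; apply: (nbhsx_ballx t (d' / 2)%R d2).
  move=> [/= b1 b2].
  have := hd' (c s - c t); rewrite [c t + _]addrC subrK => H.
  apply: le_lt_trans (H _); last first.
    apply: le_trans (cabs_ReIm _) _.
    move: b1 b2; rewrite /ball /= => b1 b2.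
    by rewrite distrC [X in _ + X]distrC; lra.
  rewrite /g -[X in _ <= X](@cabs_distC _ (f (c t)) (f (c s))).
  exact: cabs_dist.
have B0 : B !=set0.
  by exists (complex.Re z1, complex.Im z1); apply: inB; rewrite /r lerDr invr_ge0 ltW.
have [p pB pmax] := compact_EVT_max B0 Bc (continuous_subspaceT gcont).
have z1p : cabs (f z1) <= g p.
  have := pmax (complex.Re z1, complex.Im z1); rewrite inE {1}/g cE; apply; apply: inB; rewrite /r lerDr invr_ge0 ltW //.
have gmax z : cabs (f z) <= g p.
  have [zr|zr] := leP (cabs z) r; last by apply: ltW; apply: lt_le_trans z1p; apply: far.
  by have := pmax (complex.Re z, complex.Im z); rewrite inE {1}/g cE; apply; apply: inB.
pose S := B `&` g @^-1` [set g p].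
have Sc : compact S.
  apply: compact_closedI => //; move/continuous_closedP: gcont; apply.
  exact: closed_eq.
have [p' p'S p'max] : exists2 c, c \in S & forall t, t \in S -> t.1 <= c.1.
  apply: (@compact_EVT_max _ _ (fun t : K * K => t.1)) => //.
    by exists p; split=> //; rewrite inE in pB.
  by apply: continuous_subspaceT => x; exact: cvg_fst.
rewrite inE in p'S; case: p'S => p'B gp'.
have gp0 : 0 < g p by apply: lt_le_trans z1p.
have [d1 d10 hconst] : exists2 d : K, 0 < d & forall h, cabs h <= d -> f (c p' + h) = f (c p').
  apply: (@local_max_locally_constant _ _ 1) => //.
    by rewrite -cabs_gt0 -/(g p') gp'.
  by move=> h _; rewrite -/(g p') gp'; exact: gmax.
have fp : f (c (p'.1 + d1, p'.2)) = f (c p').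
  rewrite -(hconst (d1%:C%C)); last by rewrite cabs_real ger0_norm // ltW.
  by congr f; rewrite /c; congr Complex; rewrite /= addr0.
have := p'max (p'.1 + d1, p'.2); rewrite inE /= => H.
have : p'.1 + d1 <= p'.1.
  apply: H; split; last by rewrite /= /g fp.
  have [zr|zr] := leP (cabs (c (p'.1 + d1, p'.2))) r; first exact: (inB _ zr).
  have := lt_le_trans (far _ zr) z1p; rewrite fp -/(g p') gp' ltxx //.
by rewrite gerDl leNgt d10.
Unshelve. all: by end_near.
Qed.

Definition ana_disc u : Prop := forall z, cabs z <= 1 -> ana u z.

Definition ana_ext_disc v (l : Cx K) : Prop :=
  (forall z, 1 <= cabs z -> ana v z) /\ ana (at_infty v l) 0.

(** Cayley transform: for purely imaginary [t] the number [(1 + t) / (1 - t)] is unimodular, and it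
    differs from 1 by [2 t / (1 - t)], whose modulus is at most [2 |t|]. *)
Lemma circle_limit_point z0 (r : K) : cabs z0 = 1 -> 0 < r ->
  exists2 h, 0 < cabs h <= r & cabs (z0 + h) = 1.
Proof.
move=> z1 r0; pose t := (Complex 0 (r / 2) : Cx K).
have ct : cabs t = r / 2.
  rewrite cabs_sqrt /= expr0n add0r sqrtr_sqr ger0_norm //; lra.
have nz : 1 - t != 0.
  rewrite subr_eq0; apply/eqP => /(congr1 (@complex.Re K)) /=.
  by move/eqP; rewrite oner_eq0.
have nz' : 1 <= cabs (1 - t).
  by apply: le_trans (norm_Re_le _); rewrite /= subr0 normr1.
have cc : cabs (1 + t) = cabs (1 - t).
  by rewrite !cabs_sqrt /= !add0r sqrrN oppr0.
exists (z0 * (2 * t / (1 - t))).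
  rewrite !cabsM z1 mul1r cabsV ct.
  have -> : cabs (2 : Cx K) = 2.
    by rewrite -[RHS](@ger0_norm K 2) // -cabs_real; congr cabs; rewrite rmorph_nat.
  rewrite divr_gt0 //=; [|lra|lra].
  rewrite ler_pdivrMr; last lra.
  have -> : 2 * (r / 2) = r by field.
  by rewrite ler_peMr // ltW.
have -> : z0 + z0 * (2 * t / (1 - t)) = z0 * ((1 + t) / (1 - t)) by field.
by rewrite !cabsM cabsV z1 mul1r cc divff // cabs_eq0.
Qed.

(** The two functions agree at points of the circle arbitrarily close to [z0]. The first difference
    of coefficients would be bounded by a multiple of the distance to such points, so all
    coefficients coincide and one series serves both sides. *)
Lemma ana_glue u v z0 : cabs z0 = 1 -> ana u z0 -> ana v z0 ->
  (forall z, cabs z = 1 -> u z = v z) ->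
  ana (fun z => if cabs z <= 1 then u z else v z) z0.
Proof.
move=> z1 au av uv.
have [a [b [M [C [r [r0 C0 h2]]]]]] := anaP2 au av.
have ab n : a n = b n.
  elim/ltn_ind: n => n IH; apply/eqP; rewrite -subr_eq0 -cabs_eq0 eq_le cabs_ge0 andbT.
  rewrite leNgt; apply/negP => ab0.
  pose D := 2 * M * C ^+ n.+1.
  have M0 : 0 <= M by apply: (@pexp_M_ge0 _ a _ _ _ _ (h2 0 _).1); rewrite cabs0 ltW.
  have D0 : 0 < D + 1 by rewrite ltr_wpDl // !mulr_ge0 ?exprn_ge0 // ltW.
  have [] := @circle_limit_point z0 (Num.min r (cabs (a n - b n) / (D + 1) / 2)) z1.
    by rewrite lt_min r0 !divr_gt0.
  move=> h /andP[h0]; rewrite le_min => /andP[hr hs] zh.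
  have [Hu Hv] := h2 h hr.
  have := Hu n.+1; have := Hv n.+1; rewrite -(uv _ zh) !big_ord_recr /=.
  rewrite (eq_bigr (fun i : 'I_n => a i * h ^+ i)) => [|i _]; last by rewrite IH.
  set S := \sum_(i < n) _; set U := u _ => H1 H2.
  have : cabs ((a n - b n) * h ^+ n) <= 2 * (M * (C * cabs h) ^+ n.+1).
    have -> : (a n - b n) * h ^+ n = (U - (S + b n * h ^+ n)) - (U - (S + a n * h ^+ n)) by ring.
    by apply: le_trans (cabsB _ _) _; lra.
  rewrite cabsM cabsX exprMn.
  have -> : 2 * (M * (C ^+ n.+1 * cabs h ^+ n.+1)) = D * cabs h * cabs h ^+ n.
    by rewrite /D [cabs h ^+ n.+1]exprS; ring.
  rewrite ler_pM2r ?exprn_gt0 // leNgt => /negP; apply.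
  apply: (@le_lt_trans _ _ ((D + 1) * cabs h)).
    by rewrite ler_wpM2r ?cabs_ge0 // lerDl.
  rewrite mulrC -ltr_pdivlMr //; apply: le_lt_trans hs _.
  have := divr_gt0 ab0 D0; lra.
exists a, M, C, r; split=> //; first exact: ltW.
move=> h /h2[Hu Hv]; case: ifP => // _ N.
by have := Hv N; under eq_bigr do rewrite -ab.
Qed.

(** Glued along the circle, [u] and [v] form an entire function that vanishes at infinity. *)
Lemma disc_ext_disc_eq0 u v : ana_disc u -> ana_ext_disc v 0 ->
  (forall z, cabs z = 1 -> u z = v z) -> forall z, cabs z <= 1 -> u z = 0.
Proof.
move=> au [av avi] uv z z1.
pose f z := if cabs z <= 1 then u z else v z.
suff /(_ z) : forall z, f z = 0 by rewrite /f z1.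
apply: liouville_decay => [w|].
  have [w1|w1|w1] := ltgtP (cabs w) 1; last first.
    by apply: ana_glue => //; [apply: au|apply: av]; rewrite w1.
    apply: (@ana_near v _ _ ((cabs w - 1) / 2)); [lra| |exact: av (ltW w1)].
    move=> h hw; rewrite /f; case: ifPn => // wh; exfalso.
    by have := cabsB (w + h) h; rewrite addrK; lra.
  apply: (@ana_near u _ _ (1 - cabs w)); [lra| |exact: au (ltW w1)].
  move=> h hw; rewrite /f; case: ifPn => //; rewrite -ltNge => wh; exfalso.
    by have := cabsD w h; lra.
apply: (@ana_near (at_infty v 0) _ _ (1 / 2)) avi; first lra.
move=> h; rewrite add0r /at_infty; case: eqP => // /eqP h0 hh; rewrite /f.
case: ifPn => //; rewrite cabsV => wh; exfalso; move: wh; rewrite invf_ple ?posrE ?cabs_gt0 // invr1; lra.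
Qed.

Lemma at_infty_op f g (l l' : Cx K) (op : Cx K -> Cx K -> Cx K) :
  (fun h => op (at_infty f l h) (at_infty g l' h)) =1
  at_infty (fun z => op (f z) (g z)) (op l l').
Proof. by move=> h; rewrite /at_infty; case: eqP. Qed.

Lemma ana_ext_discD f g l l' : ana_ext_disc f l -> ana_ext_disc g l' ->
  ana_ext_disc (fun z => f z + g z) (l + l').
Proof.
move=> [hf fi] [hg gi]; split=> [z z1|]; first by apply: anaD; [exact: hf|exact: hg].
exact: ana_ext (at_infty_op f g l l' +%R) (anaD fi gi).
Qed.

Lemma ana_ext_discM f g l l' : ana_ext_disc f l -> ana_ext_disc g l' ->
  ana_ext_disc (fun z => f z * g z) (l * l').
Proof.
move=> [hf fi] [hg gi]; split=> [z z1|]; first by apply: anaM; [exact: hf|exact: hg].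
exact: ana_ext (at_infty_op f g l l' *%R) (anaM fi gi).
Qed.

Lemma ana_ext_disc_cst (c : Cx K) : ana_ext_disc (fun=> c) c.
Proof.
split=> [z _|]; first exact: ana_cst.
by apply: ana_ext (ana_cst c 0) => h; rewrite /at_infty if_same.
Qed.

Lemma ana_ext_disc_quot (c : Cx K) : cabs c < 1 -> ana_ext_disc (fun z => z / (z - c)) 1.
Proof.
move=> c1; split=> [z z1|].
  apply: anaM; first exact: ana_id.
  by apply: ana_inv; apply/eqP => zc; move: z1; rewrite zc; lra.
exists (fun n => c ^+ n), 2, (cabs c), (1 / 2); split; [lra|exact: cabs_ge0|].
move=> h h1; rewrite -cabsM add0r.
have ch : cabs (c * h) <= 1 / 2.
  rewrite cabsM; apply: le_trans h1; rewrite ler_piMl ?cabs_ge0 //; lra.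
rewrite (_ : at_infty _ _ _ = (1 - c * h)^-1); first exact: pexp_geometric.
rewrite /at_infty; case: eqP => [->|/eqP h0]; first by rewrite mulr0 subr0 invr1.
by rewrite -invfM; congr (_^-1); rewrite mulrBr mulfV // [h * c]mulrC.
Qed.

Lemma ana_ext_disc_inv : ana_ext_disc (fun z => z^-1) 0.
Proof.
split=> [z z1|].
  apply: ana_ext (ana_inv (_ : z != 0)) => [w|]; first by rewrite subr0.
  by rewrite -cabs_gt0; lra.
apply: ana_ext (ana_id 0) => h; rewrite /at_infty; case: eqP => [->//|_].
by rewrite invrK.
Qed.

(** Multiplying by [z] divides by the local parameter at infinity. Once the constant term is
    subtracted, this merely shifts the coefficients. *)
Lemma ana_ext_disc_sub v l : ana_ext_disc v l ->
  exists l', ana_ext_disc (fun z => z * (v z - l)) l'.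
Proof.
move=> [hv [a [M [C [r [r0 C0 ha]]]]]]; exists (a 1%N); split=> [z z1|].
  apply: anaM; first exact: ana_id.
  by apply: anaD; [exact: hv|exact: ana_cst].
have a0 : a 0%N = l by rewrite -(pexp0 r0 ha) /at_infty eqxx.
have M0 : 0 <= M by apply: (@pexp_M_ge0 _ a _ _ _ _ (ha 0 _)); rewrite cabs0 ltW.
(* The summand [cabs (a 1%N)] bounds the value at infinity, where one cannot divide by [h]. *)
exists (fun n => a n.+1), (M * C + cabs (a 1%N)), C, r; split=> // h hr.
rewrite add0r /at_infty; have [->|h0] := eqVneq h 0.
  rewrite cabs0 mulr0 => -[|N].
    by rewrite big_ord0 subr0 expr0 mulr1 lerDr mulr_ge0.
  rewrite big_ord_recl /= expr0 mulr1 big1 => [|i _]; last by rewrite exprS mul0r mulr0.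
  by rewrite addr0 subrr cabs0 exprS mul0r mulr0.
apply: (@pexp_le _ _ _ _ (M * C) (C * cabs h)).
- by rewrite mulr_ge0 ?cabs_ge0 //= lexx.
- by rewrite lerDl cabs_ge0.
move=> N; have := ha h hr N.+1; rewrite add0r /at_infty (negPf h0).
rewrite big_ord_recl /= expr0 mulr1 a0.
rewrite (eq_bigr (fun i : 'I_N => h * (a i.+1 * h ^+ i))) => [|i _]; last by rewrite /bump /= exprS; ring.
rewrite -mulr_sumr => H.
have hc : 0 < cabs h by rewrite cabs_gt0.
rewrite -(ler_pM2l hc) -cabsM.
have -> : h * (h^-1 * (v h^-1 - l) - \sum_(i < N) a i.+1 * h ^+ i) =
  v h^-1 - (l + h * \sum_(i < N) a i.+1 * h ^+ i).
  by rewrite mulrBr mulrA divff // mul1r; ring.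
by apply: le_trans H _; rewrite exprS le_eqVlt; apply/orP; left; apply/eqP; ring.
Qed.

(** Induction on the order of the pole at infinity: subtracting the leading term [l z^N] lowers it
    by one, and without a pole [u - l] vanishes by Liouville. *)
Lemma ana_disc_polynomial u v l N : ana_disc u -> ana_ext_disc v l ->
  (forall z, cabs z = 1 -> u z = z ^+ N * v z) ->
  exists2 p : {poly Cx K}, (size p <= N.+1)%N & forall z, cabs z <= 1 -> u z = p.[z].
Proof.
elim: N u v l => [|N IH] u v l au av uv.
  exists l%:P; first by rewrite size_polyC leq_b1.
  move=> z z1; rewrite hornerC; apply/eqP; rewrite -subr_eq0; apply/eqP.
  apply: (@disc_ext_disc_eq0 (fun z => u z - l) (fun z => v z - l)) => //.
  - by move=> w w1; apply: anaD; [exact: au|exact: ana_cst].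
  - by rewrite -(subrr l); apply: ana_ext_discD => //; exact: ana_ext_disc_cst.
  - by move=> w w1; rewrite uv // expr0 mul1r.
have [l' hl'] := ana_ext_disc_sub av.
have [] := IH (fun z => u z - l * z ^+ N.+1) _ l' _ hl'.
- move=> z z1; apply: anaD; first exact: au.
  apply: (@ana_ext _ (fun z => - l * z ^+ N.+1)) => [w|]; first by rewrite mulNr.
  by apply: anaZ; apply: ana_expr; exact: ana_id.
- by move=> z z1; rewrite uv // exprS; ring.
move=> p sp hp; exists (p + l *: 'X^(N.+1)).
  apply: leq_trans (size_polyD _ _) _; rewrite geq_max (leq_trans sp) //=.
  by apply: leq_trans (size_scale_leq _ _) _; rewrite size_polyXn.
by move=> z z1; rewrite hornerD hornerZ hornerXn -hp // subrK.
Qed.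

End Liouville.

(** * Fourier coefficients *)

Section CircleMean.
Variable K : realType.
Implicit Types (f g : Cx K -> Cx K) (z : Cx K).
Notation mu := (@lebesgue_measure K).
Notation D := (`[(0:K), 2 * pi]%classic).

Lemma cabs_expi (w : K) : cabs (expi w) = 1.
Proof. by rewrite cabs_sqrt /= cos2Dsin2 sqrtr1. Qed.

Lemma expi_neq0 (w : K) : expi w != 0.
Proof. by rewrite -cabs_gt0 cabs_expi. Qed.

Lemma expiD (a b : K) : expi (a + b) = expi a * expi b.
Proof.
by rewrite /expi cosD sinD; congr Complex; rewrite addrC.
Qed.

Lemma expiX (a : K) n : expi a ^+ n = expi (n%:R * a).
Proof.
elim: n => [|n IH].
  by rewrite expr0 mul0r /expi cos0 sin0.
by rewrite exprS IH -expiD mulrSr mulrDl mul1r addrC.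
Qed.

Lemma expiV (a : K) : (expi a)^-1 = expi (- a).
Proof.
apply: (mulfI (expi_neq0 a)).
by rewrite divff ?expi_neq0 // -expiD subrr /expi cos0 sin0.
Qed.

Lemma expi_exprz (a : K) (n : int) : (expi a ^ n)%R = expi (n%:~R * a).
Proof.
case: n => n; first by rewrite -exprnP expiX.
by rewrite NegzE -exprnN expiX expiV mulrNz mulNr.
Qed.

(** A class of functions on the circle that is closed under sums and products and on which
    [circle_mean] is linear. *)
Definition cmeas f : Prop :=
  [/\ measurable_fun setT (fun w => complex.Re (f (expi w))),
      measurable_fun setT (fun w => complex.Im (f (expi w))) &
      exists B, forall z, cabs z = 1 -> cabs (f z) <= B].

Lemma cmeas_integrable f : cmeas f ->
  mu.-integrable D (EFin \o (fun w => complex.Re (f (expi w)))) /\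
  mu.-integrable D (EFin \o (fun w => complex.Im (f (expi w)))).
Proof.
move=> [mr mi [B hB]].
have fin : (mu D < +oo)%E by rewrite lebesgue_measure_itv /=; case: ifP => _; rewrite ?ltry.
split; apply: measurable_bounded_integrable => //.
- exact: measurable_funTS.
- exists B; split; first exact: num_real.
  move=> x Bx w _ /=; apply: le_trans (ltW Bx); apply: le_trans (hB _ (cabs_expi w)).
  exact: norm_Re_le.
- exact: measurable_funTS.
- exists B; split; first exact: num_real.
  move=> x Bx w _ /=; apply: le_trans (ltW Bx); apply: le_trans (hB _ (cabs_expi w)).
  exact: norm_Im_le.
Qed.

Lemma ReD (x y : Cx K) : complex.Re (x + y) = complex.Re x + complex.Re y.
Proof. by case: x; case: y. Qed.

Lemma ImD (x y : Cx K) : complex.Im (x + y) = complex.Im x + complex.Im y.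
Proof. by case: x; case: y. Qed.

Lemma ReM (x y : Cx K) :
  complex.Re (x * y) = complex.Re x * complex.Re y - complex.Im x * complex.Im y.
Proof. by case: x; case: y. Qed.

Lemma ImM (x y : Cx K) :
  complex.Im (x * y) = complex.Re x * complex.Im y + complex.Im x * complex.Re y.
Proof. by case: x; case: y. Qed.

Lemma cmeasD f g : cmeas f -> cmeas g -> cmeas (fun z => f z + g z).
Proof.
move=> [mr mi [B hB]] [nr ni [B' hB']]; split.
- by under eq_fun do rewrite ReD; exact: measurable_funD.
- by under eq_fun do rewrite ImD; exact: measurable_funD.
- by exists (B + B') => z z1; apply: le_trans (cabsD _ _) _; rewrite lerD ?hB ?hB'.
Qed.

Lemma cmeasM f g : cmeas f -> cmeas g -> cmeas (fun z => f z * g z).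
Proof.
move=> [mr mi [B hB]] [nr ni [B' hB']]; split.
- under eq_fun do rewrite ReM.
  by apply: measurable_funB; exact: measurable_realfun.measurable_funM.
- under eq_fun do rewrite ImM.
  by apply: measurable_funD; exact: measurable_realfun.measurable_funM.
- by exists (B * B') => z z1; rewrite cabsM ler_pM ?cabs_ge0 ?hB ?hB'.
Qed.

Lemma cmeas_cst (c : Cx K) : cmeas (fun=> c).
Proof. by split; [exact: measurable_cst|exact: measurable_cst|exists (cabs c)]. Qed.

Lemma cmeas_exprz (n : int) : cmeas (fun z => (z ^ n)%R).
Proof.
have m : measurable_fun setT (fun w : K => n%:~R * w).
  by apply: continuous_measurable_fun; exact: mulrl_continuous.
split.
- rewrite (_ : (fun w => _) = cos \o (fun w => n%:~R * w)); last first.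
    by apply: funext => w; rewrite expi_exprz.
  exact: measurableT_comp (continuous_measurable_fun (@continuous_cos K)) m.
- rewrite (_ : (fun w => _) = sin \o (fun w => n%:~R * w)); last first.
    by apply: funext => w; rewrite expi_exprz.
  exact: measurableT_comp (continuous_measurable_fun (@continuous_sin K)) m.
- exists 1 => z z1; case: n {m} => n.
    by rewrite -exprnP cabsX z1 expr1n.
  by rewrite NegzE -exprnN cabsV cabsX z1 expr1n invr1.
Qed.

Lemma cmeas_sum (I : Type) (s : seq I) (f : I -> Cx K -> Cx K) :
  (forall i, cmeas (f i)) -> cmeas (fun z => \sum_(i <- s) f i z).
Proof.
move=> hf; elim: s => [|i s IH].
  by rewrite (_ : (fun z => _) = (fun=> 0)) ?cmeas_cst //; [exact: cmeas_cst|apply: funext => z; rewrite big_nil].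
rewrite (_ : (fun z => _) = (fun z => f i z + \sum_(i <- s) f i z)); first exact: cmeasD.
by apply: funext => z; rewrite big_cons.
Qed.

Definition fc f (n : int) : Cx K :=
  circle_mean (fun w => (expi w ^ (- n))%R * f (expi w)).

Lemma circle_mean_ext (f g : K -> Cx K) : f =1 g -> circle_mean f = circle_mean g.
Proof. by move=> /funext ->. Qed.

Lemma fc_ext f g n : (forall z, cabs z = 1 -> f z = g z) -> fc f n = fc g n.
Proof. by move=> h; apply: circle_mean_ext => w; rewrite h ?cabs_expi. Qed.

Lemma circle_meanD f g : cmeas f -> cmeas g ->
  circle_mean (fun w => f (expi w) + g (expi w)) =
  circle_mean (fun w => f (expi w)) + circle_mean (fun w => g (expi w)).
Proof.
move=> /cmeas_integrable[fr fi] /cmeas_integrable[gr gi].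
rewrite /circle_mean; apply/eqP; rewrite eq_complex /=; apply/andP; split; apply/eqP.
- rewrite -mulrDr -RintegralD //.
  by congr (_ * _); apply: eq_Rintegral => w _; case: (f _) => ? ?; case: (g _).
- rewrite -mulrDr -RintegralD //.
  by congr (_ * _); apply: eq_Rintegral => w _; case: (f _) => ? ?; case: (g _).
Qed.

Lemma circle_meanZ (c : Cx K) f : cmeas f ->
  circle_mean (fun w => c * f (expi w)) = c * circle_mean (fun w => f (expi w)).
Proof.
move=> /cmeas_integrable[fr fi]; case: c => a b.
have mD : measurable D by exact: measurable_itv.
have Zl (r : K) (g : K -> K) : mu.-integrable D (EFin \o g) ->
    r * \int[mu]_(w in D) g w = \int[mu]_(w in D) (r * g w).
  by move=> ig; rewrite RintegralZl.
have iZ (r : K) (g : K -> K) : mu.-integrable D (EFin \o g) ->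
    mu.-integrable D (EFin \o (fun w => r * g w)).
  by move=> ig; have := @integrableZl _ _ _ mu D mD r _ ig.
rewrite /circle_mean; apply/eqP; rewrite eq_complex /=; apply/andP; split; apply/eqP.
- rewrite !(mulrCA _ _^-1) -mulrBr (Zl a _ fr) (Zl b _ fi) -RintegralB ?iZ //.
  by congr (_ * _); apply: eq_Rintegral => w _; case: (f _).
- rewrite !(mulrCA _ _^-1) -mulrDr (Zl a _ fi) (Zl b _ fr) -RintegralD ?iZ //.
  by congr (_ * _); apply: eq_Rintegral => w _; case: (f _).
Qed.

Lemma mean_real_le (g : K -> K) (B : K) : mu.-integrable D (EFin \o g) ->
  (forall w, `|g w| <= B) -> `|(2 * pi)^-1 * \int[mu]_(w in D) g w| <= B.
Proof.
move=> ig hB; have p0 := pi_gt0 K.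
have p2 : 0 < 2 * pi :> K by rewrite mulr_gt0.
rewrite normrM normfV (gtr0_norm p2) ler_pdivrMl // [leRHS]mulrC.
apply: le_trans (le_normr_Rintegral _ ig) _; first exact: measurable_itv.
apply: (@le_trans _ _ (\int[mu]_(w in D) B)).
  apply: le_Rintegral => //.
  - exact: integrable_norm.
  - apply: measurable_bounded_integrable => //.
      by rewrite [X in (X < _)%E](_ : _ = mu D) // lebesgue_measure_itv /=; case: ifP => _; rewrite ?ltry.
    exists `|B|; split; first exact: num_real.
    by move=> x Bx w _ /=; exact: ltW.
rewrite Rintegral_cst // [X in fine X](_ : _ = mu D) //.
by rewrite lebesgue_measure_itv /= lte_fin p2 /= subr0.
Qed.

(** The factor 2 comes from estimating the real and imaginary parts separately. *)
Lemma circle_mean_le f (B : K) : cmeas f -> (forall z, cabs z = 1 -> cabs (f z) <= B) ->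
  cabs (circle_mean (fun w => f (expi w))) <= 2 * B.
Proof.
move=> /cmeas_integrable[fr fi] hB; apply: le_trans (cabs_ReIm _) _.
rewrite mulrDl mul1r; apply: lerD; apply: mean_real_le => // w.
  exact: le_trans (norm_Re_le _) (hB _ (cabs_expi w)).
exact: le_trans (norm_Im_le _) (hB _ (cabs_expi w)).
Qed.

(** Each integrand has an antiderivative that takes the same value at both ends of the interval. *)
Lemma mean_cos_sin (k : K) : k != 0 -> cos (k * (2 * pi)) = 1 -> sin (k * (2 * pi)) = 0 ->
  \int[mu]_(w in D) cos (k * w) = 0 /\ \int[mu]_(w in D) sin (k * w) = 0.
Proof.
move=> k0 c1 s0.
have p2 : 0 < 2 * pi :> K by rewrite mulr_gt0 // pi_gt0.
have cl : continuous (fun w : K => k * w) by move=> w; apply: cvgM => //; exact: cvg_cst.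
have cc : continuous (fun w : K => cos (k * w)).
  by move=> w; apply: (continuous_comp (cl w)); exact: continuous_cos.
have cs : continuous (fun w : K => sin (k * w)).
  by move=> w; apply: (continuous_comp (cl w)); exact: continuous_sin.
have ftc (F f : K -> K) : continuous f -> (forall w : K, is_derive w (1 : K) F (f w)) ->
    F (2 * pi) = F 0 -> \int[mu]_(w in D) f w = 0.
  move=> cf dF FF; rewrite /Rintegral (@continuous_FTC2 _ f F) //.
  - by rewrite FF subee.
  - exact: continuous_subspaceT.
  - have cF : continuous F.
      move=> w; apply: differentiable_continuous; apply/derivable1_diffP.
      by case: (dF w).
    split=> [w _||]; first by case: (dF w).
      by apply: cvg_at_right_filter; exact: cF.
    by apply: cvg_at_left_filter; exact: cF.
  - by move=> w _; rewrite derive1E; case: (dF w).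
split.
- apply: (ftc (fun w => k^-1 * sin (k * w))) => //; last by rewrite s0 !mulr0 sin0 mulr0.
  move=> w; apply: is_derive_eq.
  by rewrite /GRing.scale /=; field.
- apply: (ftc (fun w => - k^-1 * cos (k * w))) => //; last by rewrite c1 mulr0 cos0.
  move=> w; apply: is_derive_eq.
  by rewrite /GRing.scale /=; field.
Qed.

Lemma expi_2piz (n : int) : expi (n%:~R * (2 * pi) : K) = 1.
Proof.
have e1 : expi (2 * pi : K) = 1.
  by rewrite /expi mulr_natl cos2pi sin2pi.
rewrite -[2 * pi]mul1r.
by rewrite mulrCA [_ * (n%:~R * _)]mul1r -expi_exprz e1 exp1rz.
Qed.

Lemma circle_mean_exprz (n : int) : circle_mean (fun w : K => (expi w ^ n)%R) = (n == 0)%:R.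
Proof.
have p2 : 0 < 2 * pi :> K by rewrite mulr_gt0 // pi_gt0.
have mD : measurable D by exact: measurable_itv.
have [->|n0] := eqVneq n 0.
  apply/eqP; rewrite eq_complex /=; apply/andP; split; apply/eqP.
    rewrite (@eq_Rintegral _ _ _ _ _ (fun=> 1)) => [|w _]; last by [].
    rewrite Rintegral_cst // [X in fine X](_ : _ = mu D) // lebesgue_measure_itv /= lte_fin p2 /= subr0 mul1r mulVf //.
    by rewrite lt0r_neq0.
  rewrite (@eq_Rintegral _ _ _ _ _ (fun=> 0)) => [|w _]; last by [].
  by rewrite Rintegral_cst // mul0r mulr0.
have k0 : (n%:~R : K) != 0 by rewrite intr_eq0.
have := expi_2piz n; rewrite /expi => -[c1 s0].
have [i1 i2] := mean_cos_sin k0 c1 s0.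
rewrite (circle_mean_ext (fun w => expi_exprz w n)).
apply/eqP; rewrite eq_complex /=; apply/andP; split; apply/eqP.
  by rewrite i1 mulr0.
by rewrite i2 mulr0.
Qed.

Lemma fcD f g n : cmeas f -> cmeas g -> fc (fun z => f z + g z) n = fc f n + fc g n.
Proof.
move=> mf mg; rewrite /fc.
have e := cmeas_exprz (- n).
rewrite -(circle_meanD (cmeasM e mf) (cmeasM e mg)).
by apply: circle_mean_ext => w; rewrite mulrDr.
Qed.

Lemma fcZ (c : Cx K) f n : cmeas f -> fc (fun z => c * f z) n = c * fc f n.
Proof.
move=> mf; rewrite /fc -(circle_meanZ c (cmeasM (cmeas_exprz (- n)) mf)).
by apply: circle_mean_ext => w; rewrite mulrCA.
Qed.

Lemma fcB f g n : cmeas f -> cmeas g -> fc (fun z => f z - g z) n = fc f n - fc g n.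
Proof.
move=> mf mg; rewrite -[- fc g n]mulN1r -fcZ // -fcD //; last first.
  exact: cmeasM (cmeas_cst _) mg.
by apply: fc_ext => z _; rewrite mulN1r.
Qed.

Lemma fc_sum (I : Type) (s : seq I) (f : I -> Cx K -> Cx K) n :
  (forall i, cmeas (f i)) -> fc (fun z => \sum_(i <- s) f i z) n = \sum_(i <- s) fc (f i) n.
Proof.
move=> mf; elim: s => [|i s IH].
  rewrite big_nil -[RHS](mul0r (fc (fun=> 0) n)) -fcZ; last exact: cmeas_cst.
  by apply: fc_ext => z _; rewrite big_nil mul0r.
rewrite big_cons -IH -fcD //; last exact: cmeas_sum.
by apply: fc_ext => z _; rewrite big_cons.
Qed.

Lemma fc_shift f (k n : int) : fc (fun z => (z ^ k)%R * f z) n = fc f (n - k).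
Proof.
apply: circle_mean_ext => w; rewrite mulrA -expfzDr ?expi_neq0 //.
by congr ((_ ^ _)%R * _); rewrite opprB addrC.
Qed.

Lemma fc_exprz (k n : int) : fc (fun z => (z ^ k)%R) n = (n == k)%:R.
Proof.
rewrite -[n == k]subr_eq0 -[n - k == 0]oppr_eq0 -circle_mean_exprz; apply: circle_mean_ext => w.
by rewrite -expfzDr ?expi_neq0 // opprB addrC.
Qed.

Lemma fc_le f n (B : K) : cmeas f -> (forall z, cabs z = 1 -> cabs (f z) <= B) ->
  cabs (fc f n) <= 2 * B.
Proof.
move=> mf hB; apply: (circle_mean_le (cmeasM (cmeas_exprz (- n)) mf)) => z z1.
rewrite cabsM; apply: le_trans (hB z z1).
suff -> : cabs (z ^ (- n))%R = 1 by rewrite mul1r.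
case: (- n) => k; first by rewrite -exprnP cabsX z1 expr1n.
by rewrite NegzE -exprnN cabsV cabsX z1 expr1n invr1.
Qed.

End CircleMean.

(** * Functions on the circle with one-sided, geometrically decaying Fourier coefficients *)

Section WienerClass.
Variable K : realType.
Implicit Types (f g : Cx K -> Cx K) (z : Cx K) (s : int).

Lemma cabs_exprz z s : cabs z = 1 -> cabs (z ^ s)%R = 1.
Proof.
move=> z1; case: s => n; first by rewrite -exprnP cabsX z1 expr1n.
by rewrite NegzE -exprnN cabsV cabsX z1 expr1n invr1.
Qed.

(* For [s = 1] (resp. [s = -1]): Fourier coefficients supported on the nonnegative
   (resp. nonpositive) integers and decaying geometrically. *)
Definition wiener s f : Prop := exists a M q, 0 <= q < 1 /\
  forall z, cabs z = 1 -> pexp a (f z) (z ^ s)%R M q.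

Lemma wiener_ext s f g : (forall z, cabs z = 1 -> f z = g z) -> wiener s f -> wiener s g.
Proof.
move=> fg [a [M [q [q01 h]]]]; exists a, M, q; split=> // z z1.
by rewrite -fg //; exact: h.
Qed.

Lemma wiener_common s f g : wiener s f -> wiener s g -> exists a b M q, 0 <= q < 1 /\
  forall z, cabs z = 1 -> pexp a (f z) (z ^ s)%R M q /\ pexp b (g z) (z ^ s)%R M q.
Proof.
move=> [a [M [q [/andP[q0 q1] hf]]]] [b [M' [q' [/andP[q'0 q'1] hg]]]].
have M0 : 0 <= M by apply: pexp_M_ge0 (hf 1 (cabs1 K)).
have M'0 : 0 <= M' by apply: pexp_M_ge0 (hg 1 (cabs1 K)).
exists a, b, (M + M'), (Num.max q q'); split; first by rewrite le_max q0 gt_max q1.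
move=> z z1; split.
  by apply: pexp_le (hf z z1); rewrite ?q0 ?le_max ?lexx // lerDl.
by apply: pexp_le (hg z z1); rewrite ?q'0 ?le_max ?lexx ?orbT // lerDr.
Qed.

Lemma wienerD s f g : wiener s f -> wiener s g -> wiener s (fun z => f z + g z).
Proof.
move=> hf hg; have [a [b [M [q [q01 h]]]]] := wiener_common hf hg.
exists (fun n => a n + b n), (M + M), q; split=> // z /h[]; exact: pexpD.
Qed.

Lemma wienerM s f g : wiener s f -> wiener s g -> wiener s (fun z => f z * g z).
Proof.
move=> hf hg; have [a [b [M [q [/andP[q0 q1] h]]]]] := wiener_common hf hg.
(* This [t] exceeds 1, and the new ratio [t * q = 2 q / (1 + q)] is still below 1. *)
pose t := 2 / (1 + q).
have t1 : 1 < t by rewrite ltr_pdivlMr; lra.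
exists (cauchy_prod a b), (M * M * (1 + (1 + q) / (t - 1))), (t * q); split.
  rewrite mulr_ge0 //=; last lra.
  by rewrite /t mulrAC ltr_pdivrMr; lra.
by move=> z /h[]; exact: pexpM_rate.
Qed.

Lemma wiener_cst s (c : Cx K) : wiener s (fun=> c).
Proof.
exists (fun n => if n is 0%N then c else 0), (cabs c), (1 / 2); split.
  by apply/andP; split; lra.
by move=> z _; apply: pexp_cst; lra.
Qed.

Lemma wiener_var s : wiener s (fun z => (z ^ s)%R).
Proof.
exists (fun n => if n is 0%N then 0 else if n is 1%N then 1 else 0), (cabs (0 : Cx K) + 1 + 1 / (1 / 2)), (1 / 2).
split; first by apply/andP; split; lra.
move=> z z1; rewrite -[X in pexp _ X]add0r; apply: pexp_var; first lra.
by rewrite cabs_exprz.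
Qed.

Lemma wiener_geometric s (c : Cx K) : cabs c < 1 -> wiener s (fun z => (1 - c * (z ^ s)%R)^-1).
Proof.
move=> c1; exists (fun n => c ^+ n), (1 - cabs c)^-1, (cabs c); split; first by rewrite cabs_ge0.
move=> z z1 N; have := cabs_exprz s z1; set h := (z ^ s)%R => h1.
set w := c * h; have cw : cabs w = cabs c by rewrite cabsM h1 mulr1.
have low : 1 - cabs c <= cabs (1 - w).
  by have := cabsD (1 - w) w; rewrite subrK cabs1 cw; lra.
have nz : 1 - w != 0 by rewrite -cabs_gt0; lra.
have -> : (1 - w)^-1 - \sum_(n < N) c ^+ n * h ^+ n = (1 - w)^-1 * w ^+ N.
  rewrite (eq_bigr (fun n : 'I_N => w ^+ n)) => [|k _]; last by rewrite exprMn.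
  apply: (mulfI nz); rewrite mulrBr mulrA divff // mul1r.
  by rewrite -[1 - w]opprB mulNr -subrX1; ring.
rewrite cabsM cabsX cw ler_wpM2r ?exprn_ge0 ?cabs_ge0 // cabsV lef_pV2 // posrE; lra.
Qed.

Lemma wiener_sum s (I : Type) (r : seq I) (f : I -> Cx K -> Cx K) :
  (forall i, wiener s (f i)) -> wiener s (fun z => \sum_(i <- r) f i z).
Proof.
move=> hf; elim: r => [|i r IH].
  by apply: wiener_ext (wiener_cst s 0) => z _; rewrite big_nil.
by apply: wiener_ext (wienerD (hf i) IH) => z _; rewrite big_cons.
Qed.

Lemma wiener_prod s (I : eqType) (r : seq I) (f : I -> Cx K -> Cx K) :
  {in r, forall i, wiener s (f i)} -> wiener s (fun z => \prod_(i <- r) f i z).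
Proof.
elim: r => [|i r IH] hf.
  by apply: wiener_ext (wiener_cst s 1) => z _; rewrite big_nil.
have hr : {in r, forall j, wiener s (f j)} by move=> j jr; apply: hf; rewrite inE jr orbT.
by apply: wiener_ext (wienerM (hf i (mem_head _ _)) (IH hr)) => z _; rewrite big_cons.
Qed.

Lemma wiener_exp s n : wiener s (fun z => (z ^ s)%R ^+ n).
Proof.
elim: n => [|n IH]; first exact: wiener_cst.
by apply: wiener_ext (wienerM (wiener_var s) IH) => z _; rewrite exprS.
Qed.

Lemma wiener_poly s (p : {poly Cx K}) : wiener s (fun z => p.[(z ^ s)%R]).
Proof.
apply: (@wiener_ext s (fun z => \sum_(i < size p) p`_i * (z ^ s)%R ^+ i)) => [z _|].
  by rewrite horner_coef.
by apply: wiener_sum => i; apply: wienerM; [exact: wiener_cst|exact: wiener_exp].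
Qed.

(** On the circle [f] is the pointwise limit of trigonometric polynomials, which are measurable. *)
Lemma wiener_cmeas s f : wiener s f -> cmeas f.
Proof.
move=> [a [M [q [q01 hf]]]].
pose S N z := \sum_(n < N) a n * (z ^ s)%R ^+ n.
have mS N : cmeas (S N).
  apply: cmeas_sum => n; apply: cmeasM; first exact: cmeas_cst.
  rewrite (_ : (fun z => _) = (fun z => (z ^ (s * n%:Z))%R)); first exact: cmeas_exprz.
  by apply: funext => z; rewrite exprnP exprz_exp.
have cvgS (w e : K) : 0 < e -> exists N, forall n, (N <= n)%N -> cabs (f (expi w) - S n (expi w)) < e.
  move=> e0; have M1 : 0 < M + 1 by rewrite ltr_wpDl // (pexp_M_ge0 (hf 1 (cabs1 K))).
  have [N hN] := exprn_small q01 (divr_gt0 e0 M1).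
  exists N => n Nn; apply: le_lt_trans (hf _ (cabs_expi w) n) _.
  case/andP: q01 => q0 q1.
  apply: (@le_lt_trans _ _ ((M + 1) * q ^+ n)); first by rewrite ler_wpM2r ?exprn_ge0 // lerDl.
  rewrite mulrC -ltr_pdivlMr //; apply: le_lt_trans hN.
  by rewrite ler_wiXn2l // ltW.
split; last by exists M => z /hf/pexp_val.
- apply: (@measurable_fun_cvg _ _ _ _ (fun N w => complex.Re (S N (expi w)))) => [N|w _].
    by case: (mS N).
  apply/cvgrPdist_lt => e /(cvgS w)[N hN]; exists N => // n /hN; apply: le_lt_trans.
  have -> : complex.Re (f (expi w)) - complex.Re (S n (expi w)) = complex.Re (f (expi w) - S n (expi w)).
    by case: (f _) => ? ?; case: (S _ _).
  exact: norm_Re_le.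
- apply: (@measurable_fun_cvg _ _ _ _ (fun N w => complex.Im (S N (expi w)))) => [N|w _].
    by case: (mS N).
  apply/cvgrPdist_lt => e /(cvgS w)[N hN]; exists N => // n /hN; apply: le_lt_trans.
  have -> : complex.Im (f (expi w)) - complex.Im (S n (expi w)) = complex.Im (f (expi w) - S n (expi w)).
    by case: (f _) => ? ?; case: (S _ _).
  exact: norm_Im_le.
Qed.

Lemma fc_exprzM s (n : nat) g i : fc (fun z => g z * (z ^ s)%R ^+ n) i = fc g (i - s * n%:Z).
Proof.
rewrite -fc_shift; apply: fc_ext => z _.
by rewrite mulrC exprnP exprz_exp.
Qed.

(** The convolution formula for the coefficients of a product: [f] is replaced by a partial sum of
    its expansion, and the error is estimated uniformly on the circle. *)
Lemma fc_pexpM s a M q f g (B : K) i N : cmeas g -> wiener s f ->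
  (forall z, cabs z = 1 -> pexp a (f z) (z ^ s)%R M q) ->
  (forall z, cabs z = 1 -> cabs (g z) <= B) ->
  cabs (fc (fun z => g z * f z) i - \sum_(n < N) a n * fc g (i - s * n%:Z)) <=
  2 * (B * M) * q ^+ N.
Proof.
move=> mg /wiener_cmeas mf hf hB.
have mt n : cmeas (fun z => g z * (a n * (z ^ s)%R ^+ n)).
  by apply: cmeasM => //; apply: cmeasM; [exact: cmeas_cst|exact: wiener_cmeas (wiener_exp s n)].
rewrite (eq_bigr (fun n : 'I_N => fc (fun z => g z * (a n * (z ^ s)%R ^+ n)) i)) => [|n _]; last first.
  rewrite -fc_exprzM -fcZ; last by apply: cmeasM => //; exact: wiener_cmeas (wiener_exp s n).
  by apply: fc_ext => z _; rewrite mulrCA.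
rewrite -fc_sum // -fcB; [|exact: cmeasM|exact: cmeas_sum].
rewrite -mulrA; apply: fc_le.
  apply: cmeasD; first exact: cmeasM.
  rewrite (_ : (fun z => _) = (fun z => -1 * \sum_(n < N) g z * (a n * (z ^ s)%R ^+ n))).
    by apply: cmeasM; [exact: cmeas_cst|exact: cmeas_sum].
  by apply: funext => z; rewrite mulN1r.
move=> z z1; rewrite -mulr_sumr -mulrBr cabsM -mulrA.
by rewrite ler_pM ?cabs_ge0 ?hB // hf.
Qed.

(** Multiplication by [f] moves frequencies only in the direction of [s], so the coefficient at [i]
    is fed by those of [g] at [i], [i - s], [i - 2 s] and so on. *)
Lemma fc_wiener_eq0 s f g i : cmeas g -> wiener s f ->
  (forall n : nat, fc g (i - s * n%:Z) = 0) -> fc (fun z => g z * f z) i = 0.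
Proof.
move=> mg wf g0; have [a [M [q [q01 hf]]]] := wf; have [_ _ [B hB]] := mg.
apply: (@cabs0_geometric _ _ (2 * (B * M)) q) => // N.
have := fc_pexpM i N mg wf hf hB.
by rewrite big1 ?subr0 // => n _; rewrite g0 mulr0.
Qed.

Lemma fc_one (k : int) : fc (fun=> 1 : Cx K) k = (k == 0)%:R.
Proof. by rewrite -fc_exprz; apply: fc_ext => z _; rewrite expr0z. Qed.

Lemma wiener_coef s a M q f (n : nat) : s != 0 -> 0 <= q < 1 ->
  (forall z, cabs z = 1 -> pexp a (f z) (z ^ s)%R M q) -> fc f (s * n%:Z) = a n.
Proof.
move=> s0 q01 hf; apply/eqP; rewrite -subr_eq0; apply/eqP.
apply: (@cabs0_geometric _ _ (2 * (1 * M) * q ^+ n.+1) q) => // N.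
have wf : wiener s f by exists a, M, q.
have h1 z : cabs z = 1 -> cabs (1 : Cx K) <= 1 by rewrite cabs1.
have := fc_pexpM (s * n%:Z) (n.+1 + N) (cmeas_cst 1) wf hf h1.
have -> : fc (fun z => 1 * f z) (s * n%:Z) = fc f (s * n%:Z).
  by apply: fc_ext => z _; rewrite mul1r.
have nN : (n < n.+1 + N)%N by rewrite addSn ltnS leq_addr.
rewrite (bigD1 (Ordinal nN)) //= big1 => [|k kn].
  by rewrite fc_one subrr eqxx mulr1 addr0 exprD mulrA.
rewrite fc_one -mulrBr mulf_eq0 (negPf s0) /= subr_eq0 eqz_nat.
by rewrite eq_sym (negPf (_ : k != n :> nat)) ?mulr0.
Qed.

Lemma wiener1_fc_neg f (n : nat) : wiener 1 f -> fc f (- n.+1%:Z) = 0.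
Proof.
move=> wf; have -> : fc f (- n.+1%:Z) = fc (fun z => 1 * f z) (- n.+1%:Z).
  by apply: fc_ext => z _; rewrite mul1r.
apply: (fc_wiener_eq0 (cmeas_cst 1) wf) => k.
by rewrite fc_one mul1r -opprD oppr_eq0 -PoszD.
Qed.

Lemma wienerN1_fc_pos f (n : nat) : wiener (-1) f -> fc f n.+1%:Z = 0.
Proof.
move=> wf; have -> : fc f n.+1%:Z = fc (fun z => 1 * f z) n.+1%:Z.
  by apply: fc_ext => z _; rewrite mul1r.
apply: (fc_wiener_eq0 (cmeas_cst 1) wf) => k.
by rewrite fc_one mulN1r opprK -PoszD.
Qed.

(** Applied with [d = 0] it is a uniqueness statement: if all coefficients of nonnegative index
    vanish, so does [f] on the circle. *)
Lemma wiener1_polynomial f (d : nat) : wiener 1 f -> (forall n : nat, (d <= n)%N -> fc f n%:Z = 0) ->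
  forall z, cabs z = 1 -> f z = \sum_(n < d) fc f n%:Z * z ^+ n.
Proof.
move=> wf f0 z z1; have [a [M [q [q01 hf]]]] := wf.
have ha n : fc f n%:Z = a n by rewrite -[n%:Z]mul1r (wiener_coef _ _ q01 hf).
apply/eqP; rewrite -subr_eq0; apply/eqP.
apply: (@cabs0_geometric _ _ (M * q ^+ d) q) => // N.
have := hf z z1 (d + N)%N; rewrite exprD mulrA big_split_ord /= [X in _ - (_ + X)]big1 => [|n _].
  rewrite addr0; congr (cabs (_ - _) <= _).
  by apply: eq_bigr => n _; rewrite ha expr1z.
by rewrite -ha f0 ?leq_addr // mul0r.
Qed.

End WienerClass.

(** * Stable realizations *)

Section Resolvent.
Variable K : realType.

Lemma stable_resolvent_unit n (A : 'M[Cx K]_n) z : stable A -> cabs z <= 1 ->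
  1%:M - z *: A \in unitmx.
Proof.
move=> sA z1; rewrite unitmxE unitfE; apply/negP => /det0P[v v0].
rewrite mulmxBr mulmx1 -scalemxAr => /eqP; rewrite subr_eq0 => /eqP vE.
have z0 : z != 0 by apply: contraNneq v0 => z0; rewrite vE z0 scale0r.
have /sA : eigenvalue A z^-1.
  by apply/eigenvalueP; exists v => //; rewrite [in RHS]vE scalerA mulVf // scale1r.
by rewrite norm_lt1 cabsV invf_lt1 ?cabs_gt0 // ltNge z1.
Qed.

Lemma stable_adj n (A : 'M[Cx K]_n) : stable A -> stable (A ^t*).
Proof.
move=> sA a; rewrite eigenvalue_root_char => ra; rewrite -norm_conjC; apply: sA.
rewrite eigenvalue_root_char; move: ra.
have -> : char_poly (A ^t*) = map_poly Num.conj (char_poly A).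
  rewrite /char_poly -det_map_mx -det_tr; congr (\det _).
  apply/matrixP => i j; rewrite !mxE rmorphB /= rmorphMn /= map_polyX map_polyC /=.
  by rewrite eq_sym.
by rewrite /root -{1}[a]conjCK horner_map fmorph_eq0.
Qed.

(** Its determinant is a common denominator of the entries of a transfer function, and stability
    keeps its zeros out of the closed disc. *)
Definition resolvent_mx n (A : 'M[Cx K]_n) : 'M[{poly Cx K}]_n :=
  1%:M - 'X *: map_mx polyC A.

Lemma resolvent_mxE n (A : 'M[Cx K]_n) z :
  map_mx (horner_eval z) (resolvent_mx A) = 1%:M - z *: A.
Proof.
rewrite /resolvent_mx map_mxB map_mx1 map_mxZ /= /horner_eval hornerX -map_mx_comp.
by congr (_ - _ *: _); apply/matrixP => i j; rewrite !mxE /= hornerC.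
Qed.

Lemma horner_det n (P : 'M[{poly Cx K}]_n) z :
  (\det P).[z] = \det (map_mx (horner_eval z) P).
Proof. by rewrite det_map_mx. Qed.

Lemma det_resolvent_neq0 n (A : 'M[Cx K]_n) z : stable A -> cabs z <= 1 ->
  (\det (resolvent_mx A)).[z] != 0.
Proof.
move=> sA z1; rewrite horner_det resolvent_mxE.
by have := stable_resolvent_unit sA z1; rewrite unitmxE unitfE.
Qed.

Lemma poly_eq0_near0 (p : {poly Cx K}) (e : K) : 0 < e ->
  (forall z, cabs z <= e -> p.[z] = 0) -> p = 0.
Proof.
move=> e0 hp; apply/eqP/negPn/negP => p0.
pose r := [seq ((e / k.+1%:R)%:C)%C : Cx K | k <- iota 0 (size p)].
have ur : uniq r.
  rewrite map_inj_uniq ?iota_uniq // => k l [] /(mulfI (lt0r_neq0 e0)) /invr_inj /eqP.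
  by rewrite eqr_nat => /eqP; case.
have ar : all (root p) r.
  apply/allP => _ /mapP[k _ ->]; apply/rootP/hp; rewrite cabs_real ger0_norm.
    by rewrite ler_pdivrMr // ler_peMr ?ler1n // ltW.
  by rewrite divr_ge0 // ltW.
by have := max_poly_roots p0 ar ur; rewrite size_map size_iota ltnn.
Qed.

Lemma transfer_rational n p r (A : 'M[Cx K]_n) (B : 'M[Cx K]_(n, r)) (C : 'M[Cx K]_(p, n))
    (D : 'M[Cx K]_(p, r)) i j : stable A -> exists s : {poly Cx K}, forall w, cabs w <= 1 ->
  (D + w *: (C *m invmx (1%:M - w *: A) *m B)) i j = s.[w] / (\det (resolvent_mx A)).[w].
Proof.
move=> sA; pose d := \det (resolvent_mx A).
exists (d * (D i j)%:P + 'X * (map_mx polyC C *m \adj (resolvent_mx A) *m map_mx polyC B) i j).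
move=> w w1; have dw := det_resolvent_neq0 sA w1.
rewrite hornerD hornerM hornerC hornerM hornerX.
have -> : ((map_mx polyC C *m \adj (resolvent_mx A) *m map_mx polyC B) i j).[w] =
          (C *m \adj (1%:M - w *: A) *m B) i j.
  have hE p' q (P : 'M[{poly Cx K}]_(p', q)) a b : (P a b).[w] = map_mx (horner_eval w) P a b.
    by rewrite mxE.
  have mC p' q (M : 'M[Cx K]_(p', q)) : map_mx (horner_eval w) (map_mx polyC M) = M.
    by apply/matrixP => a b; rewrite !mxE /= /horner_eval hornerC.
  by rewrite hE !map_mxM /= !mC map_mx_adj resolvent_mxE.
rewrite /invmx (stable_resolvent_unit sA w1) -scalemxAr -scalemxAl.
rewrite mxE [X in _ + X]mxE [X in _ + _ * X]mxE -[\det (1%:M - _)]/(\det (1%:M - w *: A)).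
rewrite -resolvent_mxE -horner_det -/d; field; exact: dw.
Qed.

(** The realization is given near 0 only. Both sides are quotients, so [p d = s q] as polynomials;
    as [p] and [q] are coprime, [q] divides [d], which has no zero in the closed disc. So [F] is
    determined by its quotient up to and including the circle. *)
Lemma realization_disc m n (F : Cx K -> 'M[Cx K]_m) (A : 'M[Cx K]_n) B C D :
  mx_rational F -> stable A -> realization F A B C D ->
  forall z, cabs z <= 1 -> F z = D + z *: (C *m invmx (1%:M - z *: A) *m B).
Proof.
move=> ratF sA realF z z1; apply/matrixP => i j.
pose d := \det (resolvent_mx A).
have [s sE] := transfer_rational B C D i j sA; rewrite -/d in sE.
rewrite (sE z z1).
have [p [q [q0 pq Fpq]]] := ratF i j.
have eqp : p * d = s * q.
  have [e' e'0 he] : exists2 e : K, 0 < e & forall w, cabs w <= e ->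
      F w = D + w *: (C *m invmx (1%:M - w *: A) *m B).
    move/nbhs_ballP: realF => [e /gt0_Cx[e' e'0 ->] he]; exists (e' / 2); first lra.
    by move=> w we; apply: he; rewrite -ball_normE /= sub0r normrN norm_ltR; lra.
  apply/eqP; rewrite -subr_eq0; apply/eqP.
  (* The extra factor [q] covers its own zeros, where [p / q] says nothing about [F]. *)
  suff /eqP : (p * d - s * q) * q = 0 by rewrite mulf_eq0 (negPf q0) orbF => /eqP.
  apply: (@poly_eq0_near0 _ (Num.min e' 1)); first by rewrite lt_min e'0 ltr01.
  move=> w; rewrite le_min => /andP[we w1].
  rewrite !(hornerM, hornerD, hornerN).
  have [->|qw] := eqVneq q.[w] 0; first by rewrite mulr0.
  have := Fpq w qw; rewrite he // sE // => /eqP.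
  have dw := det_resolvent_neq0 sA w1; rewrite -/d in dw.
  by rewrite eqr_div // => /eqP ->; rewrite subrr mul0r.
have qd : q %| d.
  have : q %| p * d by rewrite eqp dvdp_mull.
  by rewrite Gauss_dvdpr // coprimep_sym.
have dz := det_resolvent_neq0 sA z1; rewrite -/d in dz.
have qz : q.[z] != 0.
  have /dvdpP[r dE] := qd.
  by apply: contraNneq dz => qz; rewrite dE hornerM qz mulr0.
rewrite Fpq //; apply/eqP; rewrite eqr_div // -!hornerM eqp.
by rewrite mulrC.
Qed.

Definition mexp m n (a : nat -> 'M[Cx K]_(m, n)) (F : 'M[Cx K]_(m, n)) (h : Cx K) (M q : K) :=
  forall N, mnorm (F - \sum_(k < N) h ^+ k *: a k) <= M * q ^+ N.

Lemma mexp_entry m n a (F : 'M[Cx K]_(m, n)) h M q i j : mexp a F h M q ->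
  pexp (fun k => a k i j) (F i j) h M q.
Proof.
move=> hF N; apply: le_trans (hF N); have := cabs_le_mnorm (F - \sum_(k < N) h ^+ k *: a k) i j.
rewrite !mxE summxE (eq_bigr (fun k : 'I_N => a k i j * h ^+ k)) // => k _.
by rewrite mxE mulrC.
Qed.

Lemma mexpM m n p r a (F : 'M[Cx K]_(n, p)) h M q (X : 'M[Cx K]_(m, n)) (Y : 'M[Cx K]_(p, r)) :
  mexp a F h M q -> mexp (fun k => X *m a k *m Y) (X *m F *m Y) h (mnorm X * M * mnorm Y) q.
Proof.
move=> hF N.
have -> : X *m F *m Y - \sum_(k < N) h ^+ k *: (X *m a k *m Y) =
          X *m (F - \sum_(k < N) h ^+ k *: a k) *m Y.
  rewrite mulmxBr mulmxBl mulmx_sumr mulmx_suml; congr (_ - _).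
  by apply: eq_bigr => k _; rewrite -scalemxAr -scalemxAl.
apply: le_trans (mnormM _ _) _; rewrite mulrAC ler_wpM2r ?mnorm_ge0 //.
apply: le_trans (mnormM _ _) _; rewrite -mulrA ler_wpM2l ?mnorm_ge0 //.
Qed.

Lemma resolvent_expansion n (A : 'M[Cx K]_n) z N : 1%:M - z *: A \in unitmx ->
  invmx (1%:M - z *: A) = \sum_(k < N) z ^+ k *: A ^+ k + z ^+ N *: A ^+ N *m invmx (1%:M - z *: A).
Proof.
move=> u; set I := invmx _.
have IE : I = 1%:M + z *: A *m I.
  by apply/eqP; rewrite -subr_eq -{1}[I]mul1mx -mulmxBl mulmxV.
elim: N => [|N IH]; first by rewrite big_ord0 add0r !expr0 scale1r mul1mx.
rewrite {1}IH big_ord_recr /= -addrA; congr (_ + _).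
rewrite {1}IE mulmxDr mulmx1 mulmxA; congr (_ + _ *m _).
by rewrite -scalemxAl -scalemxAr scalerA exprSr exprSr -mulmxE.
Qed.

Lemma resolvent_mexp n (A : 'M[Cx K]_n) : stable A -> exists M q, 0 <= q < 1 /\
  forall z, cabs z <= 1 -> mexp (fun k => A ^+ k) (invmx (1%:M - z *: A)) z M q.
Proof.
move=> sA; have [c [q [c0 /andP[q0 q1] hA]]] := stable_geometric sA.
have q01 : 0 <= q < 1 by rewrite ltW.
have zA z k : cabs z <= 1 -> mnorm (z ^+ k *: A ^+ k) <= c * q ^+ k.
  move=> z1; rewrite mnormZ cabsX; apply: le_trans (hA k).
  by rewrite ler_piMl ?mnorm_ge0 // exprn_ile1 ?cabs_ge0.
have c1 : 0 < 2 * (c + 1) by lra.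
(* With the remainder of the Neumann series at most half the norm of the resolvent, that norm is at
   most twice the partial sum, uniformly on the closed disc. *)
have [N0 hN0] : exists N, c * q ^+ N <= 1 / 2.
  have [N hN] := @exprn_small _ q (1 / (2 * (c + 1))) q01 (divr_gt0 ltr01 c1).
  exists N; apply: (@le_trans _ _ ((c + 1) * q ^+ N)).
    by rewrite ler_wpM2r ?exprn_ge0 ?(ltW q0) // lerDl.
  rewrite mulrC -ler_pdivlMr; last lra.
  apply: le_trans (ltW hN) _.
  by rewrite (_ : 1 / (2 * (c + 1)) = 1 / 2 / (c + 1)) //; field; lra.
pose S := \sum_(k < N0) c * q ^+ k.
have bound z : cabs z <= 1 -> mnorm (invmx (1%:M - z *: A)) <= 2 * S.
  move=> z1; set I := invmx _.
  have hI : mnorm I <= S + 1 / 2 * mnorm I.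
    rewrite {1}/I (resolvent_expansion N0 (stable_resolvent_unit sA z1)).
    apply: le_trans (mnormD _ _) _; apply: lerD.
      rewrite /S; elim: N0 {hN0 S} => [|N IH]; first by rewrite !big_ord0 mnorm0.
      by rewrite !big_ord_recr /=; apply: le_trans (mnormD _ _) _; apply: lerD => //; exact: zA.
    apply: le_trans (mnormM _ _) _; rewrite ler_wpM2r ?mnorm_ge0 //.
    exact: le_trans (zA z N0 z1) hN0.
  lra.
exists (c * (2 * S)), q; split=> // z z1 N.
rewrite {1}(resolvent_expansion N (stable_resolvent_unit sA z1)) addrAC subrr add0r.
apply: le_trans (mnormM _ _) _; rewrite mulrAC ler_pM ?mnorm_ge0 //.
  exact: zA.
exact: bound.
Qed.

End Resolvent.

(** * The symbol as a causal plus an anticausal transfer function *)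

Section SymbolCoefficients.
Variable K : realType.

Lemma circle_conjV (z : Cx K) : cabs z = 1 -> (z^*)^-1 = z.
Proof.
move=> z1; have z0 : z != 0 by rewrite -cabs_gt0 z1.
apply: (@mulIf _ z^*); first by rewrite conjC_eq0.
by rewrite mulVf ?conjC_eq0 // -normCK normE z1 expr1n.
Qed.

Lemma circle_conj (z : Cx K) : cabs z = 1 -> z^* = z^-1.
Proof. by move=> z1; rewrite -[RHS](congr1 (@GRing.inv _) (circle_conjV z1)) invrK. Qed.

Lemma invmx_adj n (A : 'M[Cx K]_n) : (invmx A) ^t* = invmx (A ^t*).
Proof. by rewrite trmx_inv map_invmx. Qed.

Lemma hadjZ m n (a : Cx K) (A : 'M[Cx K]_(m, n)) : (a *: A) ^t* = a^* *: A ^t*.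
Proof. by rewrite linearZ /= map_mxZ. Qed.

Lemma cmeas_ext (f g : Cx K -> Cx K) : (forall z, cabs z = 1 -> f z = g z) -> cmeas f -> cmeas g.
Proof.
move=> fg [mr mi [B hB]]; split.
- by rewrite (_ : (fun w => _) = (fun w => complex.Re (f (expi w)))) //; apply: funext => w; rewrite fg ?cabs_expi.
- by rewrite (_ : (fun w => _) = (fun w => complex.Im (f (expi w)))) //; apply: funext => w; rewrite fg ?cabs_expi.
- by exists B => z z1; rewrite -fg // hB.
Qed.

Variables (m nv nw : nat) (V W : Cx K -> 'M[Cx K]_m).
Variables (Av : 'M[Cx K]_nv) (Bv : 'M[Cx K]_(nv, m)) (Cv : 'M[Cx K]_(m, nv)) (Dv : 'M[Cx K]_m).
Variables (A : 'M[Cx K]_nw) (B : 'M[Cx K]_(nw, m)) (C : 'M[Cx K]_(m, nw)) (D : 'M[Cx K]_m).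
Hypothesis Av_stable : stable Av.
Hypothesis A_stable : stable A.
Hypothesis V_disc : forall z, cabs z <= 1 -> V z = Dv + z *: (Cv *m invmx (1%:M - z *: Av) *m Bv).
Hypothesis W_disc : forall z, cabs z <= 1 -> W z = D + z *: (C *m invmx (1%:M - z *: A) *m B).
Variables (Omega : 'M[Cx K]_(nv, nw)) (C0 : 'M[Cx K]_(m, nw)).
Hypothesis Omega_eq : Omega = Av *m Omega *m A ^t* + Bv *m B ^t*.
Hypothesis C0_def : C0 = Dv *m B ^t* + Cv *m Omega *m A ^t*.

Definition symbol (z : Cx K) : 'M[Cx K]_m := V z *m star_fun W z.
(** The input operator of the causal part, whose state and output operators are [Av] and [Cv]; the
    anticausal part is realized by [C0], [A^*] and [C^*]. *)
Definition symbolB : 'M[Cx K]_(nv, m) := Bv *m D ^t* + Av *m Omega *m C ^t*.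
Definition symbolD : 'M[Cx K]_m := Dv *m D ^t* + Cv *m Omega *m C ^t*.

Lemma star_fun_circle z : cabs z = 1 ->
  star_fun W z = D ^t* + z^-1 *: (B ^t* *m invmx (1%:M - z^-1 *: A ^t*) *m C ^t*).
Proof.
move=> z1; rewrite /star_fun circle_conjV //.
rewrite W_disc; last by rewrite z1.
have -> : invmx (1%:M - z^-1 *: A ^t*) = (invmx (1%:M - z *: A)) ^t*.
  by rewrite invmx_adj hadjB hadj1 hadjZ circle_conj.
by rewrite -circle_conj // hadjD hadjZ !hadjM mulmxA.
Qed.

(** In the product only [Cv N (Bv B^* ) L C^*] couples the resolvents [N] and [L]. The Stein
    equation writes [Bv B^*] as [Omega - Av Omega A^*], which makes the doubly resolved parts
    cancel. *)
Lemma symbol_circle z : cabs z = 1 ->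
  symbol z = symbolD + z *: (Cv *m invmx (1%:M - z *: Av) *m symbolB) +
    z^-1 *: (C0 *m invmx (1%:M - z^-1 *: A ^t*) *m C ^t*).
Proof.
move=> z1; rewrite /symbol star_fun_circle // V_disc ?z1 //.
have z0 : z != 0 by rewrite -cabs_gt0 z1.
set N := invmx (_ - z *: _); set L := invmx (_ - z^-1 *: _).
have uN : 1%:M - z *: Av \in unitmx by apply: stable_resolvent_unit; rewrite ?z1.
have uL : 1%:M - z^-1 *: A ^t* \in unitmx.
  by apply: stable_resolvent_unit; [exact: stable_adj|rewrite cabsV z1 invr1].
have N1 : N *m Av = z^-1 *: (N - 1%:M).
  have : N *m (1%:M - z *: Av) = 1%:M by rewrite mulVmx.
  rewrite mulmxBr mulmx1 -scalemxAr => <-.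
  by rewrite opprB addrC subrK scalerA mulVf // scale1r.
have L1 : A ^t* *m L = z *: (L - 1%:M).
  have : (1%:M - z^-1 *: A ^t*) *m L = 1%:M by rewrite mulmxV.
  rewrite mulmxBl mul1mx -scalemxAl => <-.
  by rewrite opprB addrC subrK scalerA mulfV // scale1r.
have BB : Bv *m B ^t* = Omega - Av *m Omega *m A ^t* by rewrite {1}Omega_eq addrC addKr.
have cross : N *m (Bv *m B ^t*) *m L =
    Omega + z *: (N *m Av *m Omega) + z^-1 *: (Omega *m (A ^t* *m L)).
  rewrite BB mulmxBr mulmxBl.
  have -> : N *m (Av *m Omega *m A ^t*) *m L = N *m Av *m Omega *m (A ^t* *m L).
    by rewrite !mulmxA.
  rewrite N1 L1 -!scalemxAl -!scalemxAr !scalerA mulVf // mulfV // !scale1r.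
  rewrite !(mulmxBl, mulmxBr, mul1mx, mulmx1).
  move: (N *m Omega *m L) (N *m Omega) (Omega *m L) => X Y Z.
  by apply/matrixP => i j; rewrite !mxE; ring.
rewrite mulmxDl mulmxDr.
have -> : z *: (Cv *m N *m Bv) *m (D ^t* + z^-1 *: (B ^t* *m L *m C ^t*)) =
  z *: (Cv *m N *m Bv *m D ^t*) + Cv *m (N *m (Bv *m B ^t*) *m L) *m C ^t*.
  by rewrite mulmxDr -scalemxAl -scalemxAl -scalemxAr scalerA mulfV // scale1r !mulmxA.
rewrite cross /symbolD /symbolB C0_def.
rewrite !(mulmxDr, mulmxDl) !(=^~ scalemxAr, =^~ scalemxAl) !scalerDr !mulmxA.
by rewrite [LHS](AC (2*(1*3)) (1*4*(3*5)*(2*6))).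
Qed.

(** [Negz k] is the index [-(k + 1)], so both one-sided branches start with the zeroth power of
    their state operator. *)
Definition symbol_coef (n : int) : 'M[Cx K]_m :=
  match n with
  | Posz 0 => symbolD
  | Posz k.+1 => Cv *m Av ^+ k *m symbolB
  | Negz k => C0 *m (A ^t*) ^+ k *m C ^t*
  end.

Lemma wiener_forward n p r (X : 'M[Cx K]_n) (Y : 'M[Cx K]_(p, n)) (Z : 'M[Cx K]_(n, r)) i j :
  stable X -> let f z := (Y *m invmx (1%:M - z *: X) *m Z) i j in
  wiener 1 f /\ forall k : nat, fc f k%:Z = (Y *m X ^+ k *m Z) i j.
Proof.
move=> sX f; have [M [q [q01 h]]] := resolvent_mexp sX.
have hf z : cabs z = 1 -> pexp (fun k => (Y *m X ^+ k *m Z) i j) (f z) (z ^ (1 : int))%R (mnorm Y * M * mnorm Z) q.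
  by move=> z1; rewrite expr1z; apply: mexp_entry; apply: mexpM; apply: h; rewrite z1.
split; first by exists (fun k => (Y *m X ^+ k *m Z) i j), (mnorm Y * M * mnorm Z), q.
by move=> k; rewrite -[k%:Z]mul1r (wiener_coef _ _ q01 hf).
Qed.

Lemma wiener_backward n p r (X : 'M[Cx K]_n) (Y : 'M[Cx K]_(p, n)) (Z : 'M[Cx K]_(n, r)) i j :
  stable X -> let f z := (Y *m invmx (1%:M - z^-1 *: X) *m Z) i j in
  wiener (-1) f /\ forall k : nat, fc f (- k%:Z) = (Y *m X ^+ k *m Z) i j.
Proof.
move=> sX f; have [M [q [q01 h]]] := resolvent_mexp sX.
have hf z : cabs z = 1 -> pexp (fun k => (Y *m X ^+ k *m Z) i j) (f z) (z ^ (-1 : int))%R (mnorm Y * M * mnorm Z) q.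
  move=> z1; rewrite exprN1; apply: mexp_entry; apply: mexpM; apply: h.
  by rewrite cabsV z1 invr1.
split; first by exists (fun k => (Y *m X ^+ k *m Z) i j), (mnorm Y * M * mnorm Z), q.
by move=> k; rewrite -mulN1r (wiener_coef _ _ q01 hf).
Qed.

Lemma symbol_entry i j :
  let U z := (Cv *m invmx (1%:M - z *: Av) *m symbolB) i j in
  let T z := (C0 *m invmx (1%:M - z^-1 *: A ^t*) *m C ^t*) i j in
  forall z, cabs z = 1 ->
  symbolD i j + (z ^ (1 : int))%R * U z + (z ^ (-1 : int))%R * T z = symbol z i j.
Proof.
move=> U T z z1; rewrite symbol_circle // expr1z exprN1.
by rewrite [RHS]mxE [X in _ = X + _]mxE [X in _ = _ + X + _]mxE [X in _ = _ + X]mxE.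
Qed.

Lemma cmeas_symbol i j : cmeas (fun z => symbol z i j).
Proof.
have [wU _] := wiener_forward Cv symbolB i j Av_stable.
have [wT _] := wiener_backward C0 (C ^t*) i j (stable_adj A_stable).
apply: cmeas_ext (symbol_entry i j) _; apply: cmeasD; first apply: cmeasD.
- exact: cmeas_cst.
- by apply: cmeasM; [exact: cmeas_exprz|exact: wiener_cmeas wU].
- by apply: cmeasM; [exact: cmeas_exprz|exact: wiener_cmeas wT].
Qed.

Lemma fourier_symbol n : fourier symbol n = symbol_coef n.
Proof.
apply/matrixP => i j; rewrite mxE -[LHS]/(fc (fun z => symbol z i j) n).
have [wU cU] := wiener_forward Cv symbolB i j Av_stable.
have [wT cT] := wiener_backward C0 (C ^t*) i j (stable_adj A_stable).
rewrite -(fc_ext n (symbol_entry i j)).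
have mU := cmeasM (@cmeas_exprz K 1) (wiener_cmeas wU).
have mT := cmeasM (@cmeas_exprz K (-1)) (wiener_cmeas wT).
rewrite fcD //; last by apply: cmeasD; [exact: cmeas_cst|].
rewrite fcD //; last exact: cmeas_cst.
rewrite !fc_shift opprK.
have -> : fc (fun=> symbolD i j) n = symbolD i j * (n == 0)%:R.
  rewrite -fc_one -fcZ; last exact: cmeas_cst.
  by apply: fc_ext => z _; rewrite mulr1.
case: n => [[|n]|n] /=.
- rewrite mulr1 sub0r (wiener1_fc_neg 0 wU) add0r (wienerN1_fc_pos 0 wT).
  by rewrite !addr0.
- rewrite mulr0 add0r (_ : n.+1%:Z - 1 = n%:Z) ?cU; last by rewrite -addn1 PoszD addrK.
  by rewrite (_ : n.+1%:Z + 1 = n.+2%:Z) ?(wienerN1_fc_pos _ wT) ?addr0 // -PoszD addn1.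
- rewrite mulr0 add0r NegzE (_ : - n.+1%:Z - 1 = - n.+2%:Z); last first.
    by rewrite -opprD -PoszD addn1.
  rewrite (wiener1_fc_neg _ wU) add0r (_ : - n.+1%:Z + 1 = - n%:Z) ?cT //.
  by rewrite -[n.+1]addn1 PoszD opprD addrNK.
Qed.

End SymbolCoefficients.

(** * Kernels of Toeplitz operators *)

Lemma subn_pred_rev i j : (j < i)%N -> (i.-1 - (i - j.+1))%N = j.
Proof. by lia. Qed.

Lemma subn_pred_succ i j : (j < i)%N -> (i - j)%N = (i.-1 - j).+1.
Proof. by lia. Qed.

Lemma subz_pred_succ (i j : nat) : (j < i)%N -> i%:Z - j%:Z = (i.-1 - j).+1%:Z.
Proof. by lia. Qed.

Lemma subz_succ_add (i j : nat) : i%:Z - (i.+1 + j)%N%:Z = Negz j.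
Proof. by lia. Qed.

Section Convergence.
Variable K : realType.

Lemma cvg_geometric_shift (u : nat -> Cx K) (l : Cx K) (c q : K) i : 0 <= q < 1 ->
  (forall N, cabs (l - u (i + N)%N) <= c * q ^+ N) -> u @ \oo --> l.
Proof.
move=> q01 h; apply/cvg_CxP => e e0.
have c0 : 0 <= c by have := h 0%N; rewrite expr0 mulr1; apply: le_trans (cabs_ge0 _).
have c1 : 0 < c + 1 by lra.
have [N hN] := exprn_small q01 (divr_gt0 e0 c1).
exists (i + N)%N => n inn; rewrite -(subnKC (leq_trans (leq_addr N i) inn)).
apply: le_lt_trans (h _) _; case/andP: q01 => q0 q1.
apply: (@le_lt_trans _ _ ((c + 1) * q ^+ (n - i))); first by rewrite ler_wpM2r ?exprn_ge0 // lerDl.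
rewrite mulrC -ltr_pdivlMr //; apply: le_lt_trans hN.
by rewrite ler_wiXn2l ?(ltW q1) // leq_subRL // (leq_trans (leq_addr N i)).
Qed.

Lemma mnorm_le_entries m n (X : 'M[Cx K]_(m, n)) (e : K) :
  (forall i j, cabs (X i j) <= e) -> mnorm X <= (m * n)%:R * e.
Proof.
move=> h; apply: (@le_trans _ _ (\sum_(i < m) \sum_(j < n) e)).
  by apply: ler_sum => i _; apply: ler_sum => j _; exact: h.
rewrite (eq_bigr (fun=> n%:R * e)) => [|i _]; last by rewrite sumr_const card_ord mulr_natl.
by rewrite sumr_const card_ord -[leLHS]mulr_natl natrM mulrA.
Qed.

Lemma mx_geometric_lim m n (u : nat -> 'M[Cx K]_(m, n)) (c q : K) : 0 <= q < 1 ->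
  (forall k, mnorm (u k) <= c * q ^+ k) ->
  exists l, forall N, mnorm (l - \sum_(k < N) u k) <= (m * n)%:R * (c / (1 - q) * 2) * q ^+ N.
Proof.
move=> q01 h.
have /choice[l hl'] : forall i : 'I_m, exists li : 'I_n -> Cx K, forall j N,
    cabs (li j - \sum_(0 <= k < N) u k i j) <= c / (1 - q) * 2 * q ^+ N.
  move=> i; suff /choice[f hf] : forall j, exists l, forall N,
      cabs (l - \sum_(0 <= k < N) u k i j) <= c / (1 - q) * 2 * q ^+ N by exists f.
  move=> j; apply: geometric_lim q01 _ => k.
  exact: le_trans (cabs_le_mnorm _ _ _) (h k).
exists (\matrix_(i, j) l i j) => N; rewrite -mulrA; apply: mnorm_le_entries => i j.
by rewrite !mxE summxE -(big_mkord xpredT (fun k => u k i j)); exact: hl'.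
Qed.

(** A bounded input makes the state series of [backward_state] converge. *)
Lemma ell2_bounded m (h : nat -> 'cV[Cx K]_m) : ell2 h ->
  exists b, forall n, mnorm (h n) <= b.
Proof.
move=> /cvg_ex[l /series_bounded[b hb]].
exists ((m * 1)%:R * (b + 1)) => n; apply: mnorm_le_entries => i j; rewrite [j]ord1.
have := hb n.
have -> : \sum_(i < m) `|h n i 0| ^+ 2 = ((\sum_(i < m) cabs (h n i 0) ^+ 2)%:C)%C :> Cx K.
  by rewrite rmorph_sum /=; apply: eq_bigr => k _; rewrite normE rmorphXn.
have s0 : 0 <= \sum_(i < m) cabs (h n i 0) ^+ 2 by apply: sumr_ge0 => k _; exact: sqr_ge0.
rewrite cabs_real ger0_norm // => hb'.
have : cabs (h n i 0) ^+ 2 <= b.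
  apply: le_trans hb'; rewrite (bigD1 i) //= lerDl.
  by apply: sumr_ge0 => k _; exact: sqr_ge0.
have := cabs_ge0 (h n i 0); nra.
Qed.

Lemma geometric_ell2 m (h : nat -> 'cV[Cx K]_m) (c q : K) : 0 <= q < 1 ->
  (forall n, mnorm (h n) <= c * q ^+ n) -> ell2 h.
Proof.
move=> q01 hh; have [q0 q1] := andP q01.
have [l hl] : exists l : Cx K, forall N, cabs (l - \sum_(0 <= n < N) \sum_(i < m) `|h n i 0| ^+ 2)
    <= (c ^+ 2 * m%:R) / (1 - q) * 2 * q ^+ N.
  apply: geometric_lim q01 _ => n.
  apply: le_trans (cabs_sum _ _ _) _.
  apply: (@le_trans _ _ (\sum_(i < m) c ^+ 2 * q ^+ n)); last first.
    by rewrite sumr_const card_ord -[leLHS]mulr_natr [leLHS]mulrAC.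
  apply: ler_sum => i _; rewrite cabsX [cabs `|_|](_ : _ = cabs (h n i 0)); last first.
    by rewrite normE cabs_real ger0_norm ?cabs_ge0.
  have h1 := le_trans (cabs_le_mnorm (h n) i 0) (hh n).
  have qn : q ^+ n <= 1 by rewrite exprn_ile1 // ltW.
  have qn0 : 0 <= q ^+ n by rewrite exprn_ge0.
  apply: (@le_trans _ _ ((c * q ^+ n) ^+ 2)).
    by rewrite lerXn2r // nnegrE ?cabs_ge0 // (le_trans (cabs_ge0 _) h1).
  by rewrite exprMn ler_wpM2l ?sqr_ge0 // expr2 ler_piMl.
apply/cvg_ex; exists l; apply: (@cvg_geometric_shift _ _ _ _ 0%N q01) => N.
by rewrite add0n; exact: hl.
Qed.

End Convergence.

(** * The Toeplitz operator as two stable systems in cascade *)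

Section ToeplitzKernel.
Variable K : realType.
Variables (m nv nw : nat) (V W : Cx K -> 'M[Cx K]_m).
Variables (Av : 'M[Cx K]_nv) (Bv : 'M[Cx K]_(nv, m)) (Cv : 'M[Cx K]_(m, nv)) (Dv : 'M[Cx K]_m).
Variables (A : 'M[Cx K]_nw) (B : 'M[Cx K]_(nw, m)) (C : 'M[Cx K]_(m, nw)) (D : 'M[Cx K]_m).
Hypothesis Av_stable : stable Av.
Hypothesis A_stable : stable A.
Hypothesis Uv : block_mx Av Bv Cv Dv \is unitarymx.
Hypothesis U : block_mx A B C D \is unitarymx.
Hypothesis V_disc : forall z, cabs z <= 1 -> V z = Dv + z *: (Cv *m invmx (1%:M - z *: Av) *m Bv).
Hypothesis W_disc : forall z, cabs z <= 1 -> W z = D + z *: (C *m invmx (1%:M - z *: A) *m B).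
Variables (Omega : 'M[Cx K]_(nv, nw)) (C0 : 'M[Cx K]_(m, nw)) (Q : 'M[Cx K]_nw).
Hypothesis Omega_eq : Omega = Av *m Omega *m A ^t* + Bv *m B ^t*.
Hypothesis C0_def : C0 = Dv *m B ^t* + Cv *m Omega *m A ^t*.
Hypothesis Q_eq : Q = A *m Q *m A ^t* + C0 ^t* *m C0.

Notation sB := (symbolB Av Bv C D Omega).
Notation scoef := (symbol_coef Av Bv Cv Dv A C D Omega C0).

(** The observability Gramian is the identity: by [A^* A + C^* C = 1] its partial sums are
    [1 - A^{*N} A^N]. *)
Lemma gramian_geometric : exists c q, 0 <= q < 1 /\ forall N,
  mnorm (1%:M - \sum_(l < N) (A ^t*) ^+ l *m (C ^t* *m C) *m A ^+ l) <= c * q ^+ N.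
Proof.
have [c [q [c0 /andP[q0 q1] hA]]] := stable_geometric A_stable.
have [_ [w1 _ _ _]] := unitary_block U.
exists (c * c), q; split=> [|N]; first by rewrite ltW.
have := @contraction_defect K m nw (A ^t*) (C ^t*) N; rewrite !trmxCK => /(_ w1) <-.
rewrite opprB addrC subrK; apply: le_trans (mnormM _ _) _.
rewrite -hadjX mnorm_adj -mulrA mulrCA ler_pM ?mnorm_ge0 //.
  by apply: le_trans (hA N) _; rewrite ler_piMr // exprn_ile1 // ltW.
Qed.

Lemma observability_injective (x : 'cV[Cx K]_nw) : (forall n, C *m (A ^+ n *m x) = 0) -> x = 0.
Proof.
move=> hx; have [c [q [q01 h]]] := gramian_geometric.
apply: (@mnorm0_geometric _ _ _ _ (c * mnorm x) q q01) => N.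
rewrite mulrAC; apply: le_trans (ler_wpM2r (mnorm_ge0 _) (h N)).
apply: le_trans (mnormM _ _); rewrite mulmxBl mul1mx mulmx_suml big1 ?subr0 // => l _.
by rewrite -!mulmxA hx !mulmx0.
Qed.

Section State.
Variables (H : nat -> 'cV[Cx K]_m) (b : K).
Hypothesis H_bounded : forall n, mnorm (H n) <= b.

(** Here [xi i] is the state of the adjoint system of [W], driven by the input from time [i] on. The
    rate does not depend on [i]. *)
Lemma backward_state : exists xi c q, 0 <= q < 1 /\ forall i N,
  mnorm (xi i - \sum_(l < N) (A ^t*) ^+ l *m (C ^t* *m H (i + l)%N)) <= c * q ^+ N.
Proof.
have [c [q [c0 /andP[q0 q1] hA]]] := stable_geometric A_stable.
have q01 : 0 <= q < 1 by rewrite ltW.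
have /choice[xi hxi] : forall i, exists l, forall N,
    mnorm (l - \sum_(k < N) (A ^t*) ^+ k *m (C ^t* *m H (i + k)%N)) <=
    (nw * 1)%:R * (c * (mnorm C * b) / (1 - q) * 2) * q ^+ N.
  move=> i; apply: (@mx_geometric_lim _ _ _ (fun k => (A ^t*) ^+ k *m (C ^t* *m H (i + k)%N)) _ _ q01) => k.
  apply: le_trans (mnormM _ _) _; rewrite -hadjX mnorm_adj mulrAC ler_pM ?mnorm_ge0 //.
  by apply: le_trans (mnormM _ _) _; rewrite mnorm_adj ler_wpM2l ?mnorm_ge0.
by exists xi, ((nw * 1)%:R * (c * (mnorm C * b) / (1 - q) * 2)), q.
Qed.

Variables (xi : nat -> 'cV[Cx K]_nw) (c q : K).
Hypothesis q01 : 0 <= q < 1.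
Hypothesis xiP : forall i N,
  mnorm (xi i - \sum_(l < N) (A ^t*) ^+ l *m (C ^t* *m H (i + l)%N)) <= c * q ^+ N.

Lemma backward_step i : xi i = A ^t* *m xi i.+1 + C ^t* *m H i.
Proof.
apply/eqP; rewrite -subr_eq0; apply/eqP.
apply: (@mnorm0_geometric _ _ _ _ (c + mnorm A * c) q q01) => N.
have -> : xi i - (A ^t* *m xi i.+1 + C ^t* *m H i) =
  (xi i - \sum_(l < N.+1) (A ^t*) ^+ l *m (C ^t* *m H (i + l)%N)) +
  (-1) *: (A ^t* *m (xi i.+1 - \sum_(l < N) (A ^t*) ^+ l *m (C ^t* *m H (i.+1 + l)%N))).
  rewrite big_ord_recl expr0 mul1mx addn0 mulmxBr mulmx_sumr scaleN1r opprB.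
  have -> : \sum_(l < N) A ^t* *m ((A ^t*) ^+ l *m (C ^t* *m H (i.+1 + l)%N)) =
            \sum_(l < N) (A ^t*) ^+ (lift ord0 l) *m (C ^t* *m H (i + lift ord0 l)%N).
    by apply: eq_bigr => l _; rewrite lift0 mulmx_expS addnS addSn.
  move: (\sum_(l < N) _) (A ^t* *m _) (C ^t* *m H i) => X Y Z.
  by rewrite !opprD [RHS](AC ((1*2)*2) (1*5*2*(3*4))) /= addNr addr0 -addrA.
apply: le_trans (mnormD _ _) _; rewrite mnormZ cabsN cabs1 mul1r mulrDl.
apply: lerD.
  case/andP: q01 => q0 q1; apply: le_trans (xiP i N.+1) _.
  rewrite exprS mulrCA ler_piMl ?(ltW q1) //.
  exact: le_trans (mnorm_ge0 _) (xiP i N).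
apply: le_trans (mnormM _ _) _; rewrite mnorm_adj -mulrA ler_wpM2l ?mnorm_ge0 //.
Qed.

(** The state of the system of [V] fed by [intermediate], the output of the adjoint system of [W].
    The sum is the effect of the inputs before time [i], and [Omega *m xi i] that of the inputs from
    time [i] on. *)
Definition forward_state i : 'cV[Cx K]_nv :=
  \sum_(j < i) Av ^+ (i.-1 - j) *m (sB *m H j) + Omega *m xi i.

Definition intermediate i : 'cV[Cx K]_m := D ^t* *m H i + B ^t* *m xi i.+1.

(** The initial state need not vanish: at negative times the adjoint system already emits, and by
    the Stein equation this drives the system of [V] to [Omega *m xi 0]. *)
Lemma forward_state0 : forward_state 0 = Omega *m xi 0%N.
Proof. by rewrite /forward_state big_ord0 add0r. Qed.

Lemma forward_step i : forward_state i.+1 = Av *m forward_state i + Bv *m intermediate i.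
Proof using Omega_eq q01 xiP.
rewrite /forward_state big_ord_recr /= subnn expr0 mul1mx.
have -> : \sum_(j < i) Av ^+ (i - j) *m (sB *m H j) =
          Av *m \sum_(j < i) Av ^+ (i.-1 - j) *m (sB *m H j).
  rewrite mulmx_sumr; apply: eq_bigr => j _; rewrite -mulmx_expS; congr (_ ^+ _ *m _).
  exact: subn_pred_succ.
have OE : Omega *m xi i.+1 = Av *m Omega *m A ^t* *m xi i.+1 + Bv *m B ^t* *m xi i.+1.
  by rewrite {1}Omega_eq mulmxDl.
have sBH : sB *m H i = Bv *m D ^t* *m H i + Av *m Omega *m C ^t* *m H i by rewrite mulmxDl.
rewrite sBH OE /intermediate (backward_step i) !mulmxDr !mulmxA.
by rewrite [LHS](AC ((1*2)*2) ((1*(4*3))*(2*5))).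
Qed.

Lemma output_split i : Cv *m forward_state i + Dv *m intermediate i =
  \sum_(j < i) scoef (i%:Z - j%:Z) *m H j + scoef 0 *m H i + C0 *m xi i.+1.
Proof using C0_def q01 xiP.
have -> : \sum_(j < i) scoef (i%:Z - j%:Z) *m H j =
          Cv *m \sum_(j < i) Av ^+ (i.-1 - j) *m (sB *m H j).
  rewrite mulmx_sumr; apply: eq_bigr => j _.
  have -> : i%:Z - j%:Z = (i.-1 - j).+1%:Z by exact: subz_pred_succ.
  by rewrite /= !mulmxA.
rewrite /forward_state /intermediate (backward_step i) C0_def /= /symbolD.
rewrite !(mulmxDl, mulmxDr) !mulmxA.
by rewrite [LHS](AC ((1*2)*2) ((1*(4*3))*(5*2))).
Qed.

(** Beyond the index [i] the coefficients are anticausal, and their partial sums are [C0] applied to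
    those of [xi i.+1]; this gives both the limit and the rate. *)
Lemma toeplitz_cvg i l :
  series (fun j : nat => (scoef (i%:Z - j%:Z) *m H j) l 0) @ \oo -->
  (Cv *m forward_state i + Dv *m intermediate i) l 0.
Proof using C0_def q01 xiP.
apply: (@cvg_geometric_shift _ _ _ (mnorm C0 * c) q i.+1 q01) => N.
rewrite /series /= big_mkord -summxE.
rewrite (_ : _ l 0 - _ = (Cv *m forward_state i + Dv *m intermediate i -
  \sum_(j < i.+1 + N) scoef (i%:Z - j%:Z) *m H j) l 0); last by rewrite !mxE.
apply: le_trans (cabs_le_mnorm _ _ _) _.
rewrite big_split_ord big_ord_recr /= output_split subrr.
have -> : \sum_(j < N) scoef (i%:Z - (i.+1 + j)%N%:Z) *m H (i.+1 + j)%N =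
          C0 *m \sum_(j < N) (A ^t*) ^+ j *m (C ^t* *m H (i.+1 + j)%N).
  rewrite mulmx_sumr; apply: eq_bigr => j _.
  have -> : i%:Z - (i.+1 + j)%N%:Z = Negz j by exact: subz_succ_add.
  by rewrite /= !mulmxA.
rewrite opprD addrACA subrr add0r -mulmxBr.
by apply: le_trans (mnormM _ _) _; rewrite -mulrA ler_wpM2l ?mnorm_ge0.
Qed.

Lemma state_bounded : exists M, forall i, mnorm (forward_state i) <= M.
Proof.
have [c' [r [c'0 /andP[r0 r1] hA]]] := stable_geometric Av_stable.
have b0 : 0 <= b := le_trans (mnorm_ge0 _) (H_bounded 0%N).
pose g := c' * (mnorm sB * b).
have g0 : 0 <= g by rewrite !mulr_ge0 ?mnorm_ge0.
have c0 : 0 <= c by have := xiP 0 0; rewrite expr0 mulr1; apply: le_trans (mnorm_ge0 _).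
exists (g / (1 - r) + mnorm Omega * c) => i.
apply: le_trans (mnormD _ _) _; apply: lerD; last first.
  apply: le_trans (mnormM _ _) _; rewrite ler_wpM2l ?mnorm_ge0 //.
  by have := xiP i 0; rewrite big_ord0 subr0 expr0 mulr1.
apply: (@le_trans _ _ (\sum_(j < i) g * r ^+ (i.-1 - j))).
  elim/big_rec2: _ => [|j x y _ xy]; first by rewrite mnorm0.
  apply: le_trans (mnormD _ _) _; apply: lerD => //.
  apply: le_trans (mnormM _ _) _; rewrite mulrAC ler_pM ?mnorm_ge0 //.
  by apply: le_trans (mnormM _ _) _; rewrite ler_wpM2l ?mnorm_ge0.
rewrite (reindex_inj rev_ord_inj) /=.
rewrite (eq_bigr (fun j : 'I_i => g * r ^+ j)) => [|j _]; last first.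
  by rewrite subn_pred_rev.
have r01 : 0 <= r < 1 by rewrite ltW.
by have := geometric_partial_le 0 i r01 g0; rewrite big_mkord expr0 mulr1.
Qed.

(* With zero output the unitary system of [V] can be run backwards in time, where it is
   stable; a bounded state must then vanish. *)
Lemma zero_output : (forall i, Cv *m forward_state i + Dv *m intermediate i = 0) ->
  Omega *m xi 0%N = 0 /\ forall i, H i = C *m (A ^+ i *m xi 0%N).
Proof.
move=> h0; have [M hM] := state_bounded.
have [_ [v1 v2 v3 v4]] := unitary_block Uv.
have [[u1 u2 u3 u4] _] := unitary_block U.
have back i : forward_state i = Av ^t* *m forward_state i.+1.
  rewrite forward_step -[LHS]mul1mx -v1 mulmxDl -!mulmxA.
  have -> : Cv *m forward_state i = - (Dv *m intermediate i).
    by apply/eqP; rewrite -addr_eq0 h0.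
  rewrite mulmxDr mulmxN; congr (_ + _); rewrite !mulmxA -mulNmx; congr (_ *m _).
  by apply/eqP; rewrite eq_sym -addr_eq0 v2.
have iter i N : forward_state i = (Av ^t*) ^+ N *m forward_state (i + N)%N.
  elim: N => [|N IH]; first by rewrite addn0 expr0 mul1mx.
  rewrite IH (back (i + N)%N) -addnS mulmxA; congr (_ *m _).
  by rewrite [RHS]exprSr.
have x0 i : forward_state i = 0.
  have [c' [r [c'0 /andP[r0 r1] hA]]] := stable_geometric Av_stable.
  apply: (@mnorm0_geometric _ _ _ _ (c' * M) r) => [|N]; first by rewrite ltW.
  rewrite (iter i N) -hadjX; apply: le_trans (mnormM _ _) _.
  by rewrite mnorm_adj mulrAC ler_pM ?mnorm_ge0.
have y0 i : intermediate i = 0.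
  rewrite -[LHS]mul1mx -v4 mulmxDl -!mulmxA.
  have := forward_step i; rewrite !x0 mulmx0 add0r => <-.
  have := h0 i; rewrite x0 mulmx0 add0r => ->.
  by rewrite !mulmx0 addr0.
split; first by rewrite -forward_state0 x0.
(* With zero intermediate signal the unitary relations invert the backward recursion: the state
   moves forward by [A] and the input is read off by [C]. *)
have xiE i : xi i = A ^+ i *m xi 0%N.
  elim: i => [|i IH]; first by rewrite expr0 mul1mx.
  rewrite mulmx_expS -IH (backward_step i) mulmxDr !mulmxA.
  have -> : A *m A ^t* = 1%:M - B *m B ^t* by rewrite -u1 addrK.
  have -> : A *m C ^t* = - (B *m D ^t*) by apply/eqP; rewrite -addr_eq0 u2.
  rewrite mulmxBl mul1mx mulNmx -addrA -opprD.
  have -> : B *m B ^t* *m xi i.+1 + B *m D ^t* *m H i = B *m intermediate i.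
    by rewrite mulmxDr !mulmxA addrC.
  by rewrite y0 mulmx0 subr0.
move=> i; rewrite -xiE (backward_step i) mulmxDr !mulmxA.
have -> : C *m C ^t* = 1%:M - D *m D ^t* by rewrite -u4 addrK.
have -> : C *m A ^t* = - (D *m B ^t*) by apply/eqP; rewrite -addr_eq0 u3.
rewrite mulmxBl mul1mx mulNmx addrCA -opprD.
have -> : D *m B ^t* *m xi i.+1 + D *m D ^t* *m H i = D *m intermediate i.
  by rewrite mulmxDr !mulmxA addrC.
by rewrite y0 mulmx0 subr0.
Qed.

(** For this input the Gramian identity gives [xi i = A^i x]. Then [B^* A + D^* C = 0] kills the
    intermediate signal, and the state of [V] starts at [Omega x = 0]. *)
Lemma zero_output_converse (x : 'cV[Cx K]_nw) : Omega *m x = 0 ->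
  (forall i, H i = C *m (A ^+ i *m x)) ->
  forall i, Cv *m forward_state i + Dv *m intermediate i = 0.
Proof using A_stable U Omega_eq q01 xiP.
move=> Ox Hx; have [c' [r [r01 hg]]] := gramian_geometric.
have [_ [w1 w2 w3 w4]] := unitary_block U.
have xiE i : xi i = A ^+ i *m x.
  apply/eqP; rewrite -subr_eq0; apply/eqP.
  have [q0 q1] := andP q01; have [r0 r1] := andP r01.
  have c0 : 0 <= c by have := xiP 0 0; rewrite expr0 mulr1; apply: le_trans (mnorm_ge0 _).
  have c'0 : 0 <= c' by have := hg 0%N; rewrite expr0 mulr1; apply: le_trans (mnorm_ge0 _).
  apply: (@mnorm0_geometric _ _ _ _ (c + c' * mnorm (A ^+ i *m x)) (Num.max q r)) => [|N].
    by rewrite le_max q0 gt_max q1.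
  pose S := \sum_(l < N) (A ^t*) ^+ l *m (C ^t* *m H (i + l)%N).
  have SE : S = (\sum_(l < N) (A ^t*) ^+ l *m (C ^t* *m C) *m A ^+ l) *m (A ^+ i *m x).
    rewrite mulmx_suml; apply: eq_bigr => l _; rewrite Hx addnC exprD -mulmxE.
    by rewrite !mulmxA.
  have -> : xi i - A ^+ i *m x = (xi i - S) + (-1) *: (A ^+ i *m x - S).
    by rewrite scaleN1r opprB addrA subrK.
  apply: le_trans (mnormD _ _) _; rewrite mnormZ cabsN cabs1 mul1r mulrDl; apply: lerD.
    apply: le_trans (xiP i N) _; rewrite ler_wpM2l //.
    by rewrite lerXn2r ?nnegrE ?le_max ?q0 ?lexx.
  rewrite SE -{1}[A ^+ i *m x]mul1mx -mulmxBl.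
  apply: le_trans (mnormM _ _) _; rewrite mulrAC ler_wpM2r ?mnorm_ge0 //.
  apply: le_trans (hg N) _; rewrite ler_wpM2l //.
  by rewrite lerXn2r ?nnegrE ?le_max ?r0 ?lexx ?orbT.
have y0 i : intermediate i = 0.
  rewrite /intermediate Hx xiE mulmx_expS !mulmxA -mulmxDl.
  by rewrite addrC -mulmxDl w3 !mul0mx.
have x0 i : forward_state i = 0.
  elim: i => [|i IH]; last by rewrite forward_step IH y0 !mulmx0 addr0.
  by rewrite forward_state0 xiE expr0 mul1mx.
by move=> i; rewrite x0 y0 !mulmx0 addr0.
Qed.

End State.
End ToeplitzKernel.

(** * Kernels of the shifted Toeplitz operators and their dimension *)

Section KernelDimension.
Variable K : realType.

(** Matrix kernels are row spaces, so a basis of the null space of [M] consists of the transposed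
    rows of a base of [kermx M^T]; injectivity of [G] keeps its image independent. *)
Lemma has_dim_image m n (S : set (nat -> 'cV[Cx K]_m)) (M : 'M[Cx K]_n)
    (G : nat -> 'M[Cx K]_(m, n)) :
  (forall x : 'cV[Cx K]_n, (forall k, G k *m x = 0) -> x = 0) ->
  S = [set h | exists x : 'cV[Cx K]_n, M *m x = 0 /\ forall k, h k = G k *m x] ->
  has_dim S (nullity M).
Proof.
move=> Ginj ->; rewrite /nullity mxrank_coker -mxrank_tr -mxrank_ker.
pose b := row_base (kermx M^T).
have freeb : row_free b by exact: row_base_free.
have Mb i : M *m (row i b)^T = 0.
  have : (row i b <= kermx M^T)%MS by rewrite (submx_trans (row_sub _ _)) // eq_row_base.
  by move/sub_kermxP => e; apply: trmx_inj; rewrite trmx_mul trmxK e trmx0.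
have lin (c : 'I_(\rank (kermx M^T)) -> Cx K) :
    \sum_i c i *: (row i b)^T = ((\row_i c i) *m b)^T.
  rewrite mulmx_sum_row linear_sum /=; apply: eq_bigr => i _.
  by rewrite linearZ /= mxE.
exists (fun i k => G k *m (row i b)^T); split.
  move=> c hc i.
  have : \sum_i c i *: (row i b)^T = 0.
    apply: Ginj => k; rewrite mulmx_sumr -[RHS](hc k).
    by apply: eq_bigr => j _; rewrite -scalemxAr.
  rewrite lin => /(congr1 trmx); rewrite trmxK trmx0 => e.
  have /matrixP/(_ 0 i) : \row_i c i = 0 by apply: (row_free_inj freeb); rewrite e mul0mx.
  by rewrite !mxE.
apply/seteqP; split=> h /=.
  move=> [x [Mx hx]].
  have : (x^T <= b)%MS.
    by rewrite eq_row_base; apply/sub_kermxP; rewrite -trmx_mul Mx trmx0.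
  case/submxP => c cE; exists (fun i => c 0 i) => k; rewrite hx.
  have -> : x = \sum_i c 0 i *: (row i b)^T.
    rewrite lin -[x]trmxK cE; congr (_ *m _)^T.
    by apply/rowP => i; rewrite mxE.
  by rewrite mulmx_sumr; apply: eq_bigr => i _; rewrite -scalemxAr.
move=> [c hc]; exists (\sum_i c i *: (row i b)^T); split.
  by rewrite mulmx_sumr big1 // => i _; rewrite -scalemxAr Mb scaler0.
by move=> k; rewrite hc mulmx_sumr; apply: eq_bigr => i _; rewrite -scalemxAr.
Qed.

Variables (m nv nw : nat) (V W : Cx K -> 'M[Cx K]_m).
Variables (Av : 'M[Cx K]_nv) (Bv : 'M[Cx K]_(nv, m)) (Cv : 'M[Cx K]_(m, nv)) (Dv : 'M[Cx K]_m).
Variables (A : 'M[Cx K]_nw) (B : 'M[Cx K]_(nw, m)) (C : 'M[Cx K]_(m, nw)) (D : 'M[Cx K]_m).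
Hypothesis Av_stable : stable Av.
Hypothesis A_stable : stable A.
Hypothesis Uv : block_mx Av Bv Cv Dv \is unitarymx.
Hypothesis U : block_mx A B C D \is unitarymx.
Hypothesis V_disc : forall z, cabs z <= 1 -> V z = Dv + z *: (Cv *m invmx (1%:M - z *: Av) *m Bv).
Hypothesis W_disc : forall z, cabs z <= 1 -> W z = D + z *: (C *m invmx (1%:M - z *: A) *m B).
Variables (Omega : 'M[Cx K]_(nv, nw)) (C0 : 'M[Cx K]_(m, nw)) (Q : 'M[Cx K]_nw).
Hypothesis Omega_eq : Omega = Av *m Omega *m A ^t* + Bv *m B ^t*.
Hypothesis C0_def : C0 = Dv *m B ^t* + Cv *m Omega *m A ^t*.
Hypothesis Q_eq : Q = A *m Q *m A ^t* + C0 ^t* *m C0.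

Notation scoef := (symbol_coef Av Bv Cv Dv A C D Omega C0).

(** The Toeplitz operator of [z^k R] is that of [R] applied to the input delayed by [k] steps, which
    reduces every [k] to [k = 0]. *)
Definition shift_seq (k : nat) (h : nat -> 'cV[Cx K]_m) (j : nat) : 'cV[Cx K]_m :=
  if (j < k)%N then 0 else h (j - k)%N.

Lemma fourier_shift (F : Cx K -> 'M[Cx K]_m) (k : nat) (n : int) :
  fourier (fun z => z ^+ k *: F z) n = fourier F (n - k%:Z).
Proof.
apply/matrixP => i j; rewrite [LHS]mxE [RHS]mxE.
rewrite -[LHS]/(fc (fun z => (z ^+ k *: F z) i j) n) -[RHS]/(fc (fun z => F z i j) _) -fc_shift.
by apply: fc_ext => z _; rewrite mxE.
Qed.

Lemma toeplitz_symbol k h b (xi : nat -> 'cV[Cx K]_nw) c q i :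
  (forall n, mnorm (h n) <= b) -> 0 <= q < 1 ->
  (forall i N, mnorm (xi i - \sum_(l < N) (A ^t*) ^+ l *m (C ^t* *m shift_seq k h (i + l)%N)) <= c * q ^+ N) ->
  toeplitz (fun z => z ^+ k *: symbol V W z) h i =
  Cv *m forward_state Av Bv C D Omega (shift_seq k h) xi i +
  Dv *m intermediate B D (shift_seq k h) xi i.
Proof.
move=> hb q01 xiP; apply/colP => l; rewrite mxE.
have hL := @toeplitz_cvg _ _ _ _ Av Bv Cv Dv A B C D Omega C0 C0_def (shift_seq k h) xi c q q01 xiP i l.
apply: cvg_lim; first exact: norm_hausdorff.
apply/cvg_CxP => e e0; have [N hN] := (iffLR (cvg_CxP _ _)) hL e e0.
exists N => n Nn; have := hN (k + n)%N (leq_trans Nn (leq_addl _ _)).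
rewrite /series /= !big_mkord big_split_ord /= big1 ?add0r => [|j _]; last first.
  by rewrite /shift_seq ltn_ord mulmx0 mxE.
suff -> : \sum_(j < n) (scoef (i%:Z - (k + j)%N%:Z) *m shift_seq k h (k + j)%N) l 0 =
  \sum_(j < n) (fourier (fun z => z ^+ k *: symbol V W z) (i%:Z - j%:Z) *m h j) l 0 by [].
apply: eq_bigr => j _; rewrite fourier_shift (fourier_symbol Av_stable A_stable V_disc W_disc Omega_eq C0_def).
rewrite /shift_seq ltnNge leq_addr /= addKn; congr ((scoef _ *m _) _ _).
by rewrite PoszD opprD addrA addrAC.
Qed.

(** Zero output forces the delayed input to be [C A^n xi] with [Omega xi = 0]. Its [k] leading zeros
    say that [xi] is unobservable for [k] steps, and what follows them is [C A^n x] with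
    [x = A^k xi], as in [defect_kernel_image]. *)
Lemma toeplitz_ker_symbol k :
  toeplitz_ker (fun z => z ^+ k *: symbol V W z) =
  [set h | exists x : 'cV[Cx K]_nw,
     (1%:M - A ^+ k *m Q *m (A ^t*) ^+ k) *m x = 0 /\ forall n, h n = (C *m A ^+ n) *m x].
Proof.
have kerP := defect_kernel_image A_stable Uv U Omega_eq C0_def Q_eq.
apply/seteqP; split=> h /=.
  move=> [/ell2_bounded[b hb] hT].
  have b0 : 0 <= b := le_trans (mnorm_ge0 _) (hb 0%N).
  have Hb n : mnorm (shift_seq k h n) <= b.
    by rewrite /shift_seq; case: ifP => _ //; rewrite mnorm0.
  have [xi [c [q [q01 xiP]]]] := backward_state C A_stable Hb.
  have [i|Ox Hx] := zero_output Av_stable Uv U Omega_eq Hb q01 xiP.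
    by rewrite -(toeplitz_symbol i hb q01 xiP) hT.
  exists (A ^+ k *m xi 0%N); split.
    apply/kerP; exists (xi 0%N); split=> // j jk.
    by rewrite -Hx /shift_seq jk.
  move=> n; have := Hx (k + n)%N; rewrite /shift_seq ltnNge leq_addr /= addKn => ->.
  by rewrite addnC exprD -mulmxE !mulmxA.
move=> [x [/kerP[y [xE Oy Cy]] hx]].
have [c [q [c0 /andP[q0 q1] hA]]] := stable_geometric A_stable.
have q01 : 0 <= q < 1 by rewrite ltW.
have hdecay n : mnorm (h n) <= (mnorm C * c * mnorm x) * q ^+ n.
  rewrite hx; apply: le_trans (mnormM _ _) _; rewrite mulrAC ler_wpM2r ?mnorm_ge0 //.
  by apply: le_trans (mnormM _ _) _; rewrite -mulrA ler_wpM2l ?mnorm_ge0.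
split; first exact: geometric_ell2 q01 hdecay.
have hb n : mnorm (h n) <= mnorm C * c * mnorm x.
  apply: le_trans (hdecay n) _; rewrite ler_piMr ?exprn_ile1 ?(ltW q0) ?(ltW q1) //.
  by rewrite !mulr_ge0 ?mnorm_ge0.
have Hb n : mnorm (shift_seq k h n) <= mnorm C * c * mnorm x.
  rewrite /shift_seq; case: ifP => _ //; rewrite mnorm0.
  exact: le_trans (mnorm_ge0 _) (hb 0%N).
have [xi [c' [r [r01 xiP]]]] := backward_state C A_stable Hb.
move=> i; rewrite (toeplitz_symbol i hb r01 xiP).
apply: (zero_output_converse Cv Dv A_stable U Omega_eq r01 xiP Oy).
move=> n; rewrite /shift_seq; case: ltnP => nk; first by rewrite Cy.
by rewrite hx xE -mulmxA; congr (_ *m _); rewrite mulmxA mulmxE -exprD subnK.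
Qed.

Lemma nullity_toeplitz_symbol k :
  nullity_toeplitz (fun z => z ^+ k *: symbol V W z)
    (nullity (1%:M - A ^+ k *m Q *m (A ^t*) ^+ k)).
Proof.
apply: (@has_dim_image _ _ _ _ (fun n => C *m A ^+ n)); last exact: toeplitz_ker_symbol.
move=> x hx; apply: (observability_injective A_stable U) => n.
by rewrite mulmxA hx.
Qed.

End KernelDimension.

(** * Factors of a Wiener-Hopf factorization *)

Section InversePolynomial.
Variable K : realType.

Definition nonvanishing_disc (d : {poly Cx K}) := forall z, cabs z <= 1 -> d.[z] != 0.

Lemma nonvanishing_factor (d : {poly Cx K}) : nonvanishing_disc d ->
  exists c (r : seq (Cx K)), [/\ c != 0, {in r, forall b, 1 < cabs b} &
    d = c *: \prod_(b <- r) ('X - b%:P)].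
Proof.
move=> hd; have [r hr] := closed_field_poly_normal d.
have d0 : d != 0.
  by apply/eqP => e; have := hd 0; rewrite cabs0 ler01 e horner0 eqxx => /(_ isT).
exists (lead_coef d), r; split => //; first by rewrite lead_coef_eq0.
move=> b br; rewrite ltNge; apply/negP => /hd.
by rewrite hr hornerZ mulf_eq0 lead_coef_eq0 (negPf d0) -[_ == 0]/(root _ _) root_prod_XsubC br.
Qed.

Lemma horner_prod_XsubC (r : seq (Cx K)) c z :
  (c *: \prod_(b <- r) ('X - b%:P)).[z] = c * \prod_(b <- r) (z - b).
Proof.
rewrite hornerZ horner_prod; congr (_ * _).
by apply: eq_bigr => b _; rewrite hornerXsubC.
Qed.

(** Each linear factor has its root [b] outside the closed disc and is inverted by a geometric
    series of ratio [1 / |b|]. *)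
Lemma wiener_inv_poly s (d : {poly Cx K}) : nonvanishing_disc d ->
  wiener s (fun z => (d.[(z ^ s)%R])^-1).
Proof.
case/nonvanishing_factor => c [r [c0 hr ->]].
apply: (@wiener_ext _ s (fun z => c^-1 * \prod_(b <- r) ((z ^ s)%R - b)^-1)).
  by move=> z z1; rewrite horner_prod_XsubC invfM prodfV.
apply: wienerM; first exact: wiener_cst.
apply: wiener_prod => b /hr b1.
have b0 : b != 0 by rewrite -cabs_gt0; lra.
apply: (@wiener_ext _ s (fun z => - b^-1 * (1 - b^-1 * (z ^ s)%R)^-1)).
  move=> z z1; have -> : (z ^ s)%R - b = - b * (1 - b^-1 * (z ^ s)%R) by field.
  by rewrite invfM invrN.
apply: wienerM; first exact: wiener_cst.
by apply: wiener_geometric; rewrite cabsV invf_lt1 //; lra.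
Qed.

End InversePolynomial.

(** * Rational multiples of functions analytic on one side, for both sides at once *)

Section RationalTimes.
Variable K : realType.
Implicit Types (f g : Cx K -> Cx K).
Variables (P : (Cx K -> Cx K) -> Prop) (s : int).
Hypothesis P_ext : forall f g, f =1 g -> P f -> P g.
Hypothesis P_cst : forall c : Cx K, P (fun=> c).
Hypothesis PD : forall f g, P f -> P g -> P (fun z => f z + g z).
Hypothesis PM : forall f g, P f -> P g -> P (fun z => f z * g z).
Hypothesis P_var : P (fun z => (z ^ (- s))%R).
Hypothesis P_inv : forall b : Cx K, 1 < cabs b -> P (fun z => ((z ^ (- s))%R - b)^-1).

(** [P] stands for analyticity on the side where [z^(-s)] is analytic: the exterior for [s = 1], the
    disc for [s = -1]. The denominator and the power of [z^s] carry the poles that lie on that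
    side. *)
Definition rational_times f : Prop := exists d N v, [/\ nonvanishing_disc d, P v &
  forall z, cabs z = 1 -> f z = (z ^ s)%R ^+ N * v z / d.[(z ^ s)%R]].

Lemma P_sum (I : Type) (r : seq I) (F : I -> Cx K -> Cx K) :
  (forall i, P (F i)) -> P (fun z => \sum_(i <- r) F i z).
Proof.
move=> hF; elim: r => [|i r IH].
  by apply: P_ext (P_cst 0) => z; rewrite big_nil.
by apply: P_ext (PD (hF i) IH) => z; rewrite big_cons.
Qed.

Lemma P_exp n : P (fun z => (z ^ (- s))%R ^+ n).
Proof.
elim: n => [|n IH]; first by apply: P_ext (P_cst 1) => z; rewrite expr0.
by apply: P_ext (PM P_var IH) => z; rewrite exprS.
Qed.

Lemma P_poly (p : {poly Cx K}) : P (fun z => p.[(z ^ (- s))%R]).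
Proof.
apply: (@P_ext (fun z => \sum_(i < size p) p`_i * (z ^ (- s))%R ^+ i)) => [z|].
  by rewrite horner_coef.
by apply: P_sum => i; apply: PM; [exact: P_cst|exact: P_exp].
Qed.

Lemma P_inv_poly (d : {poly Cx K}) : nonvanishing_disc d -> P (fun z => (d.[(z ^ (- s))%R])^-1).
Proof.
case/nonvanishing_factor => c [r [c0 hr ->]].
apply: (@P_ext (fun z => c^-1 * \prod_(b <- r) ((z ^ (- s))%R - b)^-1)).
  by move=> z; rewrite horner_prod_XsubC invfM prodfV.
apply: PM; first exact: P_cst.
elim: r hr => [|b r IH] hr.
  by apply: P_ext (P_cst 1) => z; rewrite big_nil.
have hr' : {in r, forall b, 1 < cabs b} by move=> x xr; apply: hr; rewrite inE xr orbT.
by apply: P_ext (PM (P_inv (hr b (mem_head _ _))) (IH hr')) => z; rewrite big_cons.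
Qed.

Lemma circle_exprzNV z n : cabs z = 1 -> (z ^ s)%R ^+ n * (z ^ (- s))%R ^+ n = 1 :> Cx K.
Proof.
move=> z1; have z0 : z != 0 by rewrite -cabs_gt0 z1.
by rewrite -exprMn -expfzDr // addrN expr0z expr1n.
Qed.

(** Up to a power of [z^s], a polynomial in [z^s] is one in [z^(-s)], and the latter lies in [P]. *)
Lemma poly_reversal (p : {poly Cx K}) : exists N v, P v /\
  forall z, cabs z = 1 -> p.[(z ^ s)%R] = (z ^ s)%R ^+ N * v z.
Proof.
exists (size p), (fun z => \sum_(i < size p) p`_i * (z ^ (- s))%R ^+ (size p - i)); split.
  by apply: P_sum => i; apply: PM; [exact: P_cst|exact: P_exp].
move=> z z1; rewrite horner_coef mulr_sumr; apply: eq_bigr => i _.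
rewrite mulrCA; congr (_ * _).
have -> : (z ^ s)%R ^+ size p = (z ^ s)%R ^+ i * (z ^ s)%R ^+ (size p - i).
  by rewrite -exprD subnKC // ltnW.
by rewrite -mulrA circle_exprzNV // mulr1.
Qed.

Lemma rational_times_ext f g : (forall z, cabs z = 1 -> f z = g z) ->
  rational_times f -> rational_times g.
Proof.
move=> fg [d [N [v [hd Pv h]]]]; exists d, N, v; split=> // z z1.
by rewrite -fg // h.
Qed.

Lemma nonvanishingM (d e : {poly Cx K}) : nonvanishing_disc d -> nonvanishing_disc e ->
  nonvanishing_disc (d * e).
Proof. by move=> hd he z z1; rewrite hornerM mulf_neq0 ?hd ?he. Qed.

Lemma nonvanishing1 : nonvanishing_disc (1 : {poly Cx K}).
Proof. by move=> z _; rewrite hornerC oner_neq0. Qed.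

Lemma rational_timesM f g : rational_times f -> rational_times g ->
  rational_times (fun z => f z * g z).
Proof.
move=> [d [N [v [hd Pv hf]]]] [e [M [w [he Pw hg]]]].
exists (d * e), (N + M)%N, (fun z => v z * w z); split.
- exact: nonvanishingM.
- exact: PM.
- by move=> z z1; rewrite hf // hg // hornerM invfM exprD; ring.
Qed.

Lemma rational_timesP f : P f -> rational_times f.
Proof.
move=> Pf; exists 1, 0%N, f; split=> // [|z _]; first exact: nonvanishing1.
by rewrite expr0 mul1r hornerC divr1.
Qed.

Lemma rational_times_poly (p : {poly Cx K}) : rational_times (fun z => p.[(z ^ s)%R]).
Proof.
have [N [v [Pv hp]]] := poly_reversal p; exists 1, N, v; split=> // [|z z1].
  exact: nonvanishing1.
by rewrite hp // hornerC divr1.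
Qed.

Lemma rational_times_inv (d : {poly Cx K}) : nonvanishing_disc d ->
  rational_times (fun z => (d.[(z ^ s)%R])^-1).
Proof.
move=> hd; exists d, 0%N, (fun=> 1); split=> // z _.
by rewrite expr0 !mul1r.
Qed.

Lemma rational_timesD f g : rational_times f -> rational_times g ->
  rational_times (fun z => f z + g z).
Proof.
move=> [d [N [v [hd Pv hf]]]] [e [M [w [he Pw hg]]]].
have [N1 [e' [Pe' he']]] := poly_reversal e.
have [N2 [d' [Pd' hd']]] := poly_reversal d.
(* Over the common denominator the numerators acquire the factors [e] and [d], which enter [P] as
   their reversals [e'] and [d']; the powers of [z^(-s)] bring both terms to the same exponent. *)
exists (d * e), (N + M + N1 + N2)%N, (fun z =>
  (z ^ (- s))%R ^+ (M + N2) * (v z * e' z) + (z ^ (- s))%R ^+ (N + N1) * (w z * d' z)); split.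
- exact: nonvanishingM.
- by apply: PD; apply: PM; try exact: P_exp; apply: PM.
move=> z z1; have zs : cabs (z ^ s)%R <= 1 by rewrite cabs_exprz.
rewrite hf // hg // hornerM.
have dz := hd _ zs; have ez := he _ zs.
set x := (z ^ s)%R in dz ez *; set y := (z ^ (- s))%R.
have e1 : x ^+ (N + M + N1 + N2) * y ^+ (M + N2) = x ^+ N * x ^+ N1.
  have -> : (N + M + N1 + N2 = (N + N1) + (M + N2))%N by lia.
  by rewrite exprD -mulrA circle_exprzNV // mulr1 exprD.
have e2 : x ^+ (N + M + N1 + N2) * y ^+ (N + N1) = x ^+ M * x ^+ N2.
  have -> : (N + M + N1 + N2 = (M + N2) + (N + N1))%N by lia.
  by rewrite exprD -mulrA circle_exprzNV // mulr1 exprD.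
rewrite mulrDr !mulrA e1 e2.
have -> : x ^+ N * x ^+ N1 * v z * e' z = x ^+ N * v z * e.[x] by rewrite he' // -/x; ring.
have -> : x ^+ M * x ^+ N2 * w z * d' z = x ^+ M * w z * d.[x] by rewrite hd' // -/x; ring.
by field; rewrite dz ez.
Qed.

Lemma rational_times_sum (I : Type) (r : seq I) (F : I -> Cx K -> Cx K) :
  (forall i, rational_times (F i)) -> rational_times (fun z => \sum_(i <- r) F i z).
Proof.
move=> hF; elim: r => [|i r IH].
  by apply: rational_times_ext (rational_timesP (P_cst 0)) => z _; rewrite big_nil.
by apply: rational_times_ext (rational_timesD (hF i) IH) => z _; rewrite big_cons.
Qed.

Lemma rational_times_exprz (k : int) : rational_times (fun z => (z ^ (s * k))%R).
Proof.
case: k => k.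
  apply: (@rational_times_ext (fun z => ('X^k).[(z ^ s)%R])); last exact: rational_times_poly.
  by move=> z _; rewrite hornerXn exprnP exprz_exp.
apply: rational_times_ext (rational_timesP (P_exp k.+1)) => z _.
by rewrite exprnP exprz_exp NegzE mulrN mulNr.
Qed.

(** Written in [z^s], the quotient contributes its denominator; written in [z^(-s)], it lies in [P]
    already. One case serves transfer functions and the other their stars. *)
Lemma rational_times_quot (k : int) f (p d : {poly Cx K}) : k = s \/ k = - s ->
  nonvanishing_disc d -> (forall z, cabs z = 1 -> f z = p.[(z ^ k)%R] / d.[(z ^ k)%R]) ->
  rational_times f.
Proof.
move=> ks hd hf.
case: ks hf => -> hf.
  apply: (@rational_times_ext (fun z => p.[(z ^ s)%R] * (d.[(z ^ s)%R])^-1)).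
    by move=> z z1; rewrite hf.
  by apply: rational_timesM; [exact: rational_times_poly|exact: rational_times_inv].
apply: (@rational_times_ext (fun z => p.[(z ^ (- s))%R] * (d.[(z ^ (- s))%R])^-1)).
  by move=> z z1; rewrite hf.
by apply: rational_timesP; apply: PM; [exact: P_poly|exact: P_inv_poly].
Qed.

Lemma rational_times_diag m (lambda : 'I_m -> int) i j : s * s = 1 ->
  rational_times (fun z => diag_mx (\row_j (z ^ lambda j)%R : 'rV[Cx K]_m) i j).
Proof.
move=> ss; have [->|ij] := eqVneq i j.
  apply: rational_times_ext (rational_times_exprz (s * lambda j)) => z _.
  by rewrite !mxE eqxx mulr1n mulrA ss mul1r.
apply: rational_times_ext (rational_timesP (P_cst 0)) => z _.
by rewrite !mxE (negPf ij) mulr0n.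
Qed.

Lemma rational_times_mx m n p (F : Cx K -> 'M[Cx K]_(m, n)) (G : Cx K -> 'M[Cx K]_(n, p)) :
  (forall i j, rational_times (fun z => F z i j)) -> (forall i j, rational_times (fun z => G z i j)) ->
  forall i j, rational_times (fun z => (F z *m G z) i j).
Proof.
move=> hF hG i j; apply: (@rational_times_ext (fun z => \sum_k F z i k * G z k j)).
  by move=> z _; rewrite mxE.
by apply: rational_times_sum => k; apply: rational_timesM.
Qed.

End RationalTimes.

(** * From rational multiples to geometric decay *)

Section OneSided.
Variable K : realType.
Implicit Types (f g u v : Cx K -> Cx K).

Definition ana_exterior v := exists l, ana_ext_disc v l.

Lemma exprz1 (z : Cx K) : (z ^ (1 : int))%R = z. Proof. by rewrite expr1z. Qed.

(** On the circle [d u] is [z^N v] with [v] analytic outside, hence a polynomial. So [u] is a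
    quotient whose poles lie off the closed disc. *)
Lemma wiener1_of_rational_times u : ana_disc u -> rational_times ana_exterior 1 u -> wiener 1 u.
Proof.
move=> au [d [N [v [hd [l av] h]]]].
have [|z z1|p sp hp] := @ana_disc_polynomial _ (fun z => d.[z] * u z) v l N _ av.
- by move=> z z1; apply: anaM; [exact: ana_poly|exact: au].
- by rewrite h // exprz1 mulrC divfK // hd // z1.
apply: (@wiener_ext _ 1 (fun z => p.[(z ^ (1 : int))%R] * (d.[(z ^ (1 : int))%R])^-1)).
  by move=> z z1; rewrite exprz1 -hp ?z1 // mulrC mulKf // hd // z1.
by apply: wienerM; [exact: wiener_poly|exact: wiener_inv_poly].
Qed.

(** The roles are exchanged: the numerator [u] equals [z^N d(1/z) v], hence is a polynomial of
    degree at most [N], and [z^{-N} u] is a polynomial in [1/z]. *)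
Lemma wienerN1_of_rational_times v : ana_exterior v -> rational_times (@ana_disc K) (-1) v ->
  wiener (-1) v.
Proof.
move=> [l av] [d [N [u [hd au h]]]].
have [l' av'] : ana_exterior (fun z => d.[z^-1]).
  have hs n : ana_exterior (fun z : Cx K => z^-1 ^+ n).
    elim: n => [|n [l' IH]].
      by exists 1; have := ana_ext_disc_cst (1 : Cx K).
    exists (0 * l'); have := ana_ext_discM (@ana_ext_disc_inv K) IH.
    by congr ana_ext_disc; apply: funext => z; rewrite exprS.
  have hS n : ana_exterior (fun z => \sum_(i < n) d`_i * z^-1 ^+ i).
    elim: n => [|n [l' IH]].
      exists 0; have := ana_ext_disc_cst (0 : Cx K).
      by congr ana_ext_disc; apply: funext => z; rewrite big_ord0.
    have [l'' h'] := hs n.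
    exists (l' + d`_n * l''); have := ana_ext_discD IH (ana_ext_discM (ana_ext_disc_cst d`_n) h').
    by congr ana_ext_disc; apply: funext => z; rewrite big_ord_recr.
  have [l' h'] := hS (size d); exists l'; move: h'.
  by congr ana_ext_disc; apply: funext => z; rewrite horner_coef.
have eN (z : Cx K) : (z ^ (-1 : int))%R = z^-1 by rewrite exprN1.
have nz (z : Cx K) : cabs z = 1 -> z != 0 by move=> z1; rewrite -cabs_gt0 z1.
have cV (z : Cx K) : cabs z = 1 -> cabs z^-1 <= 1 by move=> z1; rewrite cabsV z1 invr1.
have [z z1|p sp hp] := @ana_disc_polynomial _ u (fun z => d.[z^-1] * v z) _ N au (ana_ext_discM av' av).
  rewrite h // eN [d.[_] * _]mulrC divfK ?hd ?cV // mulrA -exprMn mulfV ?nz // expr1n mul1r.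
  by [].
apply: (@wiener_ext _ (-1) (fun z => (\sum_(i < N.+1) p`_i * (z ^ (-1 : int))%R ^+ (N - i)) *
   (d.[(z ^ (-1 : int))%R])^-1)).
  move=> z z1; rewrite h // hp ?z1 //; congr (_ * _).
  rewrite (horner_coef_wide _ sp) mulr_sumr; apply: eq_bigr => i _.
  rewrite mulrCA; congr (_ * _); rewrite eN.
  have -> : z^-1 ^+ N = z^-1 ^+ (N - i) * z^-1 ^+ i by rewrite -exprD subnK // -ltnS.
  by rewrite -mulrA -exprMn mulVf ?nz // expr1n mulr1.
apply: wienerM; last exact: wiener_inv_poly.
by apply: wiener_sum => i; apply: wienerM; [exact: wiener_cst|exact: wiener_exp].
Qed.

End OneSided.

Section Sides.
Variable K : realType.
Implicit Types (f g : Cx K -> Cx K).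

Lemma ana_ext_disc_ext f g l : (forall z, z != 0 -> f z = g z) ->
  ana_ext_disc f l -> ana_ext_disc g l.
Proof.
move=> fg [hf fi]; split=> [z z1|].
  apply: (@ana_near _ f _ _ (1 / 2)) (hf z z1) => [|h hh]; first lra.
  apply: fg; rewrite -cabs_gt0; have := cabsB (z + h) h; rewrite addrK; lra.
apply: ana_ext fi => h; rewrite /at_infty; case: eqP => // /eqP h0.
by rewrite fg // invr_eq0.
Qed.

(** For nonzero [z] the function is [- b^{-1} z / (z - b^{-1})], with its pole inside the disc. *)
Lemma ana_ext_inv (b : Cx K) : 1 < cabs b -> ana_exterior (fun z => ((z ^ (- 1))%R - b)^-1).
Proof.
move=> b1; have b0 : b != 0 by rewrite -cabs_gt0; lra.
have bV : cabs b^-1 < 1 by rewrite cabsV invf_lt1; lra.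
exists (- b^-1 * 1).
apply: ana_ext_disc_ext (ana_ext_discM (ana_ext_disc_cst (- b^-1)) (ana_ext_disc_quot bV)).
move=> z z0; rewrite exprN1.
have -> : z - b^-1 = - (z * b^-1) * (z^-1 - b) by field; rewrite z0 b0.
by rewrite invfM; move: (_ - b)^-1 => Y; field; rewrite z0 b0.
Qed.

Lemma ana_ext_eq f g : f =1 g -> ana_exterior f -> ana_exterior g.
Proof. by move=> /funext ->. Qed.

Lemma ana_ext_cst (c : Cx K) : ana_exterior (fun=> c).
Proof. by exists c; exact: ana_ext_disc_cst. Qed.

Lemma ana_extD f g : ana_exterior f -> ana_exterior g -> ana_exterior (fun z => f z + g z).
Proof. by move=> [l hf] [l' hg]; exists (l + l'); exact: ana_ext_discD. Qed.

Lemma ana_extM f g : ana_exterior f -> ana_exterior g -> ana_exterior (fun z => f z * g z).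
Proof. by move=> [l hf] [l' hg]; exists (l * l'); exact: ana_ext_discM. Qed.

Lemma ana_ext_var : ana_exterior (fun z : Cx K => (z ^ (- 1))%R).
Proof.
by apply: (@ana_ext_eq (fun z => z^-1)) => [z|]; [rewrite exprN1|exists 0; exact: ana_ext_disc_inv].
Qed.

Lemma ana_disc_eq f g : f =1 g -> ana_disc f -> ana_disc g.
Proof. by move=> /funext ->. Qed.

Lemma ana_disc_cst (c : Cx K) : ana_disc (fun=> c).
Proof. by move=> z _; exact: ana_cst. Qed.

Lemma ana_discD f g : ana_disc f -> ana_disc g -> ana_disc (fun z => f z + g z).
Proof. by move=> hf hg z z1; apply: anaD; [exact: hf|exact: hg]. Qed.

Lemma ana_discM f g : ana_disc f -> ana_disc g -> ana_disc (fun z => f z * g z).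
Proof. by move=> hf hg z z1; apply: anaM; [exact: hf|exact: hg]. Qed.

Lemma ana_disc_var : ana_disc (fun z : Cx K => (z ^ (- -1))%R).
Proof. by apply: (@ana_disc_eq id) => [z|z _]; [rewrite opprK expr1z|exact: ana_id]. Qed.

Lemma ana_disc_inv (b : Cx K) : 1 < cabs b -> ana_disc (fun z => ((z ^ (- -1))%R - b)^-1).
Proof.
move=> b1; apply: (@ana_disc_eq (fun z => (z - b)^-1)) => [z|z z1]; first by rewrite opprK expr1z.
by apply: ana_inv; apply/eqP => zb; move: z1; rewrite zb; lra.
Qed.

End Sides.

Lemma invmx_left (F : fieldType) n (X Y : 'M[F]_n) : Y *m X = 1%:M -> invmx X = Y.
Proof.
move=> YX; have [_ Xu] := mulmx1_unit YX.
by rewrite -[RHS]mulmx1 -(mulmxV Xu) mulmxA YX mul1mx.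
Qed.

(** * One-sided expansions of the Wiener-Hopf factors and their inverses *)

Section WienerHopfFactors.
Variable K : realType.
Variables (m nv nw : nat) (V W : Cx K -> 'M[Cx K]_m).
Variables (Av : 'M[Cx K]_nv) (Bv : 'M[Cx K]_(nv, m)) (Cv : 'M[Cx K]_(m, nv)) (Dv : 'M[Cx K]_m).
Variables (A : 'M[Cx K]_nw) (B : 'M[Cx K]_(nw, m)) (C : 'M[Cx K]_(m, nw)) (D : 'M[Cx K]_m).
Hypothesis Av_stable : stable Av.
Hypothesis A_stable : stable A.
Hypothesis Uv : block_mx Av Bv Cv Dv \is unitarymx.
Hypothesis U : block_mx A B C D \is unitarymx.
Hypothesis V_disc : forall z, cabs z <= 1 -> V z = Dv + z *: (Cv *m invmx (1%:M - z *: Av) *m Bv).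
Hypothesis W_disc : forall z, cabs z <= 1 -> W z = D + z *: (C *m invmx (1%:M - z *: A) *m B).

Lemma transfer_quotient p n r (X : Cx K -> 'M[Cx K]_(p, r)) (A0 : 'M[Cx K]_n) B0 C0 D0 i j : stable A0 ->
  (forall z, cabs z <= 1 -> X z = D0 + z *: (C0 *m invmx (1%:M - z *: A0) *m B0)) ->
  exists q d, nonvanishing_disc d /\ forall z, cabs z = 1 ->
    X z i j = q.[(z ^ (1 : int))%R] / d.[(z ^ (1 : int))%R].
Proof.
move=> sA hX; have [q hq] := transfer_rational B0 C0 D0 i j sA.
exists q, (\det (resolvent_mx A0)); split=> [z z1|z z1]; first exact: det_resolvent_neq0.
by rewrite expr1z hX ?z1 // hq // z1.
Qed.

Lemma star_quotient n (X : Cx K -> 'M[Cx K]_m) (A0 : 'M[Cx K]_n) B0 C0 D0 i j : stable A0 ->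
  (forall z, cabs z <= 1 -> X z = D0 + z *: (C0 *m invmx (1%:M - z *: A0) *m B0)) ->
  exists q d, nonvanishing_disc d /\ forall z, cabs z = 1 ->
    star_fun X z i j = q.[(z ^ (-1 : int))%R] / d.[(z ^ (-1 : int))%R].
Proof.
move=> sA hX; have sA' := stable_adj sA.
have [q hq] := transfer_rational (C0 ^t*) (B0 ^t*) (D0 ^t*) i j sA'.
exists q, (\det (resolvent_mx (A0 ^t*))); split=> [z z1|z z1]; first exact: det_resolvent_neq0.
by rewrite exprN1 (star_fun_circle hX z1) hq // cabsV z1 invr1.
Qed.

(** The product is the symbol of the pair [X], [X]. Unitarity of the block makes [Omega = 1] solve
    its Stein equation with [C0 = 0], [symbolB = 0] and [symbolD = 1]. *)
Lemma transfer_circle_unitary n (X : Cx K -> 'M[Cx K]_m) (A0 : 'M[Cx K]_n) B0 C0 D0 z : stable A0 ->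
  block_mx A0 B0 C0 D0 \is unitarymx ->
  (forall z, cabs z <= 1 -> X z = D0 + z *: (C0 *m invmx (1%:M - z *: A0) *m B0)) ->
  cabs z = 1 -> X z *m star_fun X z = 1%:M.
Proof.
move=> sA U0 hX z1; have [[u1 u2 u3 u4] _] := unitary_block U0.
have O1 : 1%:M = A0 *m 1%:M *m A0 ^t* + B0 *m B0 ^t* by rewrite mulmx1 u1.
have C1 : 0 = D0 *m B0 ^t* + C0 *m 1%:M *m A0 ^t* by rewrite mulmx1 addrC u3.
rewrite -[LHS]/(symbol X X z) (symbol_circle sA sA hX hX O1 C1 z1).
rewrite /symbolB /symbolD !mulmx1 [D0 *m _ + _]addrC u4 [B0 *m _ + _]addrC u2.
by rewrite !(mulmx0, mul0mx, scaler0, addr0).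
Qed.

(** The inverse symbol is again a symbol, with [V] and [W] exchanged, so the inverses of the factors
    can be treated like the factors. *)
Lemma symbol_mulV z : cabs z = 1 -> symbol V W z *m symbol W V z = 1%:M.
Proof.
move=> z1; have hV := transfer_circle_unitary Av_stable Uv V_disc z1.
have /mulmx1C hW := transfer_circle_unitary A_stable U W_disc z1.
by rewrite /symbol mulmxA -[V z *m _ *m W z]mulmxA hW mulmx1.
Qed.

Section RationalEntries.
Variables (P : (Cx K -> Cx K) -> Prop) (s : int).
Hypothesis P_ext : forall f g, f =1 g -> P f -> P g.
Hypothesis P_cst : forall c : Cx K, P (fun=> c).
Hypothesis PD : forall f g, P f -> P g -> P (fun z => f z + g z).
Hypothesis PM : forall f g, P f -> P g -> P (fun z => f z * g z).
Hypothesis P_var : P (fun z => (z ^ (- s))%R).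
Hypothesis P_inv : forall b : Cx K, 1 < cabs b -> P (fun z => ((z ^ (- s))%R - b)^-1).
Hypothesis s1 : s = 1 \/ s = -1.

Lemma rational_times_symbol (X Y : Cx K -> 'M[Cx K]_m) n1 n2 (A1 : 'M[Cx K]_n1) (A2 : 'M[Cx K]_n2)
    B1 C1 D1 B2 C2 D2 i j : stable A1 -> stable A2 ->
  (forall z, cabs z <= 1 -> X z = D1 + z *: (C1 *m invmx (1%:M - z *: A1) *m B1)) ->
  (forall z, cabs z <= 1 -> Y z = D2 + z *: (C2 *m invmx (1%:M - z *: A2) *m B2)) ->
  rational_times P s (fun z => symbol X Y z i j).
Proof.
move=> sA1 sA2 hX hY; apply: rational_times_mx => // a b.
  have [q [d [hd h]]] := transfer_quotient a b sA1 hX.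
  by apply: (rational_times_quot P_ext P_cst PD PM P_var P_inv _ hd h); case: s1 => ->; [left|right].
have [q [d [hd h]]] := star_quotient a b sA2 hY.
by apply: (rational_times_quot P_ext P_cst PD PM P_var P_inv _ hd h); case: s1 => ->; [right|left].
Qed.

End RationalEntries.

Variable lambda : 'I_m -> int.
Variables Wm Wp : Cx K -> 'M[Cx K]_m.
Hypothesis Wm_ext : forall z, 1 <= `|z| -> [/\ Wm z \in unitmx, mx_analytic_at Wm z &
  mx_analytic_at (fun u => invmx (Wm u)) z].
Hypothesis Wm_infty : mx_analytic_at_infty Wm /\ mx_analytic_at_infty (fun u => invmx (Wm u)).
Hypothesis Wp_disc : forall z, `|z| <= 1 -> [/\ Wp z \in unitmx, mx_analytic_at Wp z &
  mx_analytic_at (fun u => invmx (Wp u)) z].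
Hypothesis WH : forall z, `|z| = 1 ->
  symbol V W z = Wm z *m diag_mx (\row_j (z ^ lambda j)%R) *m Wp z.

Lemma Wp_unit z : cabs z = 1 -> Wp z \in unitmx.
Proof. by move=> z1; case: (Wp_disc (_ : `|z| <= 1)) => //; rewrite norm_le1 z1. Qed.

Lemma Wm_unit z : cabs z = 1 -> Wm z \in unitmx.
Proof. by move=> z1; case: (Wm_ext (_ : 1 <= `|z|)) => //; rewrite norm_ge1 z1. Qed.

Lemma diag_exprzK (mu : 'I_m -> int) (z : Cx K) : cabs z = 1 ->
  diag_mx (\row_j (z ^ mu j)%R) *m diag_mx (\row_j (z ^ (- mu j))%R) = 1%:M :> 'M[Cx K]_m.
Proof.
move=> z1; have z0 : z != 0 by rewrite -cabs_gt0 z1.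
rewrite mulmx_diag -diag_const_mx; congr diag_mx; apply/rowP => j.
by rewrite !mxE -expfzDr // addrN expr0z.
Qed.

(** This identity and the next three express each factor or inverse on the circle by one that is
    analytic on the other side, together with rational terms. *)
Lemma WpE z : cabs z = 1 ->
  Wp z = diag_mx (\row_j (z ^ (- lambda j))%R) *m (invmx (Wm z) *m symbol V W z).
Proof.
move=> z1; rewrite WH; last by apply/norm_eq1.
rewrite !mulmxA -[_ *m invmx _ *m Wm z]mulmxA mulVmx ?Wm_unit // mulmx1.
by rewrite (mulmx1C (diag_exprzK lambda z1)) mul1mx.
Qed.

Lemma WpVE z : cabs z = 1 ->
  invmx (Wp z) = symbol W V z *m (Wm z *m diag_mx (\row_j (z ^ lambda j)%R)).
Proof.
move=> z1; have /mulmx1C := symbol_mulV z1; rewrite WH; last by apply/norm_eq1.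
by move=> h; apply: invmx_left; rewrite -mulmxA.
Qed.

Lemma WmE z : cabs z = 1 ->
  Wm z = symbol V W z *m (invmx (Wp z) *m diag_mx (\row_j (z ^ (- lambda j))%R)).
Proof.
move=> z1; rewrite WH; last by apply/norm_eq1.
rewrite -!mulmxA [Wp z *m (_ *m _)]mulmxA mulmxV ?Wp_unit // mul1mx.
by rewrite (diag_exprzK lambda z1) mulmx1.
Qed.

Lemma WmVE z : cabs z = 1 ->
  invmx (Wm z) = diag_mx (\row_j (z ^ lambda j)%R) *m (Wp z *m symbol W V z).
Proof.
move=> z1; have := symbol_mulV z1; rewrite WH; last by apply/norm_eq1.
by move=> h; apply: invmx_left; apply: mulmx1C; rewrite mulmxA mulmxA.
Qed.

Definition matrix_wiener s (X : Cx K -> 'M[Cx K]_m) := forall i j, wiener s (fun z => X z i j).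

Lemma Wp_wiener : matrix_wiener 1 Wp /\ matrix_wiener 1 (fun z => invmx (Wp z)).
Proof.
have e := @ana_ext_eq K; have ec := @ana_ext_cst K; have eD := @ana_extD K.
have eM := @ana_extM K; have ev := @ana_ext_var K; have ei := @ana_ext_inv K.
have side X : (forall z, 1 <= `|z| -> mx_analytic_at X z) -> mx_analytic_at_infty X ->
    forall i j, rational_times (@ana_exterior K) 1 (fun z => X z i j).
  move=> h hi i j; apply: rational_timesP.
  have [l hl] := analytic_at_infty_ana (hi i j); exists l; split=> // z z1.
  by apply: analytic_at_ana; apply: h; rewrite norm_ge1.
split=> i j; apply: wiener1_of_rational_times.
- move=> z z1; apply: analytic_at_ana.
  by case: (Wp_disc (_ : `|z| <= 1)) => [|_ h _]; [rewrite norm_le1|exact: h].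
- apply: rational_times_ext => [z z1|]; first by rewrite [RHS](congr1 (fun M : 'M[Cx K]_m => M i j) (WpE z1)).
  apply: rational_times_mx => // [a b|]; first exact: rational_times_diag.
  apply: rational_times_mx => //; last first.
    by move=> a b; apply: (rational_times_symbol _ _ _ _ _ _ _ _ _ Av_stable A_stable V_disc W_disc) => //; left.
  by apply: side => [z z1|]; [case: (Wm_ext z1)|case: Wm_infty].
- move=> z z1; apply: analytic_at_ana.
  by case: (Wp_disc (_ : `|z| <= 1)) => [|_ _ h]; [rewrite norm_le1|exact: h].
- apply: rational_times_ext => [z z1|]; first by rewrite [RHS](congr1 (fun M : 'M[Cx K]_m => M i j) (WpVE z1)).
  apply: rational_times_mx => //.
    by move=> a b; apply: (rational_times_symbol _ _ _ _ _ _ _ _ _ A_stable Av_stable W_disc V_disc) => //; left.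
  apply: rational_times_mx => // [|a b]; last exact: rational_times_diag.
  by apply: side => [z z1|]; [case: (Wm_ext z1)|case: Wm_infty].
Qed.

Lemma Wm_wiener : matrix_wiener (-1) Wm /\ matrix_wiener (-1) (fun z => invmx (Wm z)).
Proof.
have e := @ana_disc_eq K; have ec := @ana_disc_cst K; have eD := @ana_discD K.
have eM := @ana_discM K; have ev := @ana_disc_var K; have ei := @ana_disc_inv K.
have side X : (forall z, `|z| <= 1 -> mx_analytic_at X z) ->
    forall i j, rational_times (@ana_disc K) (-1) (fun z => X z i j).
  move=> h i j; apply: rational_timesP => z z1.
  by apply: analytic_at_ana; apply: h; rewrite norm_le1.
have ext X : (forall z, 1 <= `|z| -> mx_analytic_at X z) -> mx_analytic_at_infty X ->
    forall i j, ana_exterior (fun z => X z i j).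
  move=> h hi i j; have [l hl] := analytic_at_infty_ana (hi i j); exists l; split=> // z z1.
  by apply: analytic_at_ana; apply: h; rewrite norm_ge1.
split=> i j; apply: wienerN1_of_rational_times.
- by apply: ext => [z z1|]; [case: (Wm_ext z1)|case: Wm_infty].
- apply: rational_times_ext => [z z1|]; first by rewrite [RHS](congr1 (fun M : 'M[Cx K]_m => M i j) (WmE z1)).
  apply: rational_times_mx => //.
    by move=> a b; apply: (rational_times_symbol _ _ _ _ _ _ _ _ _ Av_stable A_stable V_disc W_disc) => //; right.
  apply: rational_times_mx => // [|a b]; last exact: rational_times_diag.
  by apply: side => z z1; case: (Wp_disc z1).
- have h z : 1 <= `|z| -> mx_analytic_at (fun u => invmx (Wm u)) z.
    by move=> z1; case: (Wm_ext z1).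
  exact: ext h Wm_infty.2 i j.
- apply: rational_times_ext => [z z1|]; first by rewrite [RHS](congr1 (fun M : 'M[Cx K]_m => M i j) (WmVE z1)).
  apply: rational_times_mx => // [a b|]; first exact: rational_times_diag.
  apply: rational_times_mx => //; last first.
    by move=> a b; apply: (rational_times_symbol _ _ _ _ _ _ _ _ _ A_stable Av_stable W_disc V_disc) => //; right.
  by apply: side => z z1; case: (Wp_disc z1).
Qed.

End WienerHopfFactors.

(** * Counting indices *)

Section KernelCount.
Variable F : fieldType.

Lemma kernel_vector n (M : 'M[F]_n) (c : 'rV_(\rank (kermx M^T))) :
  M *m (c *m row_base (kermx M^T))^T = 0.
Proof.
have : (c *m row_base (kermx M^T) <= kermx M^T)%MS.
  by rewrite (submx_trans (submxMl _ _)) // eq_row_base.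
by move/sub_kermxP => e; apply: trmx_inj; rewrite trmx_mul trmxK e trmx0.
Qed.

Lemma rank_kermx_tr n (M : 'M[F]_n) : \rank (kermx M^T) = \rank (cokermx M).
Proof. by rewrite mxrank_ker mxrank_coker mxrank_tr. Qed.

(** The functionals [P t] together embed the null space of [M] into a space with coordinates in
    [T]. *)
Lemma kernel_le_card n (M : 'M[F]_n) (T : finType) (P : T -> 'I_n -> F) :
  (forall x : 'cV[F]_n, M *m x = 0 -> (forall t, \sum_i P t i * x i 0 = 0) -> x = 0) ->
  (\rank (cokermx M) <= #|T|)%N.
Proof.
move=> inj; rewrite -rank_kermx_tr.
pose Q : 'M[F]_(n, #|T|) := \matrix_(i, t) P (enum_val t) i.
have /eqP <- : row_free (row_base (kermx M^T) *m Q); last exact: rank_leq_col.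
apply: inj_row_free => v; rewrite mulmxA => vQ.
have : (v *m row_base (kermx M^T))^T = 0.
  apply: inj => [|t]; first exact: kernel_vector.
  have e : ((v *m row_base (kermx M^T)) *m Q) 0 (enum_rank t) = 0 by rewrite vQ mxE.
  rewrite -[RHS]e [RHS]mxE; apply: eq_bigr => i _.
  by rewrite mxE [Q _ _]mxE enum_rankK mulrC.
move/(congr1 trmx); rewrite trmxK trmx0 => e.
by apply: (row_free_inj (row_base_free (kermx M^T))); rewrite e mul0mx.
Qed.

Lemma card_le_kernel n (M : 'M[F]_n) (T : finType) (x : T -> 'cV[F]_n) :
  (forall t, M *m x t = 0) ->
  (forall c : T -> F, \sum_t c t *: x t = 0 -> forall t, c t = 0) ->
  (#|T| <= \rank (cokermx M))%N.
Proof.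
move=> Mx indep; rewrite -rank_kermx_tr.
pose X : 'M[F]_(#|T|, n) := \matrix_(t, i) x (enum_val t) i 0.
have rowX t : row t X = (x (enum_val t))^T by apply/rowP => i; rewrite !mxE.
have /eqP <- : row_free X.
  apply: inj_row_free => v vX; apply/rowP => t; rewrite mxE -[t]enum_valK.
  apply: (indep (fun t => v 0 (enum_rank t))); apply: trmx_inj; rewrite trmx0 -vX.
  rewrite mulmx_sum_row linear_sum /= (reindex (@enum_val T xpredT)) /=; last first.
    by exists enum_rank => i _; [rewrite enum_valK|rewrite enum_rankK].
  by apply: eq_bigr => i _; rewrite linearZ /= rowX enum_valK.
apply: mxrankS; apply/row_subP => t; apply/sub_kermxP.
by rewrite rowX -trmx_mul Mx trmx0.
Qed.

End KernelCount.

(** * Toeplitz operators in terms of functions on the circle *)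

Section ToeplitzFourier.
Variable K : realType.

Lemma cvgn_sum (I : Type) (r : seq I) (u : I -> nat -> Cx K) (l : I -> Cx K) :
  (forall i, u i @ \oo --> l i) -> (fun n => \sum_(i <- r) u i n) @ \oo --> \sum_(i <- r) l i.
Proof.
move=> h; elim: r => [|i r IH].
  rewrite big_nil (_ : (fun n => _) = (fun=> 0)); first exact: cvg_cst.
  by apply: funext => n; rewrite big_nil.
rewrite big_cons (_ : (fun n => _) = (fun n => u i n + \sum_(i <- r) u i n)).
  exact: (@cvgD _ (Cx K) nat \oo _ (u i) (fun n => \sum_(i <- r) u i n) (l i) _ (h i) IH).
by apply: funext => n; rewrite big_cons.
Qed.

Lemma fc_series (g f : Cx K -> Cx K) i : cmeas g -> wiener 1 f ->
  series (fun j : nat => fc g (i - j%:Z) * fc f j%:Z) @ \oo --> fc (fun z => g z * f z) i.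
Proof.
move=> mg wf; have [a [M [q [q01 hf]]]] := wf; have [_ _ [b hb]] := mg.
have ha n : fc f n%:Z = a n by rewrite -[n%:Z]mul1r (wiener_coef _ _ q01 hf).
apply: (@cvg_geometric_shift _ _ _ (2 * (b * M)) q 0%N q01) => N.
rewrite add0n /series /= big_mkord.
have := fc_pexpM i N mg wf hf hb.
rewrite (eq_bigr (fun j : 'I_N => fc g (i - j%:Z) * fc f j%:Z)) // => j _.
by rewrite ha mul1r mulrC.
Qed.

(** The index count multiplies functions on the circle; this connects it with the operator, which is
    defined on sequences. *)
Lemma toeplitz_fc m (G : Cx K -> 'M[Cx K]_m) (h : Cx K -> 'cV[Cx K]_m) (i : nat) :
  (forall a b, cmeas (fun z => G z a b)) -> (forall b, wiener 1 (fun z => h z b 0)) ->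
  toeplitz G (fun n => \col_b fc (fun z => h z b 0) n%:Z) i =
  \col_a fc (fun z => (G z *m h z) a 0) i%:Z.
Proof.
move=> mG wh; apply/colP => a; rewrite !mxE.
apply: cvg_lim; first exact: norm_hausdorff.
have -> : fc (fun z => (G z *m h z) a 0) i%:Z = \sum_b fc (fun z => G z a b * h z b 0) i%:Z.
  rewrite -fc_sum => [|b]; last by apply: cmeasM => //; exact: wiener_cmeas (wh b).
  by apply: fc_ext => z _; rewrite mxE.
rewrite (_ : series _ = (fun n => \sum_b series (fun j : nat =>
    fc (fun z => G z a b) (i%:Z - j%:Z) * fc (fun z => h z b 0) j%:Z) n)).
  by apply: cvgn_sum => b; exact: fc_series.
apply: funext => n; rewrite /series /= exchange_big /=; apply: eq_bigr => j _.
by rewrite mxE; apply: eq_bigr => b _; rewrite !mxE.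
Qed.

Lemma wiener1_geometric (f : Cx K -> Cx K) : wiener 1 f ->
  exists c q, 0 <= q < 1 /\ forall n : nat, cabs (fc f n%:Z) <= c * q ^+ n.
Proof.
move=> [a [M [q [q01 hf]]]]; exists (M * (1 + q)), q; split=> // n.
rewrite -[n%:Z]mul1r (wiener_coef _ _ q01 hf) //.
by have := pexp_term n (hf 1 (cabs1 K)); rewrite expr1z expr1n mulr1.
Qed.

Lemma wiener1_ell2 m (h : Cx K -> 'cV[Cx K]_m) : (forall b, wiener 1 (fun z => h z b 0)) ->
  ell2 (fun n => \col_b fc (fun z => h z b 0) n%:Z).
Proof.
move=> wh.
have [c [q [q01 hc]]] : exists c q, 0 <= q < 1 /\
    forall b (n : nat), cabs (fc (fun z => h z b 0) n%:Z) <= c * q ^+ n.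
  suff [c [q [q01 hc]]] : exists c q, 0 <= q < 1 /\ forall b, b \in enum 'I_m ->
      forall n : nat, cabs (fc (fun z => h z b 0) n%:Z) <= c * q ^+ n.
    by exists c, q; split=> // b; apply: hc; rewrite mem_enum.
  elim: (enum 'I_m) => [|b s [c [q [/andP[q0 q1] hs]]]].
    by exists 0, (1 / 2); split=> //; apply/andP; split; lra.
  have [c' [q' [/andP[q'0 q'1] hb]]] := wiener1_geometric (wh b).
  have c'0 : 0 <= c' by have := hb 0%N; rewrite expr0 mulr1; apply: le_trans (cabs_ge0 _).
  exists (`|c| + c'), (Num.max q q'); split; first by rewrite le_max q0 gt_max q1.
  have m0 n : q ^+ n <= Num.max q q' ^+ n by rewrite lerXn2r ?nnegrE ?le_max ?q0 ?lexx.
  have m1 n : q' ^+ n <= Num.max q q' ^+ n by rewrite lerXn2r ?nnegrE ?le_max ?q'0 ?lexx ?orbT.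
  have p0 n : 0 <= q ^+ n by rewrite exprn_ge0.
  have p1 n : 0 <= q' ^+ n by rewrite exprn_ge0.
  move=> d; rewrite inE => /predU1P[-> n|ds n].
    apply: le_trans (hb n) _; rewrite ler_pM // lerDr //.
  apply: le_trans (hs d ds n) _; apply: (@le_trans _ _ (`|c| * q ^+ n)).
    by rewrite ler_wpM2r // ler_norm.
  by rewrite ler_pM // lerDl.
apply: (@geometric_ell2 _ _ _ ((m * 1)%:R * c) q q01) => n; rewrite -mulrA.
by apply: mnorm_le_entries => b j; rewrite mxE.
Qed.

Lemma fc_matrix_wienerN1 m (X : Cx K -> 'M[Cx K]_m) (g : Cx K -> 'cV[Cx K]_m) a (i : nat) :
  matrix_wiener (-1) X -> (forall b, cmeas (fun z => g z b 0)) ->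
  (forall b (i : nat), fc (fun z => g z b 0) i%:Z = 0) ->
  fc (fun z => (X z *m g z) a 0) i%:Z = 0.
Proof.
move=> wX mg g0.
rewrite (_ : fc _ _ = fc (fun z => \sum_b g z b 0 * X z a b) i%:Z); last first.
  by apply: fc_ext => z _; rewrite mxE; apply: eq_bigr => b _; rewrite mulrC.
rewrite fc_sum => [|b]; last by apply: cmeasM => //; exact: wiener_cmeas (wX a b).
rewrite big1 // => b _; apply: (fc_wiener_eq0 (mg b) (wX a b)) => n.
by rewrite mulN1r opprK -PoszD g0.
Qed.

Lemma wiener_mulmx s m n p (X : Cx K -> 'M[Cx K]_(m, n)) (Y : Cx K -> 'M[Cx K]_(n, p)) i j :
  (forall i j, wiener s (fun z => X z i j)) -> (forall i j, wiener s (fun z => Y z i j)) ->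
  wiener s (fun z => (X z *m Y z) i j).
Proof.
move=> hX hY; apply: (@wiener_ext _ s (fun z => \sum_k X z i k * Y z k j)).
  by move=> z _; rewrite mxE.
by apply: wiener_sum => k; exact: wienerM.
Qed.

End ToeplitzFourier.

(** * The kernel dimension in terms of the Wiener-Hopf indices *)

Section IndexCount.
Variable K : realType.
Variables (m nv nw : nat) (V W : Cx K -> 'M[Cx K]_m).
Variables (Av : 'M[Cx K]_nv) (Bv : 'M[Cx K]_(nv, m)) (Cv : 'M[Cx K]_(m, nv)) (Dv : 'M[Cx K]_m).
Variables (A : 'M[Cx K]_nw) (B : 'M[Cx K]_(nw, m)) (C : 'M[Cx K]_(m, nw)) (D : 'M[Cx K]_m).
Hypothesis Av_stable : stable Av.
Hypothesis A_stable : stable A.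
Hypothesis Uv : block_mx Av Bv Cv Dv \is unitarymx.
Hypothesis U : block_mx A B C D \is unitarymx.
Hypothesis V_disc : forall z, cabs z <= 1 -> V z = Dv + z *: (Cv *m invmx (1%:M - z *: Av) *m Bv).
Hypothesis W_disc : forall z, cabs z <= 1 -> W z = D + z *: (C *m invmx (1%:M - z *: A) *m B).
Variables (Omega : 'M[Cx K]_(nv, nw)) (C0 : 'M[Cx K]_(m, nw)) (Q : 'M[Cx K]_nw).
Hypothesis Omega_eq : Omega = Av *m Omega *m A ^t* + Bv *m B ^t*.
Hypothesis C0_def : C0 = Dv *m B ^t* + Cv *m Omega *m A ^t*.
Hypothesis Q_eq : Q = A *m Q *m A ^t* + C0 ^t* *m C0.
Variable lambda : 'I_m -> int.
Variables Wm Wp : Cx K -> 'M[Cx K]_m.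
Hypothesis Wm_ext : forall z, 1 <= `|z| -> [/\ Wm z \in unitmx, mx_analytic_at Wm z &
  mx_analytic_at (fun u => invmx (Wm u)) z].
Hypothesis Wm_infty : mx_analytic_at_infty Wm /\ mx_analytic_at_infty (fun u => invmx (Wm u)).
Hypothesis Wp_disc : forall z, `|z| <= 1 -> [/\ Wp z \in unitmx, mx_analytic_at Wp z &
  mx_analytic_at (fun u => invmx (Wp u)) z].
Hypothesis WH : forall z, `|z| = 1 ->
  symbol V W z = Wm z *m diag_mx (\row_j (z ^ lambda j)%R) *m Wp z.

Let Wp_w := Wp_wiener Av_stable A_stable Uv U V_disc W_disc Wm_ext Wm_infty Wp_disc WH.
Let Wm_w := Wm_wiener Av_stable A_stable Uv U V_disc W_disc Wm_ext Wm_infty Wp_disc WH.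

Variable k : nat.
Let Rk z := z ^+ k *: symbol V W z.

Lemma Rk_factor z : cabs z = 1 ->
  Rk z = Wm z *m (diag_mx (\row_j (z ^ (lambda j + k%:Z))%R) *m Wp z).
Proof.
move=> z1; have z0 : z != 0 by rewrite -cabs_gt0 z1.
rewrite /Rk WH; last by apply/norm_eq1.
rewrite -mulmxA scalemxAr scalemxAl; congr (_ *m (_ *m _)).
apply/matrixP => i j; rewrite !mxE mulrnAr; congr (_ *+ _).
by rewrite expfzDr // -exprnP mulrC.
Qed.

Lemma cmeas_Rk i j : cmeas (fun z => Rk z i j).
Proof.
apply: (@cmeas_ext _ (fun z => (z ^ k%:Z)%R * symbol V W z i j)).
  by move=> z _; rewrite [RHS]mxE -exprnP.
apply: cmeasM; first exact: cmeas_exprz.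
exact: (cmeas_symbol Av_stable A_stable V_disc W_disc Omega_eq C0_def i j).
Qed.

Lemma cmeas_Rk_mul (h : Cx K -> 'cV[Cx K]_m) a : (forall b, wiener 1 (fun z => h z b 0)) ->
  cmeas (fun z => (Rk z *m h z) a 0).
Proof.
move=> wh; apply: (@cmeas_ext _ (fun z => \sum_b Rk z a b * h z b 0)).
  by move=> z _; rewrite mxE.
by apply: cmeas_sum => b; apply: cmeasM; [exact: cmeas_Rk|exact: wiener_cmeas (wh b)].
Qed.

(** This is max(0, -(lambda_j + k)), the kernel dimension of the scalar Toeplitz operator with
    symbol [z^(lambda_j + k)]. *)
Definition index_defect j : nat :=
  if lambda j + k%:Z < 0 then absz (lambda j + k%:Z) else 0%N.

(** Multiplication by the inverse of [Wm] creates no coefficient of nonnegative index, and it turns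
    [Rk h] into the vector with entries [z^(lambda_j + k) (Wp h)_j]. *)
Lemma fc_Wp_kernel (h : Cx K -> 'cV[Cx K]_m) j (n : nat) : (forall b, wiener 1 (fun z => h z b 0)) ->
  (forall a (i : nat), fc (fun z => (Rk z *m h z) a 0) i%:Z = 0) -> (index_defect j <= n)%N ->
  fc (fun z => (Wp z *m h z) j 0) n%:Z = 0.
Proof.
move=> wh h0 jn.
(* The bound [index_defect j <= n] makes the shifted index [n + lambda j + k] nonnegative. *)
have [i iE] : exists i : nat, n%:Z = i%:Z - (lambda j + k%:Z).
  by move: jn; rewrite /index_defect; move: (lambda j) => l; clear; case: ifP => ? ?;
    exists (absz (n%:Z + (l + k%:Z))%R); lia.
rewrite iE -fc_shift -(fc_matrix_wienerN1 j i Wm_w.2 (fun b => cmeas_Rk_mul b wh) h0).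
apply: fc_ext => z z1; rewrite Rk_factor // -!mulmxA mulKmx; last exact: (Wm_unit Wm_ext).
by rewrite mul_diag_mx !mxE.
Qed.

(** A kernel vector [x] is determined by the coefficients of [(Wp hx)_j] below [index_defect j]: all
    others vanish, so if these do too, then [Wp hx = 0], hence [hx = 0], and [x = 0] by
    observability. *)
Lemma nullity_le_indices :
  (nullity (1%:M - A ^+ k *m Q *m (A ^t*) ^+ k) <= #|{: {j : 'I_m & 'I_(index_defect j)}}|)%N.
Proof.
pose h i z : 'cV[Cx K]_m := C *m invmx (1%:M - z *: A) *m (delta_mx i 0 : 'cV[Cx K]_nw).
pose u i j z := (Wp z *m h i z) j 0.
pose T : finType := {j : 'I_m & 'I_(index_defect j)}.
(* The functionals are given by their values on the standard basis vectors, which is what [h i] and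
   [u i j] are built from. *)
rewrite /nullity; apply: (@kernel_le_card _ _ _ T (fun t i => fc (u i (tag t)) (tagged t)%:Z)) => x Mx Px.
pose hx z : 'cV[Cx K]_m := C *m invmx (1%:M - z *: A) *m x.
have wh i b : wiener 1 (fun z => h i z b 0).
  by have [] := wiener_forward C (delta_mx i 0 : 'cV[Cx K]_nw) b 0 A_stable.
have whx b : wiener 1 (fun z => hx z b 0) by have [] := wiener_forward C x b 0 A_stable.
have hxE b (n : nat) : fc (fun z => hx z b 0) n%:Z = (C *m A ^+ n *m x) b 0.
  by have [_ ->] := wiener_forward C x b 0 A_stable.
have wu i j : wiener 1 (u i j) by apply: wiener_mulmx => // a b; [exact: Wp_w.1|rewrite [b]ord1].
have wux j : wiener 1 (fun z => (Wp z *m hx z) j 0).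
  by apply: wiener_mulmx => // a b; [exact: Wp_w.1|rewrite [b]ord1].
have hx0 a (i : nat) : fc (fun z => (Rk z *m hx z) a 0) i%:Z = 0.
  have : toeplitz_ker Rk (fun n => \col_b fc (fun z => hx z b 0) n%:Z).
    rewrite (toeplitz_ker_symbol Av_stable A_stable Uv U V_disc W_disc Omega_eq C0_def Q_eq).
    by exists x; split=> // n; apply/colP => b; rewrite mxE hxE.
  by case=> _ /(_ i); rewrite (toeplitz_fc i cmeas_Rk whx) => /colP/(_ a); rewrite !mxE.
have ux0 j (n : nat) : fc (fun z => (Wp z *m hx z) j 0) n%:Z = 0.
  have [jn|nj] := leqP (index_defect j) n; first exact: fc_Wp_kernel.
  have <- := Px (Tagged (fun j => 'I_(index_defect j)) (Ordinal nj)).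
  rewrite /= (_ : fc _ _ = fc (fun z => \sum_i x i 0 * u i j z) n%:Z); last first.
    apply: fc_ext => z z1; rewrite /hx {1}(matrix_sum_delta x) mulmx_sumr mulmx_sumr summxE.
    apply: eq_bigr => i _; rewrite big_ord1 -!scalemxAr mxE.
    by rewrite /u /h.
  rewrite fc_sum => [|i]; last by apply: cmeasM; [exact: cmeas_cst|exact: wiener_cmeas (wu i j)].
  apply: eq_bigr => i _; rewrite fcZ; last exact: wiener_cmeas (wu i j).
  exact: mulrC.
apply: (observability_injective A_stable U) => n; apply/colP => b.
rewrite mulmxA -hxE [RHS]mxE (_ : fc _ _ = fc (fun=> 0 * (1 : Cx K)) n%:Z).
  by rewrite fcZ ?mul0r //; exact: cmeas_cst.
apply: fc_ext => z z1; rewrite mul0r -[hx z](mulKmx (Wp_unit Wp_disc z1)).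
rewrite (_ : Wp z *m hx z = 0) ?mulmx0 ?mxE //; apply/colP => j.
by rewrite (wiener1_polynomial (wux j) (fun l (_ : (0 <= l)%N) => ux0 j l) z1) big_ord0 mxE.
Qed.

(** The functions [Wp^{-1} z^n e_j] with [n < index_defect j] lie in the kernel: [Rk] maps them to
    [z^(lambda_j + k + n)] times a column of [Wm], which has negative frequencies only. *)
Lemma indices_le_nullity :
  (#|{: {j : 'I_m & 'I_(index_defect j)}}| <= nullity (1%:M - A ^+ k *m Q *m (A ^t*) ^+ k))%N.
Proof.
pose T : finType := {j : 'I_m & 'I_(index_defect j)}.
pose h (t : T) z : 'cV[Cx K]_m := invmx (Wp z) *m (z ^+ tagged t *: delta_mx (tag t) 0).
have wh t b : wiener 1 (fun z => h t z b 0).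
  apply: wiener_mulmx => [i j|i j]; first exact: Wp_w.2.
  apply: (@wiener_ext _ 1 (fun z => (z ^ (1 : int))%R ^+ tagged t * (delta_mx (tag t) 0 : 'cV[Cx K]_m) i j)).
    by move=> z _; rewrite expr1z !mxE.
  by apply: wienerM; [exact: wiener_exp|exact: wiener_cst].
have hker t : toeplitz_ker Rk (fun n => \col_b fc (fun z => h t z b 0) n%:Z).
  split; first exact: wiener1_ell2.
  move=> i; rewrite (toeplitz_fc i cmeas_Rk (wh t)); apply/colP => a; rewrite !mxE.
  have [l lE] : exists l : nat, i%:Z - (lambda (tag t) + k%:Z + (tagged t)%:Z) = l.+1%:Z.
    have := ltn_ord (tagged t); move: (nat_of_ord (tagged t)) => n; rewrite /index_defect.
    move: (lambda _) => l; clear; case: ifP => ? ? //.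
    exists (absz (i%:Z - (l + k%:Z + n%:Z) - 1)%R); lia.
  rewrite -(wienerN1_fc_pos l (Wm_w.1 a (tag t))) -lE -fc_shift; apply: fc_ext => z z1.
  have z0 : z != 0 by rewrite -cabs_gt0 z1.
  rewrite Rk_factor // /h -!mulmxA mulKVmx ?(Wp_unit Wp_disc) //.
  rewrite -!scalemxAr mxE mul_diag_mx mxE (bigD1 (tag t)) //= big1 => [|j jt].
    by rewrite !mxE !eqxx mulr1 addr0 [in RHS]expfzDr // -exprnP; ring.
  by rewrite !mxE (negPf jt) !mulr0.
have /choice[x hx] : forall t, exists x : 'cV[Cx K]_nw,
    (1%:M - A ^+ k *m Q *m (A ^t*) ^+ k) *m x = 0 /\
    forall n : nat, \col_b fc (fun z => h t z b 0) n%:Z = (C *m A ^+ n) *m x.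
  move=> t; have := hker t.
  by rewrite (toeplitz_ker_symbol Av_stable A_stable Uv U V_disc W_disc Omega_eq C0_def Q_eq).
rewrite /nullity; apply: (@card_le_kernel _ _ _ T x) => [t|c cx t]; first by case: (hx t).
pose g z : 'cV[Cx K]_m := \sum_t c t *: h t z.
have gE z b : g z b 0 = \sum_t c t * h t z b 0.
  by rewrite summxE; apply: eq_bigr => s _; rewrite mxE.
have wg b : wiener 1 (fun z => g z b 0).
  apply: (@wiener_ext _ 1 (fun z => \sum_t c t * h t z b 0)) => [z _|]; first by rewrite gE.
  by apply: wiener_sum => s; apply: wienerM; [exact: wiener_cst|exact: wh].
have g0 z : cabs z = 1 -> g z = 0.
  move=> z1; apply/colP => b; suff gb0 (n : nat) : (0 <= n)%N -> fc (fun z => g z b 0) n%:Z = 0.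
    by rewrite (wiener1_polynomial (wg b) gb0 z1) big_ord0 mxE.
  move=> _; rewrite (_ : fc _ _ = fc (fun z => \sum_t c t * h t z b 0) n%:Z); last first.
    by apply: fc_ext => w _; rewrite gE.
  rewrite fc_sum => [|s]; last by apply: cmeasM; [exact: cmeas_cst|exact: wiener_cmeas (wh s b)].
  transitivity (((C *m A ^+ n) *m \sum_t c t *: x t) b 0); last by rewrite cx mulmx0 mxE.
  rewrite mulmx_sumr summxE; apply: eq_bigr => s _; rewrite -scalemxAr -(hx s).2 !mxE fcZ //.
  exact: wiener_cmeas (wh s b).
(* Independence: multiplying the relation by [Wp] leaves monomials [z^n e_j], and [c t] is the
   coefficient at index [tagged t] of the component [tag t]. *)
pose d (s : T) : Cx K := (delta_mx (tag s) 0 : 'cV[Cx K]_m) (tag t) 0.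
have : fc (fun z => \sum_s c s * (d s * (z ^ (tagged s)%:Z)%R)) (tagged t)%:Z = 0.
  rewrite -[RHS](mul0r (fc (fun=> 1) (tagged t)%:Z)) -fcZ; last exact: cmeas_cst.
  apply: fc_ext => z z1; rewrite mul0r.
  transitivity ((Wp z *m g z) (tag t) 0); last by rewrite g0 // mulmx0 mxE.
  rewrite mulmx_sumr summxE; apply: eq_bigr => s _.
  rewrite -scalemxAr /h mulKVmx ?(Wp_unit Wp_disc) // [in RHS]mxE [in RHS]mxE.
  by rewrite -exprnP [_ * d s]mulrC.
rewrite fc_sum => [|s]; last first.
  by apply: cmeasM; [exact: cmeas_cst|apply: cmeasM; [exact: cmeas_cst|exact: cmeas_exprz]].
rewrite (bigD1 t) //= big1 ?addr0 => [|s st].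
  rewrite fcZ; last by apply: cmeasM; [exact: cmeas_cst|exact: cmeas_exprz].
  rewrite fcZ; last exact: cmeas_exprz.
  by rewrite fc_exprz eqxx /d mxE !eqxx mul1r mulr1.
rewrite fcZ; last by apply: cmeasM; [exact: cmeas_cst|exact: cmeas_exprz].
rewrite fcZ; last exact: cmeas_exprz.
rewrite fc_exprz /d mxE eqxx andbT.
have [e|] := eqVneq (tag t) (tag s); last by rewrite mul0r mulr0.
have [e'|] := eqVneq (tagged t)%:Z (tagged s)%:Z; last by rewrite !mulr0.
case/eqP: st; clear -e e'; case: t e e' => j n; case: s => j' n' /= e; case: _ / e n' => n' [] /val_inj ->.
by [].
Qed.

Lemma nullity_indices :
  nullity (1%:M - A ^+ k *m Q *m (A ^t*) ^+ k) = (\sum_j index_defect j)%N.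
Proof.
apply/eqP; rewrite eqn_leq.
have -> : (\sum_j index_defect j)%N = #|{: {j : 'I_m & 'I_(index_defect j)}}|.
  by rewrite card_tagged sumnE big_map big_enum; apply: eq_bigr => j _; rewrite card_ord.
by rewrite nullity_le_indices indices_le_nullity.
Qed.

End IndexCount.

(** * The negative indices as the conjugate partition of the differences *)

Lemma index_defect_neg (l : int) (k : nat) :
  (if l + k%:Z < 0 then absz (l + k%:Z) else 0%N) = (if l < 0 then (absz l - k)%N else 0%N).
Proof. by case: ifP; case: ifP; lia. Qed.

Lemma sum_index_defect m (lambda : 'I_m -> int) (kappa : seq nat) k :
  perm_eq [seq - j%:Z | j <- kappa] [seq l <- codom lambda | l < 0] ->
  (\sum_j index_defect lambda k j = \sum_(j <- kappa) (j - k))%N.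
Proof.
move=> hk.
have -> : (\sum_(j <- kappa) (j - k) = \sum_(l <- [seq - j%:Z | j <- kappa]) (absz l - k))%N.
  by rewrite big_map; apply: eq_bigr => j _; rewrite abszN.
rewrite (perm_big _ hk) /= big_filter codomE big_map [RHS]big_mkcond [RHS]big_enum /=.
by apply: eq_bigr => j _; exact: index_defect_neg.
Qed.

(** Passing from [j - k] to [j - k.-1] adds 1 exactly when [k <= j]; for smaller [j] both truncated
    differences are 0. *)
Lemma sum_subn_step (s : seq nat) k : (0 < k)%N ->
  (\sum_(j <- s) (j - k.-1) = \sum_(j <- s) (j - k) + count (leq k) s)%N.
Proof.
move=> k0; elim: s => [|j s IH]; first by rewrite !big_nil.
by rewrite !big_cons IH /=; lia.
Qed.

Lemma sum_subn_diff (s : seq nat) k : (0 < k)%N ->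
  (\sum_(j <- s) (j - k.-1))%N%:Z - (\sum_(j <- s) (j - k))%N%:Z = (count (leq k) s)%:Z.
Proof. by move=> k0; rewrite (sum_subn_step _ k0) PoszD addrAC subrr add0r. Qed.

(** In a nonincreasing sequence the entries that are at least [k] form an initial segment. *)
Lemma count_geq_nth (s : seq nat) k i : sorted geq s -> (i < size s)%N ->
  (i < count (leq k) s)%N = (k <= nth 0 s i)%N.
Proof.
elim: s i => // x s IH i /= xs.
have /allP hx : all (geq x) s by apply: order_path_min xs => a b c ab ca; exact: leq_trans ca ab.
have ss := path_sorted xs; case: i => [|i] /= hi.
  have [kx|xk] := leqP k x; first by [].
  rewrite add0n; apply/negbTE; rewrite -has_count; apply/negP => /hasP[y /hx /= yx ky]; lia.
have [kx|xk] := leqP k x; first by rewrite add1n ltnS IH.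
have yk y : y \in s -> (k <= y)%N = false by move/hx => /= yx; lia.
rewrite (eq_in_count yk) count_pred0 yk //; exact: mem_nth.
Qed.

Lemma card_interval1 n : [set k : nat | (1 <= k <= n)%N] #= `I_n.
Proof.
have -> : [set k : nat | (1 <= k <= n)%N] = [set k.+1 | k in `I_n].
  apply/seteqP; split=> [[|k] //= kn|_ [k kn <-]]; last by [].
  by exists k.
by apply: inj_card_eq => i j _ _ [].
Qed.

(** At least [j] entries reach [k] exactly when the [j]-th one does, so the set is the interval from
    1 to that entry. Positions in [kappa] are counted from 0, hence [j.-1]. *)
Lemma conjugate_partition (kappa : seq nat) j (f : nat -> int) : sorted geq kappa ->
  (forall k, (0 < k)%N -> f k = (count (leq k) kappa)%:Z) -> (1 <= j <= size kappa)%N ->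
  [set k : nat | (1 <= k)%N /\ j%:Z <= f k] #= `I_(nth 0%N kappa j.-1).
Proof.
move=> hs hf; case: j => // j /= jk.
rewrite (_ : [set k | _] = [set k : nat | (1 <= k <= nth 0%N kappa j)%N]).
  exact: card_interval1.
apply/seteqP; split=> k /=.
  by case=> k1; rewrite hf // lez_nat (count_geq_nth _ hs jk) => ->; rewrite k1.
by case/andP=> k1 hk; rewrite hf // lez_nat (count_geq_nth _ hs jk).
Qed.

Lemma negative_index_pos m (lambda : 'I_m -> int) kappa j :
  perm_eq [seq - j%:Z | j <- kappa] [seq l <- codom lambda | l < 0] -> j \in kappa -> (0 < j)%N.
Proof.
move=> hk jk; have : - j%:Z \in [seq l <- codom lambda | l < 0].
  by rewrite -(perm_mem hk); apply: (map_f (fun j : nat => - j%:Z) jk).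
by rewrite mem_filter => /andP[]; lia.
Qed.

Theorem theorem2p2 (K : realType) (m nv nw : nat)
  (V W R : Cx K -> 'M[Cx K]_m)
  (V_rat : mx_rational V) (V_Hinfty : Hinfty V) (V_inner : bi_inner V)
  (W_rat : mx_rational W) (W_Hinfty : Hinfty W) (W_inner : bi_inner W)
  (R_def : R = fun z => V z *m star_fun W z)
  (Av : 'M[Cx K]_nv) (Bv : 'M[Cx K]_(nv, m)) (Cv : 'M[Cx K]_(m, nv))
  (Dv : 'M[Cx K]_m)
  (V_real : stable_unitary_realization V Av Bv Cv Dv)
  (Aw : 'M[Cx K]_nw) (Bw : 'M[Cx K]_(nw, m)) (Cw : 'M[Cx K]_(m, nw))
  (Dw : 'M[Cx K]_m)
  (W_real : stable_unitary_realization W Aw Bw Cw Dw)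
  (Omega : 'M[Cx K]_(nv, nw))
  (Omega_eq : Omega = Av *m Omega *m Aw ^t* + Bv *m Bw ^t*)
  (C0 : 'M[Cx K]_(m, nw))
  (C0_def : C0 = Dv *m Bw ^t* + Cv *m Omega *m Aw ^t*)
  (Q : 'M[Cx K]_nw)
  (Q_eq : Q = Aw *m Q *m Aw ^t* + C0 ^t* *m C0) :
  let nk := fun k : nat =>
    nullity (1%:M - (Aw ^+ k) *m Q *m ((Aw ^t*) ^+ k)) in
  let mu := fun k : nat => (nk k.-1)%:Z - (nk k)%:Z in
  [/\ psdmx Q /\ psdmx (1%:M - Q),
      nullity_toeplitz R (nullity (1%:M - Q)) /\
      mup 1 (char_poly Q) = nullity (1%:M - Q) &
      forall (lambda : 'I_m -> int) (kappa : seq nat),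
        wiener_hopf_indices R lambda -> negative_indices lambda kappa ->
        [/\ forall k : nat, (k <= size kappa)%N ->
              nullity_toeplitz (fun z => z ^+ k *: R z) (nk k),
            (size kappa)%:Z = mu 1%N &
            forall j : nat, (1 <= j <= size kappa)%N ->
              [set k : nat | (1 <= k)%N /\ j%:Z <= mu k]
                #= `I_(nth 0%N kappa j.-1)]].
Proof.
move=> nk mu.
case: V_real => V_re Av_s Uv; case: W_real => W_re A_s U.
have V_disc := realization_disc V_rat Av_s V_re.
have W_disc := realization_disc W_rat A_s W_re.
have kerT k : nullity_toeplitz (fun z => z ^+ k *: R z) (nk k).
  rewrite R_def.
  exact: (nullity_toeplitz_symbol Av_s A_s Uv U V_disc W_disc Omega_eq C0_def Q_eq k).
have nk0 : nk 0%N = nullity (1%:M - Q) by rewrite /nk !expr0 mul1mx mulmx1.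
have QE := stein_solution A_s Uv U Omega_eq C0_def Q_eq.
have Q_herm : Q ^t* = Q by rewrite QE hadjB hadj1 hadjM trmxCK.
split.
- by split; [exact: (psdmx_stein A_s Q_eq)|exact: (psdmx_contraction A_s Uv U Omega_eq C0_def Q_eq)].
- split; last by rewrite /nullity mxrank_coker; exact: (mup_char_poly_hermitian 1 Q_herm).
  have <- : (fun z => z ^+ 0 *: R z) = R by apply: funext => z; rewrite expr0 scale1r.
  rewrite -nk0; exact: kerT.
move=> lambda kappa [Wm [Wp [Wm_ext Wm_infty Wp_disc WH]]] [kappa_sorted kappa_perm].
rewrite R_def in WH.
(* The state space and the index computation of the same kernel meet here; nonnegative indices
   contribute nothing for any [k]. *)
have nkE k : nk k = (\sum_(j <- kappa) (j - k))%N.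
  rewrite -(sum_index_defect k kappa_perm).
  exact: (nullity_indices Av_s A_s Uv U V_disc W_disc Omega_eq C0_def Q_eq
    Wm_ext Wm_infty Wp_disc WH k).
have muE k : (0 < k)%N -> mu k = (count (leq k) kappa)%:Z.
  move=> k0; rewrite -[mu k]/((nk k.-1)%:Z - (nk k)%:Z) (nkE k.-1) (nkE k).
  exact: sum_subn_diff.
split=> [k _||j]; first exact: kerT.
  rewrite (muE 1%N isT); suff /eqP -> : count (leq 1) kappa == size kappa by [].
  (* [mu 1] counts the entries that are at least 1, and these are all entries of [kappa]. *)
  rewrite -all_count; apply/allP => j.
  exact: negative_index_pos kappa_perm.
exact: (conjugate_partition kappa_sorted muE).
Qed.
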